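(* (i) Let $\phi:(\mathbb{P}^1_{\mathbb{C}})^3\dashrightarrow\mathbb{P}^3_{\mathbb{C}}$ be a general real trilinear birational map of type $(1,1,2)$ with parametric line congruences $S,T,U$, and let $a,b\subset\mathbb{P}^3_{\mathbb{C}}$ be the distinct coplanar lines and $c\subset\mathbb{P}^3_{\mathbb{C}}$ the plane conic, with $a\cap c$ and $b\cap c$ points, such that (up to interchanging $a$ and $b$) the focal curves of $S$ are $a$ and $c$, the focal curves of $T$ are $b$ and $c$, and $U$ has the single focal point $a\cap b$. Then the three curves $a,b,c$ are real. (ii) For every (not necessarily general) real trilinear birational map of type $(1,1,2)$, with parametric line congruences $S,T,U$, there are distinct lines $a,b$ intersecting in a point $O=a\cap b$ and a plane conic $c$ in $\mathbb{P}^3_{\mathbb{C}}$ such that, up to permutation of the factors of $\mathbb{P}^1_{\mathbb{C}}\times\mathbb{P}^1_{\mathbb{C}}\times\mathbb{P}^1_{\mathbb{C}}$ (and the corresponding permutation of the congruences), one of the following holds: 1. (General) The conic $c$ is smooth and $O\notin c$; $S$ is quadratic with focal curves $b$ and $c$; $T$ is quadratic with focal curves $a$ and $c$. 2. The conic $c$ is smooth and $O\in c$; $S$ is quadratic with focal curves $b$ and $c$; $T$ is quadratic with focal curves $a$ and $c$. 3. The conic $c=x\cup y$ is reducible and the four lines $a,b,x,y$ are distinct; $S$ is hyperbolic linear with focal lines $b$ and $x$; $T$ is hyperbolic linear with focal lines $a$ and $y$. 4. The conic $c=x\cup y$ is reducible and $y\leadsto a$; $S$ is hyperbolic linear with focal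 lines $b$ and $x$; $T$ is parabolic linear with focal line $a$. 5. The conic $c=x\cup y$ is reducible, $y\leadsto a$ and $x\leadsto b$; $S$ is parabolic linear with focal line $2b$; $T$ is parabolic linear with focal line $2a$.
   Context: A variety $X\subset\mathbb{P}^n_{\mathbb{C}}$ is real if $X=\overline{X}$. Let $Q\subset\mathbb{P}^5_{\mathbb{C}}=\mathbb{P}(\bigwedge^2\mathbb{C}^4)$ be the Klein quadric, parametrizing lines in $\mathbb{P}^3_{\mathbb{C}}$ by Plücker coordinates. A line congruence is an algebraic surface $X\subset Q$; it is real if $X$ is real and its real locus $X(\mathbb{R})$ has real dimension $2$. A (irreducible) variety $V\subset\mathbb{P}^3_{\mathbb{C}}$ is focal for $X$ if $V\cap x\neq\varnothing$ for every line $x\in X$ and $V$ is minimal with this property (no proper subvariety of $V$ has it). A real line congruence $X$ is: linear if it is contained in a 3-plane of $\mathbb{P}^5_{\mathbb{C}}$; hyperbolic linear if it is linear with two skew real focal lines; parabolic linear if it is linear with a single focal line (limit case of two skew focal lines); quadratic if it has a focal plane conic and a focal line intersecting the conic; degenerate if it has a single focal point. Notation $y\leadsto x$: this denotes the limiting configuration in which the line $y$ has become infinitely near to $x$ through some smooth quadric surface $G\subset\mathbb{P}^3_{\mathbb{C}}$ (flat limit of two skew lines of one ruling), i.e. the two lines are replaced by the double line supported on $x$ and contained in $G$, denoted $2x$; the corresponding parabolic linear congruence consists of the lines $\ell$ through a point $P\in x$ which are tangent to $G$ at $P$ ($\ell\subset T_PG$). A trilinear rational map is a rational map $\phi:(\mathbb{P}^1_{\mathbb{C}})^3\dashrightarrow\mathbb{P}^3_{\mathbb{C}}$,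 $(s_0:s_1)\times(t_0:t_1)\times(u_0:u_1)\mapsto(f_0:f_1:f_2:f_3)$, with $f_i$ trilinear in the three pairs of variables and without common factor. It is real if all $f_i$ have real coefficients. It is birational if it has a rational inverse $\phi^{-1}=(\sigma_0:\sigma_1)\times(\tau_0:\tau_1)\times(\upsilon_0:\upsilon_1)$, where each pair consists of homogeneous polynomials in $x_0,\dots,x_3$ of the same degree without common factor; its type is $(\deg\sigma_i,\deg\tau_j,\deg\upsilon_k)$. An $s$-line is the image of the restriction of $\phi$ to a fixed value of $(t_0:t_1)\times(u_0:u_1)$; $t$- and $u$-lines are defined analogously. The parametric line congruences $S,T,U$ of $\phi$ are the line congruences defined by (the closures in $Q$ of) the families of $s$-, $t$- and $u$-lines, respectively. ''General'' means: in a nonempty Zariski open subset of the variety of (real) trilinear birational maps of the given type. *)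

(* Defs.v *)
From mathcomp Require Import all_boot all_order all_fingroup all_algebra.
From mathcomp Require Import boolp classical_sets reals mpoly complex.
Set Implicit Arguments.
Unset Strict Implicit.
Unset Printing Implicit Defensive.
Import GRing.Theory.
Local Open Scope ring_scope.
Local Open Scope classical_set_scope.

(* A subset of the projective space P^(n-1) over K is given by its set of
   representatives in K^n; every set below is stable under nonzero scaling and
   does not contain 0, so that equality of such sets is equality of subsets of
   projective space. *)

Section Zariski.
Variables (K : fieldType) (n : nat).
Implicit Types (F : {mpoly K[n]}) (X Y Z : set 'rV[K]_n).

Definition evalv F (v : 'rV[K]_n) : K := F.@[v 0].

Definition zeros (I : set {mpoly K[n]}) : set 'rV[K]_n :=
  [set v | v != 0 /\ forall F, I F -> evalv F v = 0].

Definition zclosed X : Prop :=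
  exists I : set {mpoly K[n]},
    (forall F, I F -> exists d : nat, F \is d.-homog) /\ X = zeros I.

Definition zclosure X : set 'rV[K]_n := smallest zclosed X.

Definition zopen_in (B W : set 'rV[K]_n) : Prop :=
  exists2 Z : set 'rV[K]_n, zclosed Z & W = B `\` Z.

(* Varieties are irreducible. *)
Definition variety X : Prop :=
  [/\ zclosed X, X !=set0 &
      forall Y Z, zclosed Y -> zclosed Z ->
        X `<=` Y `|` Z -> X `<=` Y \/ X `<=` Z].

Definition variety_chain X (d : nat) : Prop :=
  exists Z : nat -> set 'rV[K]_n,
    (forall i, (i <= d)%N -> variety (Z i) /\ Z i `<=` X) /\
    (forall i, (i < d)%N -> Z i `<` Z i.+1).

(* Krull dimension of X with its Zariski topology; over a real closed field this
   is the usual dimension of a real algebraic set. *)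
Definition zdim X (d : nat) : Prop :=
  variety_chain X d /\ ~ variety_chain X d.+1.

Definition flat (k : nat) (M : 'M[K]_(k, n)) : set 'rV[K]_n :=
  [set v | v != 0 /\ (v <= M)%MS].

Definition is_flat (k : nat) X : Prop :=
  exists2 M : 'M[K]_(k.+1, n), row_free M & X = flat M.

Definition is_point X : Prop := is_flat 0 X.
Definition is_line X : Prop := is_flat 1 X.
Definition is_plane X : Prop := is_flat 2 X.

Definition grad F (v : 'rV[K]_n) : 'rV[K]_n := \row_i evalv (F^`M(i)) v.

Definition no_common_factor (I : Type) (F : I -> {mpoly K[n]}) : Prop :=
  forall g, (forall i, exists h, F i = g * h) ->
    exists2 k : K, k != 0 & g = k%:MP.

End Zariski.

Section ProjectiveThreeSpace.
Variable K : fieldType.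
Implicit Types (a b c V : set 'rV[K]_4) (X : set 'rV[K]_6).

Definition skew a b : Prop := a `&` b = set0.

Definition coplanar a b : Prop :=
  exists2 H : set 'rV[K]_4, is_plane H & a `<=` H /\ b `<=` H.

(* Conics are reduced: the last two conditions exclude that the quadratic form q
   vanishes on the plane l = 0, or restricts there to the square of a linear
   form. *)
Definition is_plane_conic c : Prop :=
  exists l q : {mpoly K[4]},
    [/\ l \is 1.-homog, l != 0, q \is 2.-homog & c = zeros [set l; q]] /\
    (c <> zeros [set l] /\ ~ is_line c).

Definition smooth_plane_conic c : Prop :=
  exists l q : {mpoly K[4]},
    [/\ l \is 1.-homog, l != 0, q \is 2.-homog, c = zeros [set l; q] &
        forall P, c P -> row_free (col_mx (grad l P) (grad q P))].

Definition smooth_quadric (q : {mpoly K[4]}) : Prop :=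
  q \is 2.-homog /\ forall P, zeros [set q] P -> grad q P != 0.

Definition tangent_plane (q : {mpoly K[4]}) (P : 'rV[K]_4) : set 'rV[K]_4 :=
  [set v | v != 0 /\ grad q P *m v^T = 0].

(* Pluecker coordinates are ordered p01, p02, p03, p12, p13, p23. *)
Definition pl_pair : 6.-tuple ('I_4 * 'I_4) :=
  [tuple (0, 1); (0, 2); (0, 3); (1, 2); (1, 3); (2, 3)].

Definition pluecker (M : 'M[K]_(2, 4)) : 'rV[K]_6 :=
  \row_k (let: (i, j) := tnth pl_pair k in M 0 i * M 1 j - M 0 j * M 1 i).

Definition klein : set 'rV[K]_6 :=
  [set w : 'rV[K]_6 | w != 0 /\ w 0 0 * w 0 5 - w 0 1 * w 0 4 + w 0 2 * w 0 3 = 0].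

(* The line of P^3 with Pluecker coordinates w, for w in klein. *)
Definition line_of (w : 'rV[K]_6) : set 'rV[K]_4 :=
  [set v | exists2 M : 'M[K]_(2, 4), pluecker M = w & flat M v].

Definition meets_all V X : Prop :=
  forall w, X w -> V `&` line_of w !=set0.

Definition focal X V : Prop :=
  [/\ variety V, meets_all V X &
      forall W, variety W -> W `<` V -> ~ meets_all W X].

Definition focal_points X : set (set 'rV[K]_4) :=
  [set V | is_point V /\ focal X V].
Definition focal_lines X : set (set 'rV[K]_4) :=
  [set V | is_line V /\ focal X V].
Definition focal_curves X : set (set 'rV[K]_4) :=
  [set V | zdim V 1 /\ focal X V].

Definition linear_congruence X : Prop :=
  exists2 L : set 'rV[K]_6, is_flat 3 L & X `<=` L.

(* For a line x contained in the smooth quadric q = 0, this is the limit of the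
   congruence of the lines meeting x and y, when the line y tends to x in the
   ruling of x: it is determined by the double line 2x on the quadric. *)
Definition tangent_congruence (q : {mpoly K[4]}) (x : set 'rV[K]_4) :
    set 'rV[K]_6 :=
  [set w | klein w /\
     exists P, [/\ x P, line_of w P & line_of w `<=` tangent_plane q P]].

(* X has the double line 2x, contained in some smooth quadric, as focal line. *)
Definition double_focal_line X (x : set 'rV[K]_4) : Prop :=
  exists q : {mpoly K[4]},
    [/\ smooth_quadric q, x `<=` zeros [set q] & X = tangent_congruence q x].

End ProjectiveThreeSpace.

Section Real.
Variable R : realType.
Implicit Type X : set 'rV[R[i]]_6.

Definition is_real (n : nat) (X : set 'rV[R[i]]_n) : Prop :=
  map_mx (@conjc R) @^-1` X = X.

Definition real_locus (n : nat) (X : set 'rV[R[i]]_n) : set 'rV[R]_n :=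
  map_mx (real_complex R) @^-1` X.

Definition real_line_congruence X : Prop :=
  [/\ X `<=` @klein R[i], variety X, zdim X 2, is_real X &
      zdim (real_locus X) 2].

Definition hyperbolic_linear X : Prop :=
  [/\ real_line_congruence X, linear_congruence X &
      exists l m : set 'rV[R[i]]_4,
        [/\ is_real l, is_real m, skew l m & focal_lines X = [set l; m]]].

Definition parabolic_linear X : Prop :=
  [/\ real_line_congruence X, linear_congruence X &
      exists l : set 'rV[R[i]]_4, focal_lines X = [set l]].

Definition quadratic X : Prop :=
  real_line_congruence X /\
  exists c l : set 'rV[R[i]]_4,
    [/\ is_plane_conic c, focal X c, is_line l, focal X l & l `&` c !=set0].

End Real.

Section Trilinear.
Variable K : fieldType.

(* The monomial s_(j 0) t_(j 1) u_(j 2) has multi-index j. *)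
Definition multi_index := {ffun 'I_3 -> 'I_2}.

Definition ncoef : nat := (4 * #|{: multi_index}|)%N.

(* A 4-tuple of trilinear forms is given by its vector of coefficients. *)
Definition coef (w : 'rV[K]_ncoef) (i : 'I_4) (j : multi_index) : K :=
  w 0 (mxvec_index i (enum_rank j)).

Definition pair_var (k : 'I_3) (e : 'I_2) : 'I_(3 * 2) := mxvec_index k e.

Definition tri_poly (w : 'rV[K]_ncoef) (i : 'I_4) : {mpoly K[3 * 2]} :=
  \sum_(j : multi_index) coef w i j *: \prod_(k < 3) 'X_(pair_var k (j k)).

(* The rows of x are the three points (s0 : s1), (t0 : t1), (u0 : u1). *)
Definition tri_map (w : 'rV[K]_ncoef) (x : 'M[K]_(3, 2)) : 'rV[K]_4 :=
  \row_i evalv (tri_poly w i) (mxvec x).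

Definition in_P1x3 (x : 'M[K]_(3, 2)) : Prop := forall k, row k x != 0.

Definition subst_tri (w : 'rV[K]_ncoef) (p : {mpoly K[4]}) : {mpoly K[3 * 2]} :=
  p \mPo [tuple tri_poly w i | i < 4].

Definition subst_pairs (psi : 'M[{mpoly K[4]}]_(3, 2)) (p : {mpoly K[3 * 2]}) :
    {mpoly K[4]} :=
  p \mPo [tuple mxvec psi 0 z | z < 3 * 2].

(* The rows of psi are the pairs (sigma_0, sigma_1), (tau_0, tau_1),
   (upsilon_0, upsilon_1); both composites are the identity as rational maps. *)
Definition rational_inverse (w : 'rV[K]_ncoef) (psi : 'M[{mpoly K[4]}]_(3, 2)) :
    Prop :=
  [/\ forall k, exists e, subst_tri w (psi k e) != 0,
      forall k, subst_tri w (psi k 0) * 'X_(pair_var k 1) =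
                subst_tri w (psi k 1) * 'X_(pair_var k 0),
      exists i, subst_pairs psi (tri_poly w i) != 0 &
      forall i j, subst_pairs psi (tri_poly w i) * 'X_j =
                  subst_pairs psi (tri_poly w j) * 'X_i].

Definition birational_of_type (d : 'I_3 -> nat) (w : 'rV[K]_ncoef) : Prop :=
  no_common_factor (tri_poly w) /\
  exists psi : 'M[{mpoly K[4]}]_(3, 2),
    [/\ rational_inverse w psi,
        forall k e, psi k e \is (d k).-homog &
        forall k, no_common_factor (psi k)].

(* The image of the restriction of the map to the line through x in the k-th
   factor; rescaling row k of y rescales tri_map w y. *)
Definition param_line (w : 'rV[K]_ncoef) (k : 'I_3) (x : 'M[K]_(3, 2)) :
    set 'rV[K]_4 :=
  [set v | v != 0 /\
     exists y, [/\ in_P1x3 y, forall l, l != k -> row l y = row l x &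
                   v = tri_map w y]].

Definition param_congruence (w : 'rV[K]_ncoef) (k : 'I_3) : set 'rV[K]_6 :=
  zclosure [set p | @klein K p /\
              exists2 x, in_P1x3 x & line_of p = param_line w k x].

End Trilinear.

Definition type112 (k : 'I_3) : nat := tnth [tuple 1; 1; 2]%N k.

Definition cplx (R : realType) (w : 'rV[R]_ncoef) : 'rV[R[i]]_ncoef :=
  map_mx (real_complex R) w.

Definition real_birational_maps (R : realType) (d : 'I_3 -> nat) :
    set 'rV[R]_ncoef :=
  [set w | birational_of_type d (cplx w)].

Arguments real_birational_maps : clear implicits.

Definition focal_configuration (R : realType) (w : 'rV[R]_ncoef)
    (a b c : set 'rV[R[i]]_4) : Prop :=
  let S := param_congruence (cplx w) 0 in
  let T := param_congruence (cplx w) 1 in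
  let U := param_congruence (cplx w) 2 in
  [/\ is_line a, is_line b, a <> b & coplanar a b] /\
  [/\ is_plane_conic c, is_point (a `&` c) & is_point (b `&` c)] /\
  [/\ focal_curves S = [set a; c] /\ focal_curves T = [set b; c] \/
      focal_curves S = [set b; c] /\ focal_curves T = [set a; c] &
      focal_points U = [set a `&` b]].

(* Main.v *)
Require Import Defs.
From mathcomp Require Import all_boot all_order all_fingroup all_algebra.
From mathcomp Require Import boolp classical_sets reals mpoly complex.
From mathcomp Require Import ring zify.
Set Implicit Arguments.
Unset Strict Implicit.
Unset Printing Implicit Defensive.
Import Order.TTheory GRing.Theory Num.Theory.
Local Open Scope ring_scope.
Local Open Scope classical_set_scope.

(* Write the degree 1 components of the inverse as (L0 : L1) and (M0 : M1); then
   L o phi = (s0, s1) A(t, u) and M o phi = (t0, t1) B(s, u). The degree 2 component is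
   in lowest terms, so no nonzero pair of linear forms satisfies
   l0(phi) u1 = l1(phi) u0; applied to the comparison of A and B this forces
   A = t'(t) C(u) and B = s'(s) C(u). In suitable real coordinates phi is therefore
     (s0 t0 u0, s1 t0 u0, s0 t1 u0, u0 d(s,t) + u1 e(s,t))
   with bilinear d and e, and shears of the coordinates leave five forms of (d, e). For
   each of them S and T are linear pullbacks of one of three explicit surfaces: the lines
   meeting two skew lines, the lines tangent to a quadric along one of its lines, and the
   joins of a conic with a line meeting it. Their focal loci are computed directly; the
   dimension of a variety is bounded by counting independent forms along a chain, and
   the focal curves of the last surface are found by projecting from a point of the conic.
   For part (i), det e != 0 leaves the two forms with a smooth conic, whose focal curves
   are real, and det e = 0 implies the vanishing of the resultant in u of the
   determinants of two of the components of phi seen as bilinear forms in s and t. *)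

(** Dimension, irreducibility and reality are properties of sets of points, and [R] is not
    algebraically closed, so on the real locus no dictionary between ideals and closed sets can be
    invoked. This is why the surfaces are treated over an arbitrary [numFieldType]: the closure of a
    polynomial image is irreducible because its forms pull back to an integral domain, and one
    statement then serves for [R[i]] and for the real locus. Limits are taken algebraically, along
    polynomial curves. The given inverse has complex coefficients. Its linear components descend
    because the equations of a pencil are real, hence hold for the real and the imaginary parts
    separately; the component of degree 2 stays complex, and excludes linear pencils for u as well
    as fibres u = const on which phi vanishes. At u0 = 0 the normal form is e(s,t) times a constant
    vector, so all components have there a bilinear form proportional to e; for det e = 0 this u is
    a common root of their determinants. The two components entering the resultant are chosen so
    that it is nonzero for one explicit map. *)

Section LastVariable.
Variables (R : idomainType) (n : nat).

Let widened : n.-tuple {mpoly R[n.+1]} := [tuple 'X_(widen_ord (leqnSn n) i) | i < n].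

(** A ring morphism from polynomials over n variables onto polynomials in n + 1 variables. Its
    surjectivity drives two inductions on the number of variables: the vanishing criterion below and
    the Hilbert basis theorem. *)
Definition mpoly_of_poly (P : {poly {mpoly R[n]}}) : {mpoly R[n.+1]} :=
  (map_poly (comp_mpoly widened) P).['X_ord_max].

Lemma mpoly_of_polyD : {morph mpoly_of_poly : P Q / P + Q}.
Proof. by move=> P Q; rewrite /mpoly_of_poly rmorphD hornerD. Qed.

Lemma mpoly_of_polyM : {morph mpoly_of_poly : P Q / P * Q}.
Proof. by move=> P Q; rewrite /mpoly_of_poly rmorphM hornerM. Qed.

Lemma mpoly_of_poly0 : mpoly_of_poly 0 = 0.
Proof. by rewrite /mpoly_of_poly rmorph0 horner0. Qed.

Lemma mpoly_of_polyC p : mpoly_of_poly p%:P = p \mPo widened.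
Proof. by rewrite /mpoly_of_poly map_polyC hornerC. Qed.

Lemma mpoly_of_polyX : mpoly_of_poly 'X = 'X_ord_max.
Proof. by rewrite /mpoly_of_poly map_polyX hornerX. Qed.

Lemma mpoly_of_poly_onto p : exists P, p = mpoly_of_poly P.
Proof.
have XP i : exists P, 'X_i = mpoly_of_poly P.
  have [ltin|] := ltnP i n; last first.
    move=> leni; exists 'X; rewrite mpoly_of_polyX; suff -> : i = ord_max by [].
    by apply: val_inj; apply/eqP; rewrite eqn_leq leni -ltnS ltn_ord.
  exists ('X_(Ordinal ltin))%:P.
  rewrite mpoly_of_polyC comp_mpolyXU -tnth_nth tnth_mktuple.
  by suff -> : widen_ord (leqnSn n) (Ordinal ltin) = i by []; apply: val_inj.
have prodP (r : seq 'I_n.+1) (m : 'X_{1..n.+1}) :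
    exists P, \prod_(i <- r) 'X_i ^+ m i = mpoly_of_poly P.
  elim: r => [|i r [P IH]].
    exists 1%:P; by rewrite big_nil mpoly_of_polyC comp_mpoly1.
  have [Q HQ] : exists Q, 'X_i ^+ m i = mpoly_of_poly Q.
    have [Q HQ] := XP i; elim: (m i) => [|k [Q' HQ']].
      by exists 1%:P; rewrite expr0 mpoly_of_polyC comp_mpoly1.
    by exists (Q * Q'); rewrite exprS HQ' HQ mpoly_of_polyM.
  by exists (Q * P); rewrite big_cons IH HQ mpoly_of_polyM.
elim/mpolyind: p => [|c m p _ _ [P ->]]; first by exists 0; rewrite mpoly_of_poly0.
rewrite mpolyXE_id; have [Q ->] := prodP (index_enum _) m.
exists (c%:MP%:P * Q + P).
by rewrite mpoly_of_polyD mpoly_of_polyM mpoly_of_polyC comp_mpolyC mul_mpolyC.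
Qed.

Lemma meval_mpoly_of_poly (v : 'I_n.+1 -> R) P :
  (mpoly_of_poly P).@[v] =
  (map_poly (meval (fun i => v (widen_ord (leqnSn n) i))) P).[v ord_max].
Proof.
rewrite /mpoly_of_poly -(horner_map (meval v)) /= mevalXU -map_poly_comp.
congr (_.[_]); apply: eq_map_poly => p /=; rewrite comp_mpoly_meval.
by apply: meval_eq => i; rewrite tnth_mktuple mevalXU.
Qed.

End LastVariable.

(** Induction on the number of variables: at natural values of the first n variables, what remains
    is a univariate polynomial with too many roots. Natural points matter because they are real:
    they also test complex polynomials on real parameters. *)
Lemma mpoly_nat_eq0 (R : numDomainType) n (p : {mpoly R[n]}) :
  (forall v : 'I_n -> nat, p.@[fun i => (v i)%:R] = 0) -> p = 0.
Proof.
elim: n p => [|n IH] p Hp.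
  have := Hp (fun _ => 0%N); rewrite (nvar0_mpolyC p) mevalC => ->.
  by rewrite mpolyC0.
have [P pE] := mpoly_of_poly_onto p; rewrite pE.
suff -> : P = 0 by rewrite mpoly_of_poly0.
apply/polyP => j; rewrite coef0; apply: IH => v.
set Q := map_poly (meval (fun i => (v i)%:R)) P.
suff Q0 : Q = 0 by rewrite -coef_map -/Q Q0 coef0.
apply/eqP/negPn/negP => Qn0.
(* The naturals below [size Q] are [size Q] distinct roots, one more than a nonzero [Q] can have. *)
have := max_poly_roots Qn0 (rs := [seq k%:R | k <- iota 0 (size Q)]).
rewrite size_map size_iota ltnn map_inj_uniq ?iota_uniq; last first.
  by move=> a b /eqP; rewrite eqr_nat => /eqP.
suff -> : all (root Q) [seq k%:R | k <- iota 0 (size Q)] by move=> /(_ isT isT).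
apply/allP => _ /mapP[k _ ->]; apply/eqP.
pose w (i : 'I_n.+1) := if insub (val i) is Some j then v j else k.
have := Hp w; rewrite pE meval_mpoly_of_poly => <-.
have -> : w ord_max = k by rewrite /w insubF //= ltnn.
congr (_.[_]); apply: eq_map_poly => q; apply: meval_eq => i.
by rewrite /w insubT //= => lti; congr (v _)%:R; apply: val_inj.
Qed.

Lemma mpoly_eval_eq0 (K : numFieldType) n (p : {mpoly K[n]}) :
  (forall v, p.@[v] = 0) -> p = 0.
Proof. by move=> H; apply: mpoly_nat_eq0. Qed.

(** * Closed sets and dimension *)

Section Vanishing.
Variables (K : fieldType) (n : nat).
Implicit Types (F G : {mpoly K[n]}) (X Y Z V : set 'rV[K]_n) (v : 'rV[K]_n).

Definition is_form F : Prop := exists d : nat, F \is d.-homog.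

Definition vanishes X F : Prop := forall v, X v -> evalv F v = 0.

Lemma evalvM F G v : evalv (F * G) v = evalv F v * evalv G v.
Proof. exact: mevalM. Qed.

Lemma evalvX i v : evalv 'X_i v = v 0 i.
Proof. exact: mevalXU. Qed.

Lemma evalv_scale d F a v : F \is d.-homog -> evalv F (a *: v) = a ^+ d * evalv F v.
Proof.
move=> /dhomogP homF; rewrite /evalv !mevalE mulr_sumr.
apply: eq_big_seq => m /homF <-; rewrite mulrCA; congr (_ * _).
rewrite /= mdegE -prodrXr -big_split /=; apply: eq_bigr => i _.
by rewrite mxE exprMn.
Qed.

Lemma is_formM F G : is_form F -> is_form G -> is_form (F * G).
Proof. by move=> [d hF] [e hG]; exists (d + e)%N; apply: dhomogM. Qed.

Lemma is_formX (i : 'I_n) : is_form 'X_i.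
Proof. by exists 1%N; rewrite dhomogX /= mdeg1. Qed.

Lemma zclosedP X : zclosed X <->
  X = [set v | v != 0 /\ forall F, is_form F -> vanishes X F -> evalv F v = 0].
Proof.
split=> [[I [homI XE]]|XE]; last first.
  by exists [set F | is_form F /\ vanishes X F]; split=> [F []//|]; rewrite {1}XE;
     apply/seteqP; split=> v [v0 Hv]; split=> // F; [case | move=> hF hX]; apply: Hv.
apply/seteqP; split=> v.
  by move=> Xv; split; [move: Xv; rewrite XE => -[] | move=> F _ /(_ _ Xv)].
move=> [v0 Hv]; rewrite XE; split=> // F IF; apply: Hv; first exact: homI.
by move=> w; rewrite XE => -[_ /(_ F IF)].
Qed.

Lemma zclosed_neq0 X v : zclosed X -> X v -> v != 0.
Proof. by move=> [I [_ ->]] []. Qed.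

Lemma zclosed_mem X v : zclosed X -> v != 0 ->
  (forall F, is_form F -> vanishes X F -> evalv F v = 0) -> X v.
Proof. by move=> /zclosedP XE v0 Hv; rewrite XE. Qed.

Lemma zclosed_sub_vanishes X Y : zclosed X -> zclosed Y ->
  (forall F, is_form F -> vanishes Y F -> vanishes X F) -> X `<=` Y.
Proof.
move=> cX cY H v Xv; apply: zclosed_mem => //; first exact: zclosed_neq0 Xv.
by move=> F hF vF; apply: (H F).
Qed.

Lemma zclosed_not_sub X Y : zclosed X -> zclosed Y -> ~ (X `<=` Y) ->
  exists F, [/\ is_form F, vanishes Y F & ~ vanishes X F].
Proof.
move=> cX cY nXY; apply: contrapT => nex; apply: nXY.
apply: zclosed_sub_vanishes => // F hF vF; apply: contrapT => nv.
by apply: nex; exists F.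
Qed.

Lemma zclosed_scale X a v : zclosed X -> a != 0 -> X v -> X (a *: v).
Proof.
move=> cX a0 Xv; apply: zclosed_mem => //.
  by rewrite scaler_eq0 negb_or a0 (zclosed_neq0 cX Xv).
by move=> F [d hF] vF; rewrite (evalv_scale _ _ hF) vF ?mulr0.
Qed.

Lemma zclosed_scaleE X a v : zclosed X -> a != 0 -> X (a *: v) <-> X v.
Proof.
move=> cX a0; split; last exact: zclosed_scale.
move=> /(zclosed_scale cX (a := a^-1)); rewrite invr_eq0 scalerA mulVf // scale1r.
exact.
Qed.

Lemma zclosed_zeros (I : set {mpoly K[n]}) :
  (forall F, I F -> is_form F) -> zclosed (zeros I).
Proof. by move=> hI; exists I. Qed.

Lemma zclosed_zeros1 F : is_form F -> zclosed (zeros [set F]).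
Proof. by move=> hF; apply: zclosed_zeros => _ ->. Qed.

Lemma zclosedI X Y : zclosed X -> zclosed Y -> zclosed (X `&` Y).
Proof.
move=> [I [hI ->]] [J [hJ ->]]; exists (I `|` J); split=> [F [/hI|/hJ]//|].
apply/seteqP; split=> v.
  by move=> [[v0 H1] [_ H2]]; split=> // F; case=> [/H1|/H2].
by move=> [v0 H]; split; split=> // F IF; apply: H; [left|right].
Qed.

Lemma zclosed_bigcap (A : set (set 'rV[K]_n)) :
  (forall X, A X -> zclosed X) -> A !=set0 -> zclosed (\bigcap_(X in A) X).
Proof.
move=> cA [X0 AX0]; exists [set F | is_form F /\ exists2 X, A X & vanishes X F].
split=> [F []//|]; apply/seteqP; split=> v.
  move=> Hv; split; first exact: zclosed_neq0 (cA _ AX0) (Hv _ AX0).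
  by move=> F [hF [X AX]]; apply; apply: Hv.
move=> [v0 Hv] X AX; apply: zclosed_mem => //; first exact: cA.
by move=> F hF vF; apply: Hv; split=> //; exists X.
Qed.

Lemma zclosed_all : zclosed [set v : 'rV[K]_n | v != 0].
Proof.
exists set0; split=> //; apply/seteqP; split=> v /=; last by case.
by move=> v0; split.
Qed.

Lemma zclosed_zclosure X : (forall v, X v -> v != 0) -> zclosed (zclosure X).
Proof.
move=> X0; apply: (@zclosed_bigcap [set Y | zclosed Y /\ X `<=` Y]).
  by move=> Y [].
by exists [set v | v != 0]; split=> //; exact: zclosed_all.
Qed.

Lemma zclosure_sub X Y : zclosed Y -> X `<=` Y -> zclosure X `<=` Y.
Proof. by move=> cY XY v; apply. Qed.

Lemma sub_zclosure X : X `<=` zclosure X.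
Proof. by move=> v Xv Y [_]; apply. Qed.

Lemma variety_closed V : variety V -> zclosed V.
Proof. by case. Qed.

Lemma variety_vanishesM V F G : variety V -> is_form F -> is_form G ->
  vanishes V (F * G) -> vanishes V F \/ vanishes V G.
Proof.
move=> [cV _ irrV] hF hG vFG.
have [||v Vv|h|h] := irrV (zeros [set F]) (zeros [set G]);
  try exact: zclosed_zeros1.
- have v0 := zclosed_neq0 cV Vv.
  have /eqP := vFG v Vv; rewrite evalvM mulf_eq0 => /orP[]/eqP Ev.
    by left; split=> // _ ->.
  by right; split=> // _ ->.
- by left=> v /h[_]; apply.
- by right=> v /h[_]; apply.
Qed.

(** Primeness of the vanishing ideal, tested on forms only: if neither of two closed sets covering
    [V] contains it, each is cut by a form not vanishing on [V], and the product of the two forms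
    vanishes on [V]. *)
Lemma variety_of_vanishesM V : zclosed V -> V !=set0 ->
  (forall F G, is_form F -> is_form G -> vanishes V (F * G) ->
     vanishes V F \/ vanishes V G) -> variety V.
Proof.
move=> cV V0 H; split=> // Y Z cY cZ VYZ; apply: contrapT => /not_orP[nY nZ].
have [F [hF vF nF]] := zclosed_not_sub cV cY nY.
have [G [hG vG nG]] := zclosed_not_sub cV cZ nZ.
have [] // := H F G hF hG.
by move=> v /VYZ[/vF E|/vG E]; rewrite evalvM E ?mul0r ?mulr0.
Qed.

Lemma variety_chainS V d : variety_chain V d.+1 ->
  exists Z W, [/\ variety Z, W `<` Z, variety_chain W d & Z `<=` V].
Proof.
move=> [Z [HZ HZs]]; exists (Z d.+1), (Z d).
have [vZ ZV] := HZ d.+1 (leqnn _); split=> //; first exact: HZs.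
exists Z; split=> i lid; last by apply: HZs; apply: ltnW.
split; first by case: (HZ i (leqW lid)).
rewrite leq_eqVlt in lid; case/predU1P: lid => [->//|].
elim: d {HZ vZ ZV} HZs => // d IH HZs; rewrite ltnS leq_eqVlt => /predU1P[->|lt].
  by case: (HZs d ltac:(by rewrite ltnW)).
apply: (subset_trans (IH _ lt)); last by case: (HZs d ltac:(by rewrite ltnW)).
by move=> j ltj; apply: HZs; apply: ltnW.
Qed.

End Vanishing.

(** * Hilbert functions along a chain of varieties *)

Section Dimension.
Variables (K : fieldType) (n : nat).
Implicit Types (F G : {mpoly K[n]}) (X Y Z V : set 'rV[K]_n) (v : 'rV[K]_n).

Lemma evalvD F G v : evalv (F + G) v = evalv F v + evalv G v.
Proof. exact: mevalD. Qed.

Lemma evalvZ c F v : evalv (c *: F) v = c * evalv F v.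
Proof. exact: mevalZ. Qed.

Lemma evalv_sum (I : Type) (r : seq I) (P : pred I) (F : I -> {mpoly K[n]}) v :
  evalv (\sum_(i <- r | P i) F i) v = \sum_(i <- r | P i) evalv (F i) v.
Proof. exact: raddf_sum. Qed.

Lemma evalvXn F m v : evalv (F ^+ m) v = evalv F v ^+ m.
Proof. exact: rmorphXn. Qed.

(** A lower bound [r] for the Hilbert function of [X] in degree [e]: independence is modulo the
    forms vanishing on [X]. *)
Definition indep_forms X (e r : nat) : Prop :=
  exists G : 'I_r -> {mpoly K[n]}, (forall i, G i \is e.-homog) /\
    forall x : 'I_r -> K, vanishes X (\sum_i x i *: G i) -> forall i, x i = 0.

Lemma indep_forms_le X e r r' : (r' <= r)%N -> indep_forms X e r -> indep_forms X e r'.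
Proof.
move=> le_r [G [hG iG]]; exists (fun i => G (widen_ord le_r i)); split=> // x Hx i.
pose y (j : 'I_r) := if insub (val j) is Some i then x i else 0.
have yE i' : y (widen_ord le_r i') = x i'.
  by rewrite /y /= valK.
rewrite -yE; apply: iG => v Xv; rewrite -[RHS](Hx v Xv); congr evalv.
rewrite (bigID (fun j : 'I_r => (j < r')%N)) /= [X in _ + X]big1 ?addr0; last first.
  by move=> j nj; rewrite /y insubF ?scale0r //; apply: negbTE.
rewrite (big_ord_narrow le_r); apply: eq_bigr => i' _; congr (_ *: _).
exact: yE.
Qed.

(** Since [Z] is irreducible, multiplication by [F] is injective modulo the forms vanishing on [Z],
    and its image vanishes on [Z']; so the two families remain independent when put together. *)
Lemma indep_forms_step Z Z' F e m r r' : variety Z ->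
  Z' `<=` Z -> F \is e.-homog -> vanishes Z' F -> ~ vanishes Z F ->
  indep_forms Z' (e + m) r' -> indep_forms Z m r -> indep_forms Z (e + m) (r' + r).
Proof.
move=> vZ sZ hF vF nF [G' [hG' iG']] [G [hG iG]].
exists (fun i => match split i with inl j => G' j | inr j => F * G j end); split.
  by move=> i; case: split => j //; apply: dhomogM.
move=> x Hx.
have xE v : evalv (\sum_i x i *: match split i with inl j => G' j | inr j => F * G j end) v
    = evalv (\sum_j x (lshift r j) *: G' j) v
      + evalv F v * evalv (\sum_j x (rshift r' j) *: G j) v.
  rewrite big_split_ord /= evalvD -evalvM; congr (evalv _ v + evalv _ v).
    by apply: eq_bigr => j _; rewrite (unsplitK (inl j)).
  rewrite [RHS]mulr_sumr; apply: eq_bigr => j _.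
  by rewrite (unsplitK (inr j)) scalerAr.
have x1 : forall j, x (lshift r j) = 0.
  apply: iG' => v Zv; have := Hx v (sZ _ Zv).
  by rewrite xE (vF v Zv) mul0r addr0.
have x2 : forall j, x (rshift r' j) = 0.
  apply: iG; have [] // := @variety_vanishesM _ _ Z F (\sum_j x (rshift r' j) *: G j) vZ.
  - by exists e.
  - by exists m; apply: rpred_sum => j _; apply: rpredZ; exact: hG.
  - move=> v Zv; have := Hx v Zv; rewrite xE big1 ?evalvM; last first.
      by move=> j _; rewrite x1 scale0r.
    by rewrite [evalv 0 v]meval0 add0r.
by move=> i; rewrite -(splitK i); case: (split i) => j /=.
Qed.

Lemma nonzero_coord v : v != 0 -> exists i, v 0 i != 0.
Proof.
move=> v0; apply: contrapT => nex; case/negP: v0; apply/eqP/rowP => i; rewrite mxE.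
by apply: contrapT => /eqP vi; apply: nex; exists i.
Qed.

(** A chain of length [d] forces the Hilbert function to grow like a polynomial of degree [d]. Only
    the multiples of one degree [e] are controlled; Pascal's rule matches the inductive step. *)
Lemma chain_indep_forms V d : variety_chain V d ->
  exists Z e, [/\ variety Z, Z `<=` V, (0 < e)%N &
                 forall q, indep_forms Z (e * q) 'C(q + d, d)].
Proof.
elim: d V => [|d IH] V.
  move=> [Z [/(_ 0%N (leqnn _))[vZ ZV] _]]; exists (Z 0%N), 1%N; split=> // q.
  have [cZ [v Zv] _] := vZ; have [i vi] := nonzero_coord (zclosed_neq0 cZ Zv).
  rewrite bin0 mul1n; exists (fun _ => 'X_i ^+ q); split.
    move=> _; rewrite -[q in X in X.-homog]mul1n; apply: dhomogMn.
    by rewrite dhomogX /= mdeg1.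
  move=> x /(_ v Zv); rewrite big_ord1 evalvZ evalvXn evalvX => /eqP.
  rewrite mulf_eq0 expf_eq0 (negPf vi) andbF orbF => /eqP x0 j.
  by rewrite (ord1 j).
move=> /variety_chainS[Z [W [vZ [WZ nWZ] /IH[W' [e [vW' W'W e0 iW']]] ZV]]].
have sW'Z := subset_trans W'W WZ.
have [F [[f hF] vF nF]] : exists F, [/\ is_form F, vanishes W' F & ~ vanishes Z F].
  apply: zclosed_not_sub; [exact: variety_closed|exact: variety_closed|].
  by move=> ZW'; apply: nWZ; apply: subset_trans W'W.
have [v Zv Fv] : exists2 v, Z v & evalv F v != 0.
  apply: contrapT => nex; apply: nF => v Zv; apply: contrapT => /eqP Fv.
  by apply: nex; exists v.
have [i vi] := nonzero_coord (zclosed_neq0 (variety_closed vZ) Zv).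
(* The factor ['X_i] makes the degree positive, and the power [e] makes it a multiple of the degree
   for which the bound on [W'] is known. *)
pose F' := (F * 'X_i) ^+ e.
have hF' : F' \is (f.+1 * e).-homog.
  by apply: dhomogMn; rewrite -addn1; apply: dhomogM => //; rewrite dhomogX /= mdeg1.
exists Z, (f.+1 * e)%N; split=> //; first by rewrite muln_gt0.
elim=> [|q IHq].
  rewrite add0n binn muln0; exists (fun _ => 1); split; first by move=> _; apply: dhomog1.
  move=> x /(_ v Zv); rewrite big_ord1 evalvZ [evalv 1 v]meval1 mulr1 => x0 j.
  by rewrite (ord1 j).
rewrite mulnS.
have -> : 'C(q.+1 + d.+1, d.+1) = ('C(q.+1 + d, d) + 'C(q + d.+1, d.+1))%N.
  by rewrite addnS binS addnC addSnnS.
apply: (indep_forms_step (F := F') vZ sW'Z hF') => //.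
- move=> u W'u; rewrite evalvXn evalvM (vF u W'u) mul0r expr0n.
  by rewrite eqn0Ngt e0.
- move=> /(_ v Zv) /eqP; rewrite evalvXn expf_eq0 evalvM evalvX mulf_eq0.
  by rewrite (negPf Fv) (negPf vi) andbF.
- rewrite -mulnS [(_ * e)%N]mulnC -mulnA; apply: indep_forms_le (iW' _).
  by apply: leq_bin2l; rewrite leq_add2r mulSn leq_addr.
Qed.

End Dimension.

(** * Dimension bound from a parametrization *)

Section Parametrization.
Variables (K : fieldType) (n k : nat).

Lemma msizeM_bound (p q : {mpoly K[k]}) D E :
  (msize p <= D.+1)%N -> (msize q <= E.+1)%N -> (msize (p * q) <= (D + E).+1)%N.
Proof.
move=> hp hq; have [->|p0] := eqVneq p 0; first by rewrite mul0r msize0.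
have [->|q0] := eqVneq q 0; first by rewrite mulr0 msize0.
rewrite msizeM //; move: (mmeasure _ p) (mmeasure _ q) hp hq => a b; lia.
Qed.

Lemma msize_comp_bound (F : {mpoly K[n]}) (p : n.-tuple {mpoly K[k]}) e D :
  F \is e.-homog -> (forall i, msize (tnth p i) <= D.+1)%N ->
  (msize (F \mPo p) <= (e * D).+1)%N.
Proof.
move=> /dhomogP hF hp; rewrite comp_mpolyEX big_seq.
apply: (big_ind (fun q : {mpoly K[k]} => msize q <= (e * D).+1)%N).
- by rewrite msize0.
- by move=> p1 p2 h1 h2; apply: leq_trans (msizeD_le _ _) _; rewrite geq_max h1.
move=> m /hF /= <-; apply: leq_trans (msizeZ_le _ _) _.
rewrite comp_mpolyX mdegE big_distrl /=.
elim/big_ind2: _ => [|p1 a p2 b h1 h2|i _]; first by rewrite msize1.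
  exact: msizeM_bound.
elim: (m i) => [|j IH]; first by rewrite expr0 msize1.
by rewrite exprS mulSn; apply: msizeM_bound.
Qed.

(** Along [p] a form of degree [e] becomes a polynomial of degree at most [e * D] in [k] variables.
    With more forms than coefficients, the coefficient matrix has a kernel, which is a relation on
    [X]. *)
Lemma indep_forms_bound (X : set 'rV[K]_n) (p : n.-tuple {mpoly K[k]}) e r D :
  (forall F, is_form F -> F \mPo p = 0 -> vanishes X F) ->
  (forall i, msize (tnth p i) <= D.+1)%N ->
  indep_forms X e r -> (r <= (e * D).+1 ^ k)%N.
Proof.
move=> Xp hp [G [hG iG]]; rewrite leqNgt; apply/negP => ltr.
pose J := {ffun 'I_k -> 'I_(e * D).+1}.
have cJ : #|{: J}| = ((e * D).+1 ^ k)%N by rewrite card_ffun !card_ord.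
pose mon (j : J) : 'X_{1..k} := [multinom (j i : nat) | i < k].
pose A : 'M[K]_(r, #|{: J}|) := \matrix_(i, j) (G i \mPo p)@_(mon (enum_val j)).
have : kermx A != 0.
  rewrite -mxrank_eq0 mxrank_ker -lt0n subn_gt0.
  by apply: leq_ltn_trans (rank_leq_col A) _; rewrite cJ.
case/rowV0Pn => x /sub_kermxP xA x0.
have [i xi] := nonzero_coord x0; case/negP: xi; apply/eqP.
apply: (iG (fun i => x 0 i)); apply: Xp.
  by exists e; apply: rpred_sum => j _; apply: rpredZ; exact: hG.
have hS : (\sum_i x 0 i *: G i) \is e.-homog.
  by apply: rpred_sum => j _; apply: rpredZ; exact: hG.
apply/mpolyP => m; rewrite mcoeff0.
have [ltm|lem] := leqP (e * D).+1 (mdeg m).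
  apply: memN_msupp_eq0; apply: msize_mdeg_ge.
  by apply: leq_trans ltm; apply: msize_comp_bound.
have mP l : (m l < (e * D).+1)%N.
  by apply: leq_ltn_trans lem; rewrite mdegE (bigD1 l) //= leq_addr.
pose j : J := [ffun l => Ordinal (mP l)].
have -> : m = mon j by apply/mnmP => l; rewrite mnmE ffunE.
have /rowP/(_ (enum_rank j)) := xA; rewrite !mxE => xAj.
rewrite (raddf_sum (comp_mpoly p)) (raddf_sum (mcoeff _)) -[RHS]xAj; apply: eq_bigr => l _.
by rewrite /= comp_mpolyZ mcoeffZ mxE enum_rankK.
Qed.

Lemma param_no_chain (X : set 'rV[K]_n) (p : n.-tuple {mpoly K[k]}) :
  (forall F, is_form F -> F \mPo p = 0 -> vanishes X F) -> ~ variety_chain X k.+1.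
Proof.
move=> Xp /chain_indep_forms[Z [e [vZ ZX e0 iZ]]].
pose D := \max_i msize (tnth p i).
have hp i : (msize (tnth p i) <= D.+1)%N.
  by apply: leqW; apply: (@leq_bigmax _ (fun i => msize (tnth p i))).
have Zp F : is_form F -> F \mPo p = 0 -> vanishes Z F.
  by move=> hF F0 v /ZX; apply: Xp.
(* The Hilbert function at [e * q] is at most [(c * (q + 1)) ^ k], while the chain gives at least
   [(q + 1) ^ (k + 1) / (k + 1)!]. This [q] makes [q + 1] exceed [(k + 1)! * c ^ k]. *)
pose c := (e * D).+1; pose q := (k.+1`! * c ^ k)%N.
have := indep_forms_bound Zp hp (iZ q); apply/negP; rewrite -ltnNge.
have le1 : ((e * q * D).+1 ^ k <= (c * q.+1) ^ k)%N.
  by elim: k => [|i IH]; rewrite ?expn0 // !expnS leq_mul // /c; nia.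
apply: leq_ltn_trans le1 _; rewrite -(ltn_pmul2r (fact_gt0 k.+1)) bin_ffact.
have le2 : forall d, (q.+1 ^ d <= (q + d) ^_ d)%N.
  elim=> [|d IHd]; first by rewrite ffactn0.
  rewrite addnS ffactnS /= expnS leq_mul // ltnS; lia.
apply: leq_trans (le2 k.+1).
by rewrite expnMn expnS -mulnA [(_ * k.+1`!)%N]mulnC mulnA ltn_pmul2r ?expn_gt0 // ltnS mulnC.
Qed.

End Parametrization.

(** * Hilbert basis theorem and curves *)

Section Noetherian.

Definition is_ideal (R : comNzRingType) (I : set R) : Prop :=
  [/\ I 0, forall x y, I x -> I y -> I (x + y) & forall a x, I x -> I (a * x)].

Definition in_ideal (R : comNzRingType) (s : seq R) (x : R) : Prop :=
  exists c : nat -> R, x = \sum_(i < size s) c i * s`_i.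

Definition noetherian (R : comNzRingType) : Prop :=
  forall I : set R, is_ideal I ->
    exists s : seq R, (forall x, x \in s -> I x) /\ forall x, I x -> in_ideal s x.

Lemma in_ideal_sub (R : comNzRingType) (s : seq R) (I : set R) x :
  is_ideal I -> (forall y, y \in s -> I y) -> in_ideal s x -> I x.
Proof.
move=> [I0 ID IM] sI [c ->]; apply: big_ind => // i _.
by apply: IM; apply: sI; apply: mem_nth.
Qed.

Lemma is_ideal_in_ideal (R : comNzRingType) (s : seq R) : is_ideal (in_ideal s).
Proof.
split=> [|x y [c ->] [d ->]|a x [c ->]].
- by exists (fun _ => 0); rewrite big1 // => i _; rewrite mul0r.
- exists (fun i => c i + d i); rewrite -big_split; apply: eq_bigr => i _.
  by rewrite mulrDl.
- exists (fun i => a * c i); rewrite mulr_sumr; apply: eq_bigr => i _.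
  by rewrite mulrA.
Qed.

Lemma mem_in_ideal (R : comNzRingType) (s : seq R) x : x \in s -> in_ideal s x.
Proof.
move=> xs; exists (fun i => (i == index x s)%:R).
rewrite -index_mem in xs; rewrite (bigD1 (Ordinal xs)) //= eqxx mul1r nth_index -?index_mem //.
rewrite big1 ?addr0 // => i; rewrite -val_eqE /= => /negPf ->; by rewrite mul0r.
Qed.

Lemma noetherian_field (K : fieldType) : noetherian K.
Proof.
move=> I [I0 ID IM]; have [[a [Ia a0]]|nex] := pselect (exists a, I a /\ a != 0).
  exists [:: a]; split=> [x|x _]; first by rewrite inE => /eqP ->.
  by exists (fun _ => x / a); rewrite big_ord1 /= mulfVK.
exists [::]; split=> // x Ix; exists (fun _ => 0); rewrite big_ord0.
by apply: contrapT => /eqP x0; apply: nex; exists x.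
Qed.

Lemma noetherian_onto (R S : comNzRingType) (f : R -> S) :
  f 0 = 0 -> {morph f : x y / x + y} -> {morph f : x y / x * y} ->
  (forall y, exists x, y = f x) -> noetherian R -> noetherian S.
Proof.
move=> f0 fD fM fonto nR I [I0 ID IM].
have [|s [sI Is]] := nR (f @^-1` I).
- split=> /= [|x y|a x]; rewrite ?f0 ?fD ?fM //; [exact: ID | exact: IM].
exists (map f s); split=> [_ /mapP[x xs ->]|y Iy]; first exact: sI.
have [x yE] := fonto y; have [c xE] : in_ideal s x by apply: Is; rewrite /= -yE.
exists (f \o c); rewrite yE xE size_map.
rewrite (big_morph f fD f0); apply: eq_bigr => i _.
by rewrite fM (nth_map 0).
Qed.

Lemma min_size_outside (R : comNzRingType) (I : set {poly R}) (s : seq {poly R}) :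
  (exists f, I f /\ ~ in_ideal s f) ->
  exists f, [/\ I f, ~ in_ideal s f &
    forall g, I g -> ~ in_ideal s g -> (size f <= size g)%N].
Proof.
move=> [f [If nf]].
pose P k := `[< exists f, [/\ I f, ~ in_ideal s f & size f = k] >].
have exP : exists k, P k by exists (size f); apply/asboolP; exists f.
case: (ex_minnP exP) => k /asboolP[g [Ig ng gE]] mink.
exists g; split=> // h Ih nh; rewrite gE; apply: mink; apply/asboolP.
by exists h.
Qed.

(** Hilbert's argument: pick repeatedly an element of least size outside the ideal of the earlier
    picks. The leading coefficients generate a finitely generated ideal, so one of them, that of
    [F N], is a combination of earlier ones; cancelling it contradicts the minimality of [F N]. *)
Lemma noetherian_poly (R : comNzRingType) : noetherian R -> noetherian {poly R}.
Proof.
move=> nR I idI; have [I0 ID IM] := idI; apply: contrapT => nfg.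
have /choice[pick pickP] (s : seq {poly R}) : exists f,
    (forall x, x \in s -> I x) -> [/\ I f, ~ in_ideal s f &
    forall g, I g -> ~ in_ideal s g -> (size f <= size g)%N].
  have [sI|nsI] := pselect (forall x, x \in s -> I x); last by exists 0.
  have [|f Hf] := @min_size_outside R I s; last by exists f.
  apply: contrapT => nex; apply: nfg; exists s; split=> // x Ix.
  by apply: contrapT => nx; apply: nex; exists x.
pose S := fix S n := if n is m.+1 then rcons (S m) (pick (S m)) else [::].
pose F n := pick (S n).
have SE n : S n = mkseq F n.
  by elim: n => // n IH; rewrite -[LHS]/(rcons (S n) (F n)) {1}IH /mkseq -addn1 iotaD map_cat cats1.
have SI n x : x \in S n -> I x.
  elim: n x => // n IH x; rewrite [S n.+1]/= mem_rcons inE => /predU1P[->|/IH //].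
  by have [] := pickP (S n) IH.
have FP n : [/\ I (F n), ~ in_ideal (S n) (F n) &
    forall g, I g -> ~ in_ideal (S n) g -> (size (F n) <= size g)%N].
  by apply: pickP; apply: SI.
have memF i n : (i < n)%N -> F i \in S n.
  by move=> ltin; rewrite SE; apply/mapP; exists i; rewrite // mem_iota.
have leF i n : (i < n)%N -> (size (F i) <= size (F n))%N.
  move=> ltin; have [_ _] := FP i; apply; first by have [] := FP n.
  have [_ nn _] := FP n; apply: contra_not nn; apply: in_ideal_sub.
    exact: is_ideal_in_ideal.
  move=> y; rewrite SE => /mapP[j]; rewrite mem_iota add0n => /= ltj ->.
  by apply: mem_in_ideal; apply: memF; apply: ltn_trans ltin.
pose L n := [seq lead_coef (F i) | i <- iota 0 n].
have LS m n x : (m <= n)%N -> in_ideal (L m) x -> in_ideal (L n) x.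
  move=> lemn; apply: in_ideal_sub; first exact: is_ideal_in_ideal.
  move=> y /mapP[j]; rewrite mem_iota add0n => /= ltj ->.
  apply: mem_in_ideal; apply/mapP; exists j => //.
  by rewrite mem_iota; apply: leq_trans lemn.
pose A : set R := [set a | exists n, in_ideal (L n) a].
have [|s [sA As]] := nR A.
- split=> [|x y [n hx] [m hy]|a x [n hx]].
  + by exists 0%N; have [] := is_ideal_in_ideal (L 0).
  + exists (maxn n m); have [_ + _] := is_ideal_in_ideal (L (maxn n m)).
    by apply; [apply: LS hx|apply: LS hy]; rewrite leq_max leqnn ?orbT.
  + by exists n; have [_ _ +] := is_ideal_in_ideal (L n); apply.
have [N HN] : exists N, forall x, x \in s -> in_ideal (L N) x.
  elim: s sA {As} => [|x s IH] sA; first by exists 0%N.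
  have [|N HN] := IH; first by move=> y ys; apply: sA; rewrite inE ys orbT.
  have [M HM] := sA x (mem_head _ _).
  exists (maxn N M) => y; rewrite inE => /predU1P[->|/HN].
    by apply: LS HM; rewrite leq_max leqnn orbT.
  by apply: LS; rewrite leq_max leqnn.
have [c] : in_ideal (L N) (lead_coef (F N)).
  apply: (in_ideal_sub (is_ideal_in_ideal _) HN); apply: As; exists N.+1.
  by apply: mem_in_ideal; apply/mapP; exists N; rewrite ?mem_iota ?add0n /=.
rewrite size_map size_iota => lcE.
have [IFN nFN minFN] := FP N.
pose B := \sum_(i < N) (c i *: 'X^(size (F N) - size (F i))) * F i.
have BI : in_ideal (S N) B.
  have [i0 iD iM] := is_ideal_in_ideal (S N).
  apply: big_ind => // i _; apply: iM; apply: mem_in_ideal.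
  exact: memF.
pose G := F N - B.
have FN0 : F N != 0.
  by apply/eqP => F0; apply: nFN; rewrite F0; have [] := is_ideal_in_ideal (S N).
have nG : ~ in_ideal (S N) G.
  move=> iG; apply: nFN; rewrite -[F N](subrK B).
  by have [_ + _] := is_ideal_in_ideal (S N); apply.
have IB : I B by apply: in_ideal_sub BI => //; exact: SI.
have IG : I G.
  by apply: ID => //; rewrite -mulN1r; apply: IM.
have /(leq_ltn_trans (minFN G IG nG)) : (size G < size (F N))%N; last by rewrite ltnn.
rewrite -[size (F N)]prednK ?lt0n ?size_poly_eq0 // ltnS; apply/leq_sizeP => j lej.
have BE m : B`_m = \sum_(i < N) c i *
    (if (m < size (F N) - size (F i))%N then 0 else (F i)`_(m - (size (F N) - size (F i)))).
  rewrite coef_sum; apply: eq_bigr => i _.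
  by rewrite -scalerAl coefZ coefXnM.
have szi (i : 'I_N) : (size (F i) <= size (F N))%N by apply: leF.
rewrite coefB BE.
have sF0 : (0 < size (F N))%N by rewrite lt0n size_poly_eq0.
(* In the top degree of [F N] the coefficient of [B] is the combination [lcE] of leading
   coefficients, so the difference vanishes; in higher degrees both coefficients are zero. *)
have [jE|ltj] := eqVneq j (size (F N)).-1.
  rewrite {1}jE -lead_coefE lcE -sumrB big1 // => i _.
  rewrite (nth_map 0%N) ?size_iota // nth_iota // add0n lead_coefE.
  have [Fi0|Fin0] := eqVneq (F i) 0.
    by rewrite Fi0 size_poly0 /= coef0 mulr0 !coef0 if_same mulr0 subrr.
  have si0 : (0 < size (F i))%N by rewrite lt0n size_poly_eq0.
  have -> : (j < size (F N) - size (F i))%N = false.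
    by apply/negbTE; rewrite -leqNgt jE; have := szi i; lia.
  have -> : (j - (size (F N) - size (F i)))%N = (size (F i)).-1.
    by rewrite jE; have := szi i; lia.
  by rewrite subrr.
have szj : (size (F N) <= j)%N by lia.
rewrite nth_default // big1 ?subrr // => i _.
rewrite [X in if _ then _ else X]nth_default ?if_same ?mulr0 //; move: szj (szi i); set a := size (F N); set b := size (F i); clearbody a b; clear; lia.
Qed.

Lemma noetherian_mpoly (K : fieldType) n : noetherian {mpoly K[n]}.
Proof.
elim: n => [|n IH].
  apply: (@noetherian_onto K _ (@mpolyC 0 K)); last exact: noetherian_field.
  - exact: mpolyC0.
  - exact: mpolyCD.
  - exact: mpolyCM.
  - by move=> p; exists p@_0%MM; apply: nvar0_mpolyC.
apply: (noetherian_onto _ (@mpoly_of_polyD K n) (@mpoly_of_polyM K n)).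
- exact: mpoly_of_poly0.
- exact: mpoly_of_poly_onto.
- exact: noetherian_poly.
Qed.

End Noetherian.

(** * Descending chains of closed sets *)

Section NoetherianSpace.
Variables (K : fieldType) (n : nat).
Implicit Types (F G : {mpoly K[n]}) (X Y Z V : set 'rV[K]_n) (v : 'rV[K]_n).

(** Without a minimal set one could descend forever. The polynomials vanishing on some member of the
    sequence form an ideal; its finitely many generators vanish on one member, after which the
    sequence is constant. *)
Lemma zclosed_minimal (P : set 'rV[K]_n -> Prop) Y0 : zclosed Y0 -> P Y0 ->
  exists Y, [/\ zclosed Y, Y `<=` Y0, P Y &
    forall Y', zclosed Y' -> Y' `<=` Y -> P Y' -> Y `<=` Y'].
Proof.
move=> cY0 PY0; apply: contrapT => nomin.
pose good Y := [/\ zclosed Y, Y `<=` Y0 & P Y].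
have /choice[next nextP] Y : exists Y', good Y ->
    [/\ good Y', Y' `<=` Y & ~ (Y `<=` Y')].
  have [[cY YY0 PY]|ng] := pselect (good Y); last by exists Y.
  apply: contrapT => nex; apply: nomin; exists Y; split=> // Y' cY' Y'Y PY'.
  apply: contrapT => nYY'; apply: nex; exists Y' => _; split=> //; split=> //.
  exact: subset_trans YY0.
pose S := fix S m := if m is m'.+1 then next (S m') else Y0.
have gS m : good (S m) by elim: m => [|m /nextP[]//]; split.
have leS m p : (m <= p)%N -> S p `<=` S m.
  move=> /subnK <-; elim: (p - m)%N => // q IH.
  by rewrite addSn; apply: subset_trans IH; case: (nextP _ (gS (q + m)%N)).
pose I : set {mpoly K[n]} := [set F | exists m, vanishes (S m) F].
have [|s [sI Is]] := @noetherian_mpoly K n I.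
  split=> [|F G [m vF] [p vG]|G F [m vF]].
  - by exists 0%N => v _; apply: meval0.
  - exists (maxn m p) => v Sv; rewrite evalvD vF ?vG ?addr0 //; apply: leS Sv;
      by rewrite leq_max leqnn ?orbT.
  - by exists m => v Sv; rewrite evalvM vF ?mulr0.
have [m Hm] : exists m, forall F, F \in s -> vanishes (S m) F.
  elim: s sI {Is} => [|F s IH] sI; first by exists 0%N.
  have [|m Hm] := IH; first by move=> G Gs; apply: sI; rewrite inE Gs orbT.
  have [p Hp] := sI F (mem_head _ _).
  exists (maxn m p) => G; rewrite inE => /predU1P[-> v Sv|Gs v Sv].
    by apply: Hp; apply: leS Sv; rewrite leq_max leqnn orbT.
  by apply: (Hm G) => //; apply: leS Sv; rewrite leq_max leqnn.
have [_ _] := nextP _ (gS m); apply.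
have [cS _ _] := gS m; have [cS1 _ _] := gS m.+1.
apply: zclosed_sub_vanishes => // F _ vF v Sv.
have [c ->] : in_ideal s F by apply: Is; exists m.+1.
rewrite evalv_sum big1 // => i _; rewrite evalvM (Hm s`_i) ?mulr0 //.
exact: mem_nth.
Qed.

Definition finitely_many_points Y : Prop :=
  exists s : seq 'rV[K]_n, forall v, Y v -> exists2 p, p \in s & exists a, v = a *: p.

Lemma finitely_many_pointsU Y Z : finitely_many_points Y -> finitely_many_points Z ->
  finitely_many_points (Y `|` Z).
Proof.
move=> [s Hs] [t Ht]; exists (s ++ t) => v [/Hs|/Ht] [p ps Hp];
  by exists p => //; rewrite mem_cat ps ?orbT.
Qed.

(** A minimal infinite closed subset is irreducible: if two closed sets cover it, one of them has
    infinite intersection with it, hence contains it by minimality. *)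
Lemma infinite_has_variety Y : zclosed Y -> ~ finitely_many_points Y ->
  exists Z, [/\ variety Z, Z `<=` Y & ~ finitely_many_points Z].
Proof.
move=> cY infY; have [Z [cZ ZY infZ minZ]] := zclosed_minimal (P := fun Z => ~ finitely_many_points Z) cY infY.
exists Z; split=> //; split=> //.
  apply: contrapT => Z0; apply: infZ; exists [::] => v Zv.
  by case: Z0; exists v.
move=> A B cA cB ZAB.
have [fA|infA] := pselect (finitely_many_points (Z `&` A)); last first.
  left; apply: subset_trans (minZ _ _ _ infA) _; first exact: zclosedI.
    by move=> v [].
  by move=> v [].
have [fB|infB] := pselect (finitely_many_points (Z `&` B)); last first.
  right; apply: subset_trans (minZ _ _ _ infB) _; first exact: zclosedI.
    by move=> v [].
  by move=> v [].
case: infZ; have [s Hs] := finitely_many_pointsU fA fB; exists s => v Zv.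
by apply: Hs; have [Av|Bv] := ZAB v Zv; [left|right].
Qed.

End NoetherianSpace.

(** * Points, and intersections with a curve *)

Section Points.
Variables (K : numFieldType) (n : nat).
Implicit Types (F G : {mpoly K[n]}) (X Y Z V : set 'rV[K]_n) (v : 'rV[K]_n).

Definition point_of v : set 'rV[K]_n := [set u | exists2 a, a != 0 & u = a *: v].

Lemma zclosed_point v : v != 0 -> zclosed (point_of v).
Proof.
move=> v0; have [i vi] := nonzero_coord v0.
pose I : set {mpoly K[n]} :=
  [set F | exists j, F = v 0 j *: 'X_i - v 0 i *: 'X_j].
exists I; split.
  by move=> _ [j ->]; exists 1%N; apply: rpredB; apply: rpredZ; rewrite dhomogX /= mdeg1.
apply/seteqP; split=> u.
  move=> [a a0 ->]; split; first by rewrite scaler_eq0 negb_or a0.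
  move=> _ [j ->]; rewrite /evalv mevalB !mevalZ !mevalXU !mxE; ring.
move=> [u0 Hu]; have uE j : u 0 j = (u 0 i / v 0 i) * v 0 j.
  have := Hu (v 0 j *: 'X_i - v 0 i *: 'X_j) ltac:(by exists j).
  rewrite /evalv mevalB !mevalZ !mevalXU => /eqP; rewrite subr_eq0 => /eqP E.
  by apply: (mulfI vi); rewrite -E; field.
have uE' : u = (u 0 i / v 0 i) *: v by apply/rowP => j; rewrite mxE.
exists (u 0 i / v 0 i) => //; apply: contraNneq u0 => E.
by rewrite uE' E scale0r.
Qed.

Lemma variety_point v : v != 0 -> variety (point_of v).
Proof.
move=> v0; apply: variety_of_vanishesM.
- exact: zclosed_point.
- by exists v; exists 1; rewrite ?oner_eq0 ?scale1r.
move=> F G [d hF] [e hG] H.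
have := H v; rewrite evalvM => /(_ _)/eqP; rewrite mulf_eq0.
case/(_ _)/orP; first by exists 1; rewrite ?oner_eq0 ?scale1r.
  by move=> /eqP E; left=> u [a _ ->]; rewrite (evalv_scale _ _ hF) E mulr0.
by move=> /eqP E; right=> u [a _ ->]; rewrite (evalv_scale _ _ hG) E mulr0.
Qed.

(** An infinite intersection would contain an infinite variety, and a point of it, this variety and
    [V] would form a chain of length 2. *)
Lemma variety_curveI V Y : variety V -> ~ variety_chain V 2 -> zclosed Y ->
  ~ (V `<=` Y) -> finitely_many_points (V `&` Y).
Proof.
move=> vV nV cY nVY; apply: contrapT => infVY.
have [|Z [vZ ZVY infZ]] := infinite_has_variety _ infVY.
  by apply: zclosedI => //; exact: variety_closed.
have [cZ [v Zv] _] := vZ; have v0 := zclosed_neq0 cZ Zv.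
apply: nV; exists (fun i => if i is 0%N then point_of v else if i is 1%N then Z else V).
have pZ : point_of v `<=` Z by move=> _ [a a0 ->]; apply: zclosed_scale.
have ZV : Z `<=` V by move=> u /ZVY[].
split=> [[|[|[|//]]] _|[|[|//]] _].
- by split; [exact: variety_point|apply: subset_trans ZV].
- by split.
- by split.
- split=> // Zp; apply: infZ; exists [:: v] => u /Zp[a _ ->].
  by exists v; rewrite ?mem_head //; exists a.
- by split=> // VZ; apply: nVY => u /VZ/ZVY[].
Qed.

End Points.

(** * Closures of polynomial images *)

Section Parametrized.
Variables (K : numFieldType) (n k : nat).
Implicit Types (F G : {mpoly K[n]}) (X Y Z V : set 'rV[K]_n) (v : 'rV[K]_n).

Definition param_point (p : n.-tuple {mpoly K[k]}) (y : 'I_k -> K) : 'rV[K]_n :=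
  \row_i (tnth p i).@[y].

Lemma evalv_param_point F p y : evalv F (param_point p y) = (F \mPo p).@[y].
Proof. by rewrite comp_mpoly_meval; apply: meval_eq => i; rewrite mxE. Qed.

(** [X] is the Zariski closure of the image of affine [k]-space. Both irreducibility and the upper
    bound on the dimension are read off from the pullback of forms along [p]. *)
Definition parametrizes (p : n.-tuple {mpoly K[k]}) X : Prop :=
  [/\ zclosed X, forall y, X (param_point p y) &
      forall Y, zclosed Y -> (forall y, Y (param_point p y)) -> X `<=` Y].

Lemma parametrizes_vanishes p X F : parametrizes p X -> is_form F ->
  vanishes X F <-> F \mPo p = 0.
Proof.
move=> [cX pX minX] hF; split=> [vF|F0].
  by apply: mpoly_eval_eq0 => y; rewrite -evalv_param_point; apply: vF.
move=> v Xv; have [_ /(_ F erefl)//] : zeros [set F] v.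
apply: minX Xv; first exact: zclosed_zeros1.
move=> y; split=> [|_ ->]; first exact: zclosed_neq0 (pX y).
by rewrite evalv_param_point F0 meval0.
Qed.

Lemma parametrizes_variety p X : parametrizes p X -> variety X.
Proof.
move=> pX; have [cX ptX _] := pX; apply: variety_of_vanishesM => //.
  by exists (param_point p (fun _ => 0)).
move=> F G hF hG; rewrite !(parametrizes_vanishes pX) //; last exact: is_formM.
by rewrite rmorphM => /eqP; rewrite mulf_eq0 => /orP[]/eqP; [left|right].
Qed.

Lemma parametrizes_no_chain p X : parametrizes p X -> ~ variety_chain X k.+1.
Proof.
move=> pX; apply: (param_no_chain (p := p)) => F hF.
by rewrite (parametrizes_vanishes pX).
Qed.

End Parametrized.

Section Limit.
Variables (K : numFieldType) (n : nat).

Lemma poly_eval_eq0 (p : {poly K}) : (forall x, p.[x] = 0) -> p = 0.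
Proof.
move=> Hp; apply/eqP/negPn/negP => pn0.
have := max_poly_roots pn0 (rs := [seq k%:R | k <- iota 0 (size p)]).
rewrite size_map size_iota ltnn map_inj_uniq ?iota_uniq; last first.
  by move=> a b /eqP; rewrite eqr_nat => /eqP.
suff -> : all (root p) [seq k%:R | k <- iota 0 (size p)] by move=> /(_ isT isT).
by apply/allP => _ /mapP[k _ ->]; apply/eqP.
Qed.

(** An algebraic limit: for a form [F] vanishing on [X], the polynomial [F(g) * h] vanishes at every
    value, and [h] is nonzero, so [F(g)] is zero. This takes the place of topological closure over
    any field of characteristic zero in use. *)
Lemma zclosed_limit (X : set 'rV[K]_n) (g : 'I_n -> {poly K}) (h : {poly K}) (x : K) :
  zclosed X -> h != 0 -> (forall y, h.[y] != 0 -> X (\row_i (g i).[y])) ->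
  \row_i (g i).[x] != 0 -> X (\row_i (g i).[x]).
Proof.
move=> cX h0 Hh g0; apply: zclosed_mem => // F hF vF.
pose G : {poly K} := mmap polyC g F.
have GE y : G.[y] = evalv F (\row_i (g i).[y]).
  rewrite /G /evalv mevalE /mmap horner_sum; apply: eq_bigr => m _.
  rewrite hornerM hornerC; congr (_ * _); rewrite /mmap1 horner_prod.
  by apply: eq_bigr => i _; rewrite horner_exp mxE.
suff G0 : G = 0 by rewrite -GE G0 horner0.
apply/eqP; rewrite -[_ == _]orbF -(negPf h0) -mulf_eq0; apply/eqP.
apply: poly_eval_eq0 => y; rewrite hornerM GE.
have [->|hy] := eqVneq h.[y] 0; first by rewrite mulr0.
by rewrite vF ?mul0r //; exact: Hh.
Qed.

End Limit.

(** * Lines and Pluecker coordinates *)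

Section Coordinates.
Variable K : fieldType.

Definition vec4 (a b c d : K) : 'rV[K]_4 := \row_i [:: a; b; c; d]`_i.
Definition vec6 (a b c d e f : K) : 'rV[K]_6 := \row_i [:: a; b; c; d; e; f]`_i.

(** A product of equations, so that a single [rewrite] applies whichever component matches. *)
Lemma vec4E a b c d :
  (vec4 a b c d 0 0 = a) * (vec4 a b c d 0 1 = b) *
  (vec4 a b c d 0 2 = c) * (vec4 a b c d 0 3 = d).
Proof. by rewrite !mxE. Qed.

Lemma vec6E a b c d e f :
  (vec6 a b c d e f 0 0 = a) * (vec6 a b c d e f 0 1 = b) *
  (vec6 a b c d e f 0 2 = c) * (vec6 a b c d e f 0 3 = d) *
  (vec6 a b c d e f 0 4 = e) * (vec6 a b c d e f 0 5 = f).
Proof. by rewrite !mxE. Qed.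

Lemma forall_I4 (P : 'I_4 -> Prop) : P 0 -> P 1 -> P 2 -> P 3 -> forall i, P i.
Proof.
move=> P0 P1 P2 P3 i.
have : [|| i == 0, i == 1, i == 2 | i == 3] by case: i => [[|[|[|[|]]]]].
by case/or4P => /eqP ->.
Qed.

Lemma forall_I6 (P : 'I_6 -> Prop) :
  P 0 -> P 1 -> P 2 -> P 3 -> P 4 -> P 5 -> forall i, P i.
Proof.
move=> P0 P1 P2 P3 P4 P5 i.
have : [|| i == 0, i == 1, i == 2, i == 3 | (i == 4) || (i == 5)].
  by case: i => [[|[|[|[|[|[|]]]]]]].
by case/or4P => [/eqP ->|/eqP ->|/eqP ->|/orP[/eqP ->|/orP[]/eqP ->]].
Qed.

Lemma eq_vec4 (v w : 'rV[K]_4) :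
  v 0 0 = w 0 0 -> v 0 1 = w 0 1 -> v 0 2 = w 0 2 -> v 0 3 = w 0 3 -> v = w.
Proof. by move=> *; apply/rowP; apply: forall_I4. Qed.

Lemma eq_vec6 (v w : 'rV[K]_6) :
  v 0 0 = w 0 0 -> v 0 1 = w 0 1 -> v 0 2 = w 0 2 -> v 0 3 = w 0 3 ->
  v 0 4 = w 0 4 -> v 0 5 = w 0 5 -> v = w.
Proof. by move=> *; apply/rowP; apply: forall_I6. Qed.

Lemma vec4_eta (v : 'rV[K]_4) : v = vec4 (v 0 0) (v 0 1) (v 0 2) (v 0 3).
Proof. by apply: eq_vec4; rewrite vec4E. Qed.

Lemma vec6_eta (v : 'rV[K]_6) :
  v = vec6 (v 0 0) (v 0 1) (v 0 2) (v 0 3) (v 0 4) (v 0 5).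
Proof. by apply: eq_vec6; rewrite vec6E. Qed.

Lemma vec4_ind (P : 'rV[K]_4 -> Prop) :
  (forall a b c d, P (vec4 a b c d)) -> forall v, P v.
Proof. by move=> H v; rewrite (vec4_eta v). Qed.

Lemma vec6_ind (P : 'rV[K]_6 -> Prop) :
  (forall a b c d e f, P (vec6 a b c d e f)) -> forall v, P v.
Proof. by move=> H v; rewrite (vec6_eta v). Qed.

Lemma vec4_eq0 a b c d :
  (vec4 a b c d == 0) = [&& a == 0, b == 0, c == 0 & d == 0].
Proof.
apply/eqP/and4P => [E|[/eqP -> /eqP -> /eqP -> /eqP ->]]; last first.
  by apply: eq_vec4; rewrite vec4E mxE.
have := vec4E a b c d; rewrite E !mxE => -[[[<- <-] <-] <-].
by rewrite eqxx.
Qed.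

Lemma vec6_eq0 a b c d e f :
  (vec6 a b c d e f == 0) =
  [&& a == 0, b == 0, c == 0, d == 0 & (e == 0) && (f == 0)].
Proof.
apply/eqP/and5P => [E|[/eqP -> /eqP -> /eqP -> /eqP -> /andP[/eqP -> /eqP ->]]]; last first.
  by apply: eq_vec6; rewrite vec6E mxE.
have := vec6E a b c d e f; rewrite E !mxE => -[[[[[<- <-] <-] <-] <-] <-].
by rewrite eqxx.
Qed.

Lemma vec4_lin x y a b c d a' b' c' d' :
  x *: vec4 a b c d + y *: vec4 a' b' c' d' =
  vec4 (x * a + y * a') (x * b + y * b') (x * c + y * c') (x * d + y * d').
Proof. by apply: eq_vec4; rewrite !mxE. Qed.

Lemma vec4Z x a b c d : x *: vec4 a b c d = vec4 (x * a) (x * b) (x * c) (x * d).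
Proof. by apply: eq_vec4; rewrite !mxE. Qed.

Lemma vec6Z x a b c d e f :
  x *: vec6 a b c d e f = vec6 (x * a) (x * b) (x * c) (x * d) (x * e) (x * f).
Proof. by apply: eq_vec6; rewrite !mxE. Qed.

Lemma sum_I4 (V : nmodType) (F : 'I_4 -> V) :
  \sum_i F i = F 0 + F 1 + F 2 + F 3.
Proof.
rewrite !big_ord_recl big_ord0 addr0 -!addrA.
by congr (F _ + (F _ + (F _ + F _))); apply: val_inj.
Qed.

Definition wedge (x y : 'rV[K]_4) : 'rV[K]_6 :=
  vec6 (x 0 0 * y 0 1 - x 0 1 * y 0 0) (x 0 0 * y 0 2 - x 0 2 * y 0 0)
       (x 0 0 * y 0 3 - x 0 3 * y 0 0) (x 0 1 * y 0 2 - x 0 2 * y 0 1)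
       (x 0 1 * y 0 3 - x 0 3 * y 0 1) (x 0 2 * y 0 3 - x 0 3 * y 0 2).

Lemma wedge_vec4 a b c d a' b' c' d' :
  wedge (vec4 a b c d) (vec4 a' b' c' d') =
  vec6 (a * b' - b * a') (a * c' - c * a') (a * d' - d * a')
       (b * c' - c * b') (b * d' - d * b') (c * d' - d * c').
Proof. by rewrite /wedge !vec4E. Qed.

Lemma pluecker_wedge (M : 'M[K]_(2, 4)) : pluecker M = wedge (row 0 M) (row 1 M).
Proof. by apply: eq_vec6; rewrite !mxE. Qed.

Lemma pluecker_col_mx (x y : 'rV[K]_4) :
  pluecker (col_mx x y : 'M[K]_(1 + 1, 4)) = wedge x y.
Proof.
rewrite pluecker_wedge; congr wedge; apply/rowP => i; rewrite !mxE;
  by case: splitP => j; rewrite (ord1 j).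
Qed.

Definition minor (x y : 'rV[K]_4) (i j : 'I_4) : K := x 0 i * y 0 j - x 0 j * y 0 i.

Lemma wedgeE (x y : 'rV[K]_4) :
  wedge x y = vec6 (minor x y 0 1) (minor x y 0 2) (minor x y 0 3)
                   (minor x y 1 2) (minor x y 1 3) (minor x y 2 3).
Proof. by []. Qed.

Lemma minor_wedge (x y x' y' : 'rV[K]_4) : wedge x y = wedge x' y' ->
  forall i j, minor x y i j = minor x' y' i j.
Proof.
move=> E; have := vec6E (minor x y 0 1) (minor x y 0 2) (minor x y 0 3)
  (minor x y 1 2) (minor x y 1 3) (minor x y 2 3).
rewrite -wedgeE E wedgeE !vec6E => -[[[[[E0 E1] E2] E3] E4] E5].
have minorN (u v : 'rV[K]_4) i j : minor u v i j = - minor u v j i.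
  by rewrite /minor; ring.
have minor0 (u v : 'rV[K]_4) i : minor u v i i = 0 by rewrite /minor; ring.
do 2![apply: forall_I4]; rewrite ?minor0 ?E0 ?E1 ?E2 ?E3 ?E4 ?E5 //.
all: by rewrite minorN [RHS]minorN ?E0 ?E1 ?E2 ?E3 ?E4 ?E5.
Qed.

Lemma wedge_neq0 (x y : 'rV[K]_4) : wedge x y != 0 -> exists i j, minor x y i j != 0.
Proof.
move=> w0; apply: contrapT => nex; case/negP: w0.
have m0 i j : minor x y i j = 0.
  by apply: contrapT => /eqP m0; apply: nex; exists i, j.
by rewrite wedgeE !m0 vec6_eq0 eqxx.
Qed.

Lemma wedge_lin (x y : 'rV[K]_4) a b c d :
  wedge (a *: x + b *: y) (c *: x + d *: y) = (a * d - b * c) *: wedge x y.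
Proof. by apply: eq_vec6; rewrite !mxE /=; ring. Qed.

Lemma line_ofP (w : 'rV[K]_6) v : w != 0 ->
  line_of w v <-> v != 0 /\ exists y, w = wedge v y.
Proof.
move=> w0; split=> [[M <-] [v0 /submxP[D vE]]|[v0 [y ->]]]; last first.
  exists (col_mx v y : 'M_(1 + 1, 4)); first exact: pluecker_col_mx.
  by split=> //; apply: submx_trans (addsmxSl v y) _; rewrite addsmxE.
split=> //; rewrite pluecker_wedge.
have {}vE : v = D 0 0 *: row 0 M + D 0 1 *: row 1 M.
  rewrite vE mulmx_sum_row !big_ord_recl big_ord0 addr0.
  by congr (D 0 _ *: row _ M + D 0 _ *: row _ M); apply: val_inj.
set a := D 0 0 in vE; set b := D 0 1 in vE.
have [a0|a0] := eqVneq a 0; last first.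
  exists (0 *: row 0 M + a^-1 *: row 1 M).
  by rewrite vE wedge_lin mulr0 subr0 mulfV // scale1r.
have b0 : b != 0.
  by apply: contraNneq v0 => b0; rewrite vE a0 b0 !scale0r addr0.
exists ((- b^-1) *: row 0 M + 0 *: row 1 M).
by rewrite vE wedge_lin mulr0 sub0r mulrN mulfV // opprK scale1r.
Qed.

Lemma line_of_wedge (x y v : 'rV[K]_4) : wedge x y != 0 ->
  line_of (wedge x y) v <-> v != 0 /\ exists a b, v = a *: x + b *: y.
Proof.
move=> w0; rewrite line_ofP //; split=> -[v0]; last first.
  move=> [a [b vE]]; have [|_ [z Hz]] := (line_ofP v w0).1; last by split=> //; exists z.
  have [a0|a0] := eqVneq a 0; last first.
    rewrite line_ofP //; split=> //; exists (0 *: x + a^-1 *: y).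
    by rewrite vE wedge_lin mulr0 subr0 mulfV // scale1r.
  have b0 : b != 0.
    by apply: contraNneq v0 => b0; rewrite vE a0 b0 !scale0r addr0.
  rewrite line_ofP //; split=> //; exists ((- b^-1) *: x + 0 *: y).
  by rewrite vE wedge_lin mulr0 sub0r mulrN mulfV // opprK scale1r.
move=> [z E]; split=> //; have [i [j mij]] := wedge_neq0 w0.
have mE := minor_wedge E.
(* Cramer's rule on the two coordinates whose minor is nonzero. *)
exists ((v 0 i * y 0 j - v 0 j * y 0 i) / minor x y i j),
       ((x 0 i * v 0 j - x 0 j * v 0 i) / minor x y i j).
apply/rowP => k; rewrite !mxE; apply: (mulfI mij).
transitivity (v 0 k * minor v z i j); first by rewrite mE mulrC.
rewrite [RHS](_ : _ = (v 0 i * y 0 j - v 0 j * y 0 i) * x 0 k +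
  (x 0 i * v 0 j - x 0 j * v 0 i) * y 0 k); last by field.
rewrite [RHS](_ : _ = v 0 j * minor x y i k - v 0 i * minor x y j k);
  last by rewrite /minor; ring.
by rewrite !mE /minor; ring.
Qed.

Lemma klein_wedge (x y : 'rV[K]_4) : wedge x y != 0 -> @klein K (wedge x y).
Proof. by move=> w0; split=> //; rewrite wedgeE !vec6E /minor; ring. Qed.

(** A bivector satisfying the Klein relation is decomposable. Up to scale, the two points are those
    where the line meets two coordinate planes, chosen according to the first nonzero Pluecker
    coordinate; the relation supplies the one coordinate that does not match identically. *)
Lemma kleinP (w : 'rV[K]_6) : klein w -> exists x y, w = wedge x y.
Proof.
elim/vec6_ind: w => a b c d e f [w0]; rewrite !vec6E => kl.
have ka : a * f = b * e - c * d.
  by apply/eqP; rewrite -subr_eq0; apply/eqP; rewrite -kl; ring.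
have kb : b * e = a * f + c * d by rewrite ka; ring.
have kc : c * d = b * e - a * f by rewrite ka; ring.
have [a0|a0] := eqVneq a 0; last first.
  exists (vec4 a 0 (- d) (- e)), (vec4 0 1 (b / a) (c / a)); rewrite wedge_vec4.
  congr vec6; try by field.
  by apply: (mulfI a0); rewrite [LHS]ka; field.
have [b0|b0] := eqVneq b 0; last first.
  exists (vec4 b d 0 (- f)), (vec4 0 (a / b) 1 (c / b)); rewrite wedge_vec4.
  congr vec6; try by field.
  by apply: (mulfI b0); rewrite [LHS]kb; field.
have [c0|c0] := eqVneq c 0; last first.
  exists (vec4 c e f 0), (vec4 0 (a / c) (b / c) 1); rewrite wedge_vec4.
  congr vec6; try by field.
  by apply: (mulfI c0); rewrite [LHS]kc; field.
have [d0|d0] := eqVneq d 0; last first.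
  exists (vec4 (- b) d 0 (- f)), (vec4 (- a / d) 0 1 (e / d)); rewrite wedge_vec4.
  by rewrite a0 b0 c0; congr vec6; field.
have [e0|e0] := eqVneq e 0; last first.
  by exists (vec4 0 e f 0), (vec4 0 0 0 1); rewrite wedge_vec4 a0 b0 c0 d0;
     congr vec6; ring.
by exists (vec4 0 0 f 0), (vec4 0 0 0 1); rewrite wedge_vec4 a0 b0 c0 d0 e0;
     congr vec6; ring.
Qed.

End Coordinates.

(** * Lines as spans of two points *)

Section SpanLine.
Variables (K : numFieldType) (n : nat).
Implicit Types (p q v : 'rV[K]_n) (X Y : set 'rV[K]_n).

Definition span2 p q : set 'rV[K]_n := [set v | v != 0 /\ exists a b, v = a *: p + b *: q].

Definition indep2 p q : Prop := exists i j, p 0 i * q 0 j - p 0 j * q 0 i != 0.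

Lemma zclosed_eq0 (f : 'rV[K]_n -> K) F : is_form F -> (forall v, evalv F v = f v) ->
  zclosed [set v | v != 0 /\ f v = 0].
Proof.
move=> hF fE; rewrite (_ : mkset _ = zeros [set F]); first exact: zclosed_zeros1.
apply/seteqP; split=> v [v0 Hv]; split=> //; last by rewrite -fE Hv.
by move=> _ ->; rewrite fE.
Qed.

Lemma dhomogX1 (i : 'I_n) : ('X_i : {mpoly K[n]}) \is 1.-homog.
Proof. by rewrite dhomogX /= mdeg1. Qed.

Lemma dhomogXX (i j : 'I_n) : ('X_i * 'X_j : {mpoly K[n]}) \is 2.-homog.
Proof. exact: (dhomogM (dhomogX1 i) (dhomogX1 j)). Qed.

Lemma span2E p q i j : p 0 i * q 0 j - p 0 j * q 0 i != 0 ->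
  span2 p q = [set v : 'rV[K]_n | v != 0 /\ forall k,
    (v 0 i * q 0 j - v 0 j * q 0 i) * p 0 k + (p 0 i * v 0 j - p 0 j * v 0 i) * q 0 k
    - (p 0 i * q 0 j - p 0 j * q 0 i) * v 0 k = 0].
Proof.
move=> m0; apply/seteqP; split=> v [v0].
  by move=> [a [b E]]; split=> // k; rewrite E !mxE; ring.
move=> Hv; split=> //.
exists ((v 0 i * q 0 j - v 0 j * q 0 i) / (p 0 i * q 0 j - p 0 j * q 0 i)),
       ((p 0 i * v 0 j - p 0 j * v 0 i) / (p 0 i * q 0 j - p 0 j * q 0 i)).
apply/rowP => k; rewrite !mxE; apply: (mulfI m0).
by have /eqP := Hv k; rewrite subr_eq0 => /eqP <-; field.
Qed.

Lemma zclosed_span2 p q : indep2 p q -> zclosed (span2 p q).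
Proof.
move=> [i [j m0]]; rewrite (span2E m0).
pose F k : {mpoly K[n]} := p 0 k *: (q 0 j *: 'X_i - q 0 i *: 'X_j)
  + q 0 k *: (p 0 i *: 'X_j - p 0 j *: 'X_i)
  - (p 0 i * q 0 j - p 0 j * q 0 i) *: 'X_k.
exists [set G | exists k, G = F k]; split.
  move=> _ [k ->]; exists 1%N.
  by repeat (first [apply: rpredB|apply: rpredD|apply: rpredZ|exact: dhomogX1]).
have FE k v : evalv (F k) v =
    (v 0 i * q 0 j - v 0 j * q 0 i) * p 0 k + (p 0 i * v 0 j - p 0 j * v 0 i) * q 0 k
    - (p 0 i * q 0 j - p 0 j * q 0 i) * v 0 k.
  by rewrite /evalv /F !(mevalB, mevalD, mevalZ, mevalXU); ring.
apply/seteqP; split=> v [v0 Hv]; split=> //; first by move=> _ [k ->]; rewrite FE.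
by move=> k; rewrite -FE; apply: Hv; exists k.
Qed.

Lemma param_span2 p q : indep2 p q ->
  parametrizes [tuple (p 0 i)%:MP + q 0 i *: 'X_(0 : 'I_1) | i < n] (span2 p q).
Proof.
move=> ipq; set P := mktuple _.
have PE y : param_point P y = p + y 0 *: q.
  apply/rowP => i; rewrite !mxE tnth_mktuple mevalD mevalC mevalZ mevalXU.
  by rewrite mulrC.
have nz a b : a *: p + b *: q = 0 -> a = 0 /\ b = 0.
  move=> E; have [i [j m0]] := ipq.
  have Ei : a * p 0 i + b * q 0 i = 0 by have /rowP/(_ i) := E; rewrite !mxE.
  have Ej : a * p 0 j + b * q 0 j = 0 by have /rowP/(_ j) := E; rewrite !mxE.
  split; apply/eqP; rewrite -[_ == 0]orbF -(negPf m0) -mulf_eq0; apply/eqP.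
    rewrite [LHS](_ : _ = q 0 j * (a * p 0 i + b * q 0 i)
                        - q 0 i * (a * p 0 j + b * q 0 j)); last by ring.
    by rewrite Ei Ej !mulr0 subrr.
  rewrite [LHS](_ : _ = p 0 i * (a * p 0 j + b * q 0 j)
                      - p 0 j * (a * p 0 i + b * q 0 i)); last by ring.
  by rewrite Ei Ej !mulr0 subrr.
split; first exact: zclosed_span2.
  move=> y; rewrite PE; split; last by exists 1, (y 0); rewrite scale1r.
  apply/eqP => E; have [|/eqP] := nz 1 (y 0); first by rewrite scale1r.
  by rewrite oner_eq0.
move=> Y cY HY v [v0 [a [b vE]]].
have Yab a' b' : a' != 0 -> Y (a' *: p + b' *: q).
  move=> a0; rewrite (_ : _ + _ = a' *: (p + (b' / a') *: q)).
    apply: zclosed_scale => //.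
    by have := HY (fun _ => b' / a'); rewrite PE.
  by rewrite scalerDr scalerA mulrCA mulfV ?mulr1.
(* The affine chart [p + y q] misses the multiples of [q]; replacing [a] by [y + a] reaches them as
   a limit at [y = 0]. *)
pose g i : {poly K} := ('X + a%:P) * (p 0 i)%:P + (b * q 0 i)%:P.
have gE y : \row_i (g i).[y] = (y + a) *: p + b *: q.
  by apply/rowP => i; rewrite !mxE !hornerE.
have : Y (\row_i (g i).[0]); last by rewrite gE add0r -vE.
apply: (zclosed_limit (h := 'X + a%:P)) => //.
- by rewrite -size_poly_eq0 size_XaddC.
- by move=> y; rewrite !hornerE => ya; rewrite gE; apply: Yab.
- by rewrite gE add0r -vE.
Qed.

Lemma span2_left p q : indep2 p q -> span2 p q p.
Proof.
move=> [i [j m0]]; split; last by exists 1, 0; rewrite scale1r scale0r addr0.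
by apply: contraNneq m0 => ->; rewrite !mxE !mul0r subrr.
Qed.

Lemma indep2_sym p q : indep2 p q -> indep2 q p.
Proof.
move=> [i [j m0]]; exists j, i; rewrite (_ : _ - _ = p 0 i * q 0 j - p 0 j * q 0 i) //.
ring.
Qed.

Lemma span2C p q : span2 p q = span2 q p.
Proof.
by apply/seteqP; split=> v [v0 [a [b E]]]; split=> //; exists b, a; rewrite addrC.
Qed.

Lemma span2_right p q : indep2 p q -> span2 p q q.
Proof. by rewrite span2C => /indep2_sym; apply: span2_left. Qed.

Lemma variety_span2 p q : indep2 p q -> variety (span2 p q).
Proof. by move=> /param_span2; apply: parametrizes_variety. Qed.

Lemma chain1_variety X v u : variety X -> X v -> X u -> ~ point_of v u -> variety_chain X 1.
Proof.
move=> vX Xv Xu nvu; have cX := variety_closed vX.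
have v0 := zclosed_neq0 cX Xv.
exists (fun i => if i is 0%N then point_of v else X); split=> [[|[|//]] _|[|//] _].
- split; first exact: variety_point.
  by move=> _ [a a0 ->]; apply: zclosed_scale.
- by split.
- by split=> [_ [a a0 ->]|/(_ u Xu) //]; apply: zclosed_scale.
Qed.

Lemma indep2_not_point p q : indep2 p q -> ~ point_of p q.
Proof.
move=> [i [j m0]] [a _ qE]; case/negP: m0; rewrite qE !mxE; apply/eqP; ring.
Qed.

Lemma zdim_span2 p q : indep2 p q -> zdim (span2 p q) 1.
Proof.
move=> ipq; split; last exact: parametrizes_no_chain (param_span2 ipq).
apply: (@chain1_variety _ p q); [exact: variety_span2| | |exact: indep2_not_point].
  exact: span2_left.
exact: span2_right.
Qed.

(** The lower bound for surfaces: a point, a line through it and [X] form a chain as soon as [X] is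
    not the line. *)
Lemma chain2_span2 X p q u : variety X -> indep2 p q -> span2 p q `<=` X -> X u ->
  ~ span2 p q u -> variety_chain X 2.
Proof.
move=> vX ipq pqX Xu nu.
exists (fun i => if i is 0%N then point_of p else if i is 1%N then span2 p q else X).
have pp : point_of p `<=` span2 p q.
  move=> _ [a a0 ->]; apply: zclosed_scale => //; first exact: zclosed_span2.
  exact: span2_left.
split=> [[|[|[|//]]] _|[|[|//]] _].
- split; last exact: subset_trans pqX.
  by apply: variety_point; case: (span2_left ipq).
- by split=> //; apply: variety_span2.
- by split.
- split=> // /(_ q (span2_right ipq)); exact: indep2_not_point.
- by split=> // /(_ u Xu).
Qed.

Lemma flat_point p : flat (p : 'M_(1, n)) = [set v | v != 0 /\ exists a, v = a *: p].
Proof.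
apply/seteqP; split=> v [v0]; first by move=> /sub_rVP[a E]; split=> //; exists a.
by move=> [a E]; split=> //; apply/sub_rVP; exists a.
Qed.

Lemma is_pointP (V : set 'rV[K]_n) : is_point V <-> exists2 p, p != 0 & V = point_of p.
Proof.
have fE (p : 'rV[K]_n) : p != 0 -> flat (p : 'M_(1, n)) = point_of p.
  move=> p0; rewrite flat_point; apply/seteqP; split=> v [].
    move=> v0 [a vE]; exists a => //; apply: contraNneq v0 => a0.
    by rewrite vE a0 scale0r.
  by move=> a a0 ->; split; [rewrite scaler_eq0 negb_or a0 p0|exists a].
split=> [[M fM ->]|[p p0 ->]].
  have M0 : M != 0.
    by apply: contraTneq fM => ->; rewrite /row_free mxrank0.
  by exists M => //; rewrite fE.
by exists p; [rewrite /row_free rank_rV p0|rewrite fE].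
Qed.

Lemma is_lineP (V : set 'rV[K]_n) : is_line V <-> exists p q, indep2 p q /\ V = span2 p q.
Proof.
have lcE (D : 'M[K]_(1, 2)) (M : 'M[K]_(2, n)) :
    D *m M = D 0 0 *: row 0 M + D 0 1 *: row 1 M.
  rewrite mulmx_sum_row !big_ord_recl big_ord0 addr0.
  by congr (D 0 _ *: row _ M + D 0 _ *: row _ M); apply: val_inj.
have fE (M : 'M[K]_(2, n)) : flat M = span2 (row 0 M) (row 1 M).
  apply/seteqP; split=> v [v0].
    by move=> /submxP[D E]; split=> //; exists (D 0 0), (D 0 1); rewrite E lcE.
  move=> [a [b E]]; split=> //; rewrite E.
  by apply: addmx_sub; apply: scalemx_sub; apply: row_sub.
split=> [[M fM ->]|[p [q [ipq ->]]]].
  exists (row 0 M), (row 1 M); split=> //; apply: contrapT => nind.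
  have m0 i j : M 0 i * M 1 j = M 0 j * M 1 i.
    apply/eqP; rewrite -subr_eq0; apply: contrapT => m0; apply: nind; exists i, j.
    by rewrite !mxE; apply/negP.
  have M0 : row 0 M != 0.
    rewrite rowE mulmx_free_eq0 //; apply/eqP => /rowP/(_ 0).
    by rewrite !mxE eqxx /= => /eqP; rewrite oner_eq0.
  have [i M0i] := nonzero_coord M0; rewrite mxE in M0i.
  pose u : 'rV[K]_2 := \row_k (if k == 0 then - M 1 i else M 0 i).
  have : u *m M == 0.
    apply/eqP; rewrite lcE; apply/rowP => j; rewrite !mxE /=.
    by rewrite mulNr mulrC (m0 j i) mulrC addNr.
  rewrite mulmx_free_eq0 // => /eqP/rowP/(_ 1); rewrite !mxE /= => /eqP.
  by rewrite (negPf M0i).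
pose M : 'M[K]_(2, n) := \matrix_k (if k == 0 then p else q).
have r0 : row 0 M = p by rewrite rowK.
have r1 : row 1 M = q by rewrite rowK.
exists M; last by rewrite fE r0 r1.
apply: inj_row_free => u; rewrite lcE r0 r1 => E.
have [i [j m0]] := ipq.
have Ei : u 0 0 * p 0 i + u 0 1 * q 0 i = 0 by have /rowP/(_ i) := E; rewrite !mxE.
have Ej : u 0 0 * p 0 j + u 0 1 * q 0 j = 0 by have /rowP/(_ j) := E; rewrite !mxE.
have u0 : u 0 0 = 0.
  apply/eqP; rewrite -[_ == 0]orbF -(negPf m0) -mulf_eq0; apply/eqP.
  rewrite [LHS](_ : _ = q 0 j * (u 0 0 * p 0 i + u 0 1 * q 0 i)
                      - q 0 i * (u 0 0 * p 0 j + u 0 1 * q 0 j)); last by ring.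
  by rewrite Ei Ej !mulr0 subrr.
have u1 : u 0 1 = 0.
  apply/eqP; rewrite -[_ == 0]orbF -(negPf m0) -mulf_eq0; apply/eqP.
  rewrite [LHS](_ : _ = p 0 i * (u 0 0 * p 0 j + u 0 1 * q 0 j)
                      - p 0 j * (u 0 0 * p 0 i + u 0 1 * q 0 i)); last by ring.
  by rewrite Ei Ej !mulr0 subrr.
apply/rowP => k; rewrite mxE.
have : (k == 0) || (k == 1) by case: k => [[|[|]]].
by case/orP => /eqP ->.
Qed.

End SpanLine.

(** * Three standard congruences *)

Section Standard.
Variable K : numFieldType.

Lemma zclosed_and n (P Q : 'rV[K]_n -> Prop) :
  zclosed [set v | v != 0 /\ P v] -> zclosed [set v | v != 0 /\ Q v] ->
  zclosed [set v | v != 0 /\ (P v /\ Q v)].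
Proof.
move=> cP cQ; rewrite (_ : mkset _ = [set v | v != 0 /\ P v] `&` [set v | v != 0 /\ Q v]).
  exact: zclosedI.
by apply/seteqP; split=> v [] => [v0 [Pv Qv]|[v0 Pv] [_ Qv]]; split.
Qed.

Lemma zclosed_eq n (f g : 'rV[K]_n -> K) F : is_form F ->
  (forall v, evalv F v = f v - g v) -> zclosed [set v | v != 0 /\ f v = g v].
Proof.
move=> hF FE; rewrite (_ : mkset _ = [set v | v != 0 /\ f v - g v = 0]).
  exact: zclosed_eq0 hF FE.
apply/seteqP; split=> v [v0 /eqP]; first by rewrite -subr_eq0 => /eqP.
by rewrite subr_eq0 => /eqP.
Qed.

Lemma zclosed_coord0 n i : zclosed [set v : 'rV[K]_n | v != 0 /\ v 0 i = 0].
Proof. by apply: (zclosed_eq0 (F := 'X_i)); [exact: is_formX|exact: evalvX]. Qed.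

Lemma zclosed_coord_eq n i j : zclosed [set v : 'rV[K]_n | v != 0 /\ v 0 i = v 0 j].
Proof.
apply: (zclosed_eq (F := 'X_i - 'X_j)) => [|v]; last by rewrite /evalv mevalB !mevalXU.
by exists 1%N; apply: rpredB; exact: dhomogX1.
Qed.

Lemma zclosed_minor n i j k l :
  zclosed [set v : 'rV[K]_n | v != 0 /\ v 0 i * v 0 j = v 0 k * v 0 l].
Proof.
apply: (zclosed_eq (F := 'X_i * 'X_j - 'X_k * 'X_l)) => [|v].
  by exists 2%N; apply: rpredB; exact: dhomogXX.
by rewrite /evalv mevalB !mevalM !mevalXU.
Qed.

Definition e4 (i : 'I_4) : 'rV[K]_4 := delta_mx 0 i.

Definition coord_line (i j : 'I_4) : set 'rV[K]_4 :=
  [set v : 'rV[K]_4 | v != 0 /\ (v 0 i = 0 /\ v 0 j = 0)].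

Definition std_conic : set 'rV[K]_4 :=
  [set v : 'rV[K]_4 | v != 0 /\ (v 0 3 = 0 /\ v 0 0 * v 0 2 = v 0 1 * v 0 1)].

(* The lines meeting the skew lines x0 = x1 = 0 and x2 = x3 = 0. *)
Definition skew_join : set 'rV[K]_6 :=
  [set w : 'rV[K]_6 | w != 0 /\ (w 0 0 = 0 /\ (w 0 5 = 0 /\ w 0 1 * w 0 4 = w 0 2 * w 0 3))].

(** The lines tangent to the quadric x0 x3 = x1 x2 along its line x0 = x1 = 0. In Pluecker space it
    is a quadric cone in a 3-plane, with the point of that line as vertex. *)
Definition tangent_cone : set 'rV[K]_6 :=
  [set w : 'rV[K]_6 | w != 0 /\ (w 0 0 = 0 /\ (w 0 2 = w 0 3 /\ w 0 1 * w 0 4 = w 0 2 * w 0 2))].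

(* The closure of the joins of the line x0 = x1 = 0 with the conic [std_conic]. *)
Definition cubic_scroll : set 'rV[K]_6 :=
  [set w : 'rV[K]_6 | w != 0 /\ (w 0 0 = 0 /\ (w 0 1 * w 0 4 = w 0 3 * w 0 2 /\
     (w 0 1 * w 0 5 = w 0 3 * w 0 4 /\ w 0 2 * w 0 5 = w 0 4 * w 0 4)))].

Lemma zclosed_std_conic : zclosed std_conic.
Proof. by apply: zclosed_and; [exact: zclosed_coord0|exact: zclosed_minor]. Qed.

Lemma zclosed_skew_join : zclosed skew_join.
Proof.
by do !apply: zclosed_and; [exact: zclosed_coord0|exact: zclosed_coord0|exact: zclosed_minor].
Qed.

Lemma zclosed_tangent_cone : zclosed tangent_cone.
Proof.
by do !apply: zclosed_and; [exact: zclosed_coord0|exact: zclosed_coord_eq|exact: zclosed_minor].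
Qed.

Lemma zclosed_cubic_scroll : zclosed cubic_scroll.
Proof.
by do !apply: zclosed_and; [exact: zclosed_coord0|exact: zclosed_minor..].
Qed.

Lemma skew_join_coords w : skew_join w ->
  exists a b c d, w = vec6 0 (c * a) (c * b) (d * a) (d * b) 0.
Proof.
elim/vec6_ind: w => w0 w1 w2 w3 w4 w5 [_ []]; rewrite !vec6E => -> [-> E].
have [w10|w10] := eqVneq w1 0; last first.
  exists 1, (w2 / w1), w1, w3; congr vec6; try by field.
  by apply: (mulfI w10); rewrite E; field.
move: E; rewrite w10 mul0r => /esym/eqP; rewrite mulf_eq0 => /orP[]/eqP ->.
  by exists w3, w4, 0, 1; congr vec6; ring.
by exists 0, 1, w2, w4; congr vec6; ring.
Qed.

Lemma tangent_cone_coords w : tangent_cone w ->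
  exists a b k m, w = vec6 0 (k * (a * a)) (k * (a * b)) (k * (a * b)) (k * (b * b)) m.
Proof.
elim/vec6_ind: w => w0 w1 w2 w3 w4 w5 [_ []]; rewrite !vec6E => -> [<- E].
have [w10|w10] := eqVneq w1 0; last first.
  exists 1, (w2 / w1), w1, w5; congr vec6; try by field.
  by apply: (mulfI w10); rewrite E; field.
move: E; rewrite w10 mul0r => /esym/eqP; rewrite mulf_eq0 orbb => /eqP ->.
by exists 0, 1, w4, w5; congr vec6; ring.
Qed.

(** The scroll is the rank one locus of the matrix with rows (w1, w2, w4) and (w3, w4, w5). Here (t0
    : t1) selects the ruling, that is, the point of the conic, and [r], [k] move along the ruling,
    that is, along the focal line. *)
Definition scroll_point (t0 t1 r k : K) : 'rV[K]_6 :=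
  vec6 0 (r * t0) (k * (t0 * t0)) (r * t1) (k * (t0 * t1)) (k * (t1 * t1)).

Lemma cubic_scroll_coords w : cubic_scroll w ->
  exists t0 t1 r k, w = scroll_point t0 t1 r k.
Proof.
elim/vec6_ind: w => w0 w1 w2 w3 w4 w5 [_ []]; rewrite !vec6E => -> [E1 [E2 E3]].
have [w10|w10] := eqVneq w1 0; last first.
  exists w1, w3, 1, (w2 / (w1 * w1)); congr vec6; try by field.
    by apply: (mulfI w10); rewrite E1; field.
  by apply: (mulfI w10); rewrite E2; apply: (mulfI w10); rewrite mulrCA E1; field.
move: E1 E2; rewrite w10 !mul0r => /esym E1 /esym E2.
have [w30|w30] := eqVneq w3 0; last first.
  move/eqP: E1; rewrite mulf_eq0 (negPf w30) => /eqP ->.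
  move/eqP: E2; rewrite mulf_eq0 (negPf w30) => /eqP ->.
  by exists 0, w3, 1, (w5 / (w3 * w3)); congr vec6; field.
have [w20|w20] := eqVneq w2 0; last first.
  exists 1, (w4 / w2), 0, w2; rewrite w30; congr vec6; try by field.
  by apply: (mulfI w20); rewrite E3; field.
move: E3; rewrite w20 mul0r => /esym/eqP; rewrite mulf_eq0 orbb => /eqP ->.
by exists 0, 1, 0, w5; rewrite w30; congr vec6; ring.
Qed.

Lemma scroll_point_mem t0 t1 r k : scroll_point t0 t1 r k != 0 ->
  cubic_scroll (scroll_point t0 t1 r k).
Proof. by move=> w0; split=> //; rewrite !vec6E; do !split; ring. Qed.

Lemma skew_join_mem a b c d : vec6 0 (c * a) (c * b) (d * a) (d * b) 0 != 0 ->
  skew_join (vec6 0 (c * a) (c * b) (d * a) (d * b) 0).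
Proof. by move=> w0; split=> //; rewrite !vec6E; do !split; ring. Qed.

Lemma tangent_cone_mem a b k m :
  vec6 0 (k * (a * a)) (k * (a * b)) (k * (a * b)) (k * (b * b)) m != 0 ->
  tangent_cone (vec6 0 (k * (a * a)) (k * (a * b)) (k * (a * b)) (k * (b * b)) m).
Proof. by move=> w0; split=> //; rewrite !vec6E; do !split; ring. Qed.

(* A small perturbation makes all four parameters nonzero. *)
Lemma generic_limit4 n (X : set 'rV[K]_n) (g : 'I_n -> {poly K}) (a b c d : K) :
  zclosed X ->
  (forall y, y + a != 0 -> y + b != 0 -> y + c != 0 -> y + d != 0 ->
     X (\row_i (g i).[y])) ->
  \row_i (g i).[0] != 0 -> X (\row_i (g i).[0]).
Proof.
move=> cX Hg; apply: (zclosed_limit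
  (h := ('X + a%:P) * ('X + b%:P) * ('X + c%:P) * ('X + d%:P))) => //.
  by rewrite !mulf_neq0 // -size_poly_eq0 size_XaddC.
move=> y; rewrite !hornerE !mulf_eq0 !negb_or => /andP[/andP[/andP[ya yb] yc] yd].
exact: Hg.
Qed.

(** Reduces the containment in a closed set to points with nonzero parameters. These are the only
    ones for which preimages under the trilinear maps have to be written down later. *)
Lemma cubic_scroll_sub (Y : set 'rV[K]_6) : zclosed Y ->
  (forall t0 t1 r k, t0 != 0 -> t1 != 0 -> r != 0 -> k != 0 -> Y (scroll_point t0 t1 r k)) ->
  cubic_scroll `<=` Y.
Proof.
move=> cY HY w Ew; have w0 := zclosed_neq0 zclosed_cubic_scroll Ew.
have [t0 [t1 [r [k wE]]]] := cubic_scroll_coords Ew.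
pose T0 : {poly K} := 'X + t0%:P; pose T1 : {poly K} := 'X + t1%:P.
pose R : {poly K} := 'X + r%:P; pose k' : {poly K} := 'X + k%:P.
pose g (i : 'I_6) : {poly K} :=
  [:: 0; R * T0; k' * (T0 * T0); R * T1; k' * (T0 * T1); k' * (T1 * T1)]`_i.
have gE y : \row_i (g i).[y] = scroll_point (y + t0) (y + t1) (y + r) (y + k).
  by apply: eq_vec6; rewrite !mxE /= ?horner0 // !hornerE.
have : Y (\row_i (g i).[0]); last by rewrite gE !add0r -wE.
apply: (@generic_limit4 _ _ _ t0 t1 r k) => //; last by rewrite gE !add0r -wE.
by move=> y *; rewrite gE; apply: HY.
Qed.

Lemma skew_join_sub (Y : set 'rV[K]_6) : zclosed Y ->
  (forall a b c d, a != 0 -> b != 0 -> c != 0 -> d != 0 ->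
     Y (vec6 0 (c * a) (c * b) (d * a) (d * b) 0)) ->
  skew_join `<=` Y.
Proof.
move=> cY HY w Ew; have w0 := zclosed_neq0 zclosed_skew_join Ew.
have [a [b [c [d wE]]]] := skew_join_coords Ew.
pose A : {poly K} := 'X + a%:P; pose B : {poly K} := 'X + b%:P.
pose C : {poly K} := 'X + c%:P; pose D : {poly K} := 'X + d%:P.
pose g (i : 'I_6) : {poly K} := [:: 0; C * A; C * B; D * A; D * B; 0]`_i.
have gE y : \row_i (g i).[y] = vec6 0 ((y + c) * (y + a)) ((y + c) * (y + b))
    ((y + d) * (y + a)) ((y + d) * (y + b)) 0.
  by apply: eq_vec6; rewrite !mxE /= ?horner0 // !hornerE.
have : Y (\row_i (g i).[0]); last by rewrite gE !add0r -wE.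
apply: (@generic_limit4 _ _ _ a b c d) => //; last by rewrite gE !add0r -wE.
by move=> y *; rewrite gE; apply: HY.
Qed.

Lemma tangent_cone_sub (Y : set 'rV[K]_6) : zclosed Y ->
  (forall a b k m, a != 0 -> b != 0 -> k != 0 -> m != 0 ->
     Y (vec6 0 (k * (a * a)) (k * (a * b)) (k * (a * b)) (k * (b * b)) m)) ->
  tangent_cone `<=` Y.
Proof.
move=> cY HY w Ew; have w0 := zclosed_neq0 zclosed_tangent_cone Ew.
have [a [b [k [m wE]]]] := tangent_cone_coords Ew.
pose A : {poly K} := 'X + a%:P; pose B : {poly K} := 'X + b%:P.
pose k' : {poly K} := 'X + k%:P; pose M : {poly K} := 'X + m%:P.
pose g (i : 'I_6) : {poly K} :=
  [:: 0; k' * (A * A); k' * (A * B); k' * (A * B); k' * (B * B); M]`_i.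
have gE y : \row_i (g i).[y] = vec6 0 ((y + k) * ((y + a) * (y + a)))
    ((y + k) * ((y + a) * (y + b))) ((y + k) * ((y + a) * (y + b)))
    ((y + k) * ((y + b) * (y + b))) (y + m).
  by apply: eq_vec6; rewrite !mxE /= ?horner0 // !hornerE.
have : Y (\row_i (g i).[0]); last by rewrite gE !add0r -wE.
apply: (@generic_limit4 _ _ _ a b k m) => //; last by rewrite gE !add0r -wE.
by move=> y *; rewrite gE; apply: HY.
Qed.

Let X0 : {mpoly K[2]} := 'X_0.
Let X1 : {mpoly K[2]} := 'X_1.

Lemma param_cubic_scroll :
  parametrizes [tuple 0; 1; X1; X0; X1 * X0; X1 * (X0 * X0)] cubic_scroll.
Proof.
set P := (X in parametrizes X).
have PE y : param_point P y = scroll_point 1 (y 0) 1 (y 1).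
  by apply: eq_vec6; rewrite !mxE /= ?(meval0, meval1, mevalM, mevalXU) ?mul1r ?mulr1.
split; first exact: zclosed_cubic_scroll.
  move=> y; rewrite PE; apply: scroll_point_mem.
  by rewrite vec6_eq0 mulr1 oner_eq0 andbF.
move=> Y cY HY; apply: cubic_scroll_sub => // t0 t1 r k t00 t10 r0 k0.
have -> : scroll_point t0 t1 r k = (r * t0) *: scroll_point 1 (t1 / t0) 1 (k * t0 / r).
  by rewrite vec6Z; congr vec6; field; rewrite ?r0 ?t00.
apply: zclosed_scale; rewrite ?mulf_neq0 //.
have := HY (fun i => if i == 0 then t1 / t0 else k * t0 / r).
by rewrite PE.
Qed.

Lemma param_skew_join :
  parametrizes [tuple 0; 1; X1; X0; X0 * X1; 0] skew_join.
Proof.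
set P := (X in parametrizes X).
have PE y : param_point P y = vec6 0 (1 * 1) (1 * y 1) (y 0 * 1) (y 0 * y 1) 0.
  by apply: eq_vec6; rewrite !mxE /= ?(meval0, meval1, mevalM, mevalXU) ?mul1r ?mulr1.
split; first exact: zclosed_skew_join.
  move=> y; rewrite PE; apply: skew_join_mem.
  by rewrite vec6_eq0 mulr1 oner_eq0 andbF.
move=> Y cY HY; apply: skew_join_sub => // a b c d a0 b0 c0 d0.
have -> : vec6 0 (c * a) (c * b) (d * a) (d * b) 0 =
   (c * a) *: vec6 0 (1 * 1) (1 * (b / a)) (d / c * 1) (d / c * (b / a)) 0.
  by rewrite vec6Z; congr vec6; field; rewrite ?a0 ?c0.
apply: zclosed_scale; rewrite ?mulf_neq0 //.
have := HY (fun i => if i == 0 then d / c else b / a).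
by rewrite PE.
Qed.

Lemma param_tangent_cone :
  parametrizes [tuple 0; 1; X0; X0; X0 * X0; X1] tangent_cone.
Proof.
set P := (X in parametrizes X).
have PE y : param_point P y =
    vec6 0 (1 * (1 * 1)) (1 * (1 * y 0)) (1 * (1 * y 0)) (1 * (y 0 * y 0)) (y 1).
  by apply: eq_vec6; rewrite !mxE /= ?(meval0, meval1, mevalM, mevalXU) ?mul1r ?mulr1.
split; first exact: zclosed_tangent_cone.
  move=> y; rewrite PE; apply: tangent_cone_mem.
  by rewrite vec6_eq0 !mulr1 oner_eq0 andbF.
move=> Y cY HY; apply: tangent_cone_sub => // a b k m a0 b0 k0 m0.
have -> : vec6 0 (k * (a * a)) (k * (a * b)) (k * (a * b)) (k * (b * b)) m =
   (k * (a * a)) *: vec6 0 (1 * (1 * 1)) (1 * (1 * (b / a))) (1 * (1 * (b / a)))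
      (1 * (b / a * (b / a))) (m / (k * (a * a))).
  by rewrite vec6Z; congr vec6; field; rewrite ?a0 ?k0.
apply: zclosed_scale; rewrite ?mulf_neq0 //.
have := HY (fun i => if i == 0 then b / a else m / (k * (a * a))).
by rewrite PE.
Qed.

Definition conic_point (t : K) : 'rV[K]_4 := vec4 1 t (t * t) 0.

Lemma param_std_conic :
  parametrizes [tuple 1; 'X_0 : {mpoly K[1]}; 'X_0 * 'X_0; 0] std_conic.
Proof.
set P := (X in parametrizes X).
have PE y : param_point P y = conic_point (y 0).
  by apply: eq_vec4; rewrite !mxE /= ?(meval0, meval1, mevalM, mevalXU).
split; first exact: zclosed_std_conic.
  move=> y; rewrite PE; split; first by rewrite vec4_eq0 oner_eq0.
  by rewrite !vec4E; split=> //; ring.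
move=> Y cY HY; elim/vec4_ind => a b c d [v0 []]; rewrite !vec4E => dE E.
have Yc t : Y (conic_point t) by have := HY (fun _ => t); rewrite PE.
have [a0|a0] := eqVneq a 0; last first.
  rewrite (_ : vec4 _ _ _ _ = a *: conic_point (b / a)); first exact: zclosed_scale.
  rewrite vec4Z dE; congr vec4; rewrite ?mulr1 ?mulr0 //; first by field.
  by apply: (mulfI a0); rewrite E; field.
move: E; rewrite a0 mul0r => /esym/eqP; rewrite mulf_eq0 orbb => /eqP b0.
rewrite a0 b0 dE in v0 *.
have c0 : c != 0 by move: v0; rewrite vec4_eq0 eqxx andbT.
rewrite (_ : vec4 _ _ _ _ = c *: vec4 0 0 1 0); last first.
  by rewrite vec4Z; congr vec4; ring.
apply: zclosed_scale => //.
(* The one point missed by the chart is (0 : 0 : 1 : 0); the curve (y^2 : y : 1 : 0), proportional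
   to [conic_point (1 / y)], runs into it. *)
pose g (i : 'I_4) : {poly K} := [:: 'X * 'X; 'X; 1; 0]`_i.
have gE y : \row_i (g i).[y] = vec4 (y * y) y 1 0.
  by apply: eq_vec4; rewrite !mxE /= !hornerE.
have : Y (\row_i (g i).[0]); last by rewrite gE mul0r.
apply: (zclosed_limit (h := 'X)) => //; first by rewrite polyX_eq0.
  move=> y; rewrite hornerX => y0; rewrite gE.
  rewrite (_ : vec4 _ _ _ _ = (y * y) *: conic_point y^-1).
    by apply: zclosed_scale; rewrite ?mulf_neq0.
  by rewrite vec4Z; congr vec4; field.
by rewrite gE vec4_eq0 oner_eq0 !andbF.
Qed.

Lemma variety_std_conic : variety std_conic.
Proof. exact: parametrizes_variety param_std_conic. Qed.

Lemma conic_point_mem t : std_conic (conic_point t).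
Proof.
split; first by rewrite vec4_eq0 oner_eq0.
by rewrite !vec4E; split=> //; ring.
Qed.

Lemma zdim_std_conic : zdim std_conic 1.
Proof.
split; last exact: parametrizes_no_chain param_std_conic.
apply: (@chain1_variety _ _ _ (conic_point 0) (conic_point 1)) => //.
- exact: variety_std_conic.
- exact: conic_point_mem.
- exact: conic_point_mem.
move=> [a a0 /rowP E]; have := E 1; rewrite !mxE /= mulr0 => /eqP.
by rewrite oner_eq0.
Qed.

Lemma zdim2_of_param X p (q1 q2 u : 'rV[K]_6) : @parametrizes K 6 2 p X ->
  indep2 q1 q2 -> span2 q1 q2 `<=` X -> X u -> ~ span2 q1 q2 u -> zdim X 2.
Proof.
move=> pX iq qX Xu nu; split; last exact: parametrizes_no_chain pX.
exact: chain2_span2 (parametrizes_variety pX) iq qX Xu nu.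
Qed.

Let f1 : 'rV[K]_6 := vec6 0 1 0 0 0 0.
Let f2 : 'rV[K]_6 := vec6 0 0 1 0 0 0.
Let f5 : 'rV[K]_6 := vec6 0 0 0 0 0 1.

Lemma zdim_cubic_scroll : zdim cubic_scroll 2.
Proof.
apply: (@zdim2_of_param _ _ f1 f2 (scroll_point 1 1 1 1)) param_cubic_scroll _ _ _ _.
- by exists 1, 2; rewrite !vec6E mulr1 mulr0 subr0 oner_eq0.
- move=> v [v0 [a [b vE]]]; move: v0; rewrite vE => v0; split=> //.
  by rewrite !mxE /=; do !split; ring.
- by apply: scroll_point_mem; rewrite /scroll_point !mulr1 vec6_eq0 oner_eq0 !andbF.
move=> [_ [a [b /rowP/(_ 3)]]]; rewrite !mxE /= !mulr0 addr0 mulr1 => /eqP.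
by rewrite oner_eq0.
Qed.

Lemma zdim_skew_join : zdim skew_join 2.
Proof.
apply: (@zdim2_of_param _ _ f1 f2 (vec6 0 (1 * 1) (1 * 1) (1 * 1) (1 * 1) 0)) param_skew_join _ _ _ _.
- by exists 1, 2; rewrite !vec6E mulr1 mulr0 subr0 oner_eq0.
- move=> v [v0 [a [b vE]]]; move: v0; rewrite vE => v0; split=> //.
  by rewrite !mxE /=; do !split; ring.
- by apply: skew_join_mem; rewrite !mulr1 vec6_eq0 oner_eq0 !andbF.
move=> [_ [a [b /rowP/(_ 3)]]]; rewrite !mxE /= !mulr0 addr0 mulr1 => /eqP.
by rewrite oner_eq0.
Qed.

Lemma zdim_tangent_cone : zdim tangent_cone 2.
Proof.
apply: (@zdim2_of_param _ _ f1 f5 (vec6 0 (1 * (1 * 1)) (1 * (1 * 1)) (1 * (1 * 1)) (1 * (1 * 1)) 0)) param_tangent_cone _ _ _ _.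
- by exists 1, 5; rewrite !vec6E mulr1 mulr0 subr0 oner_eq0.
- move=> v [v0 [a [b vE]]]; move: v0; rewrite vE => v0; split=> //.
  by rewrite !mxE /=; do !split; ring.
- by apply: tangent_cone_mem; rewrite !mulr1 vec6_eq0 oner_eq0 !andbF.
move=> [_ [a [b /rowP/(_ 3)]]]; rewrite !mxE /= !mulr0 addr0 !mulr1 => /eqP.
by rewrite oner_eq0.
Qed.

Lemma cubic_scroll_klein : cubic_scroll `<=` @klein K.
Proof.
move=> w Ew; have [_ [E0 [E1 [E2 E3]]]] := Ew.
by split; [exact: zclosed_neq0 zclosed_cubic_scroll Ew|rewrite E0 E1; ring].
Qed.

Lemma skew_join_klein : skew_join `<=` @klein K.
Proof.
move=> w Ew; have [w0 [E0 [E1 E2]]] := Ew.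
by split=> //; rewrite E0 E2; ring.
Qed.

Lemma tangent_cone_klein : tangent_cone `<=` @klein K.
Proof.
move=> w Ew; have [w0 [E0 [E1 E2]]] := Ew.
by split=> //; rewrite E0 E2 E1; ring.
Qed.

End Standard.

(** * Focal loci of the two linear congruences *)

Section Focal.
Variable K : numFieldType.
Local Notation axis := (@coord_line K).
Implicit Types (V W : set 'rV[K]_4) (X : set 'rV[K]_6) (P Q v y : 'rV[K]_4).

(** If through each point of [V] there is a line of [X] meeting [V] nowhere else, then a subset
    meeting all lines must contain every point of [V]. *)
Lemma focal_of_tight X V : variety V -> meets_all V X ->
  (forall P, V P -> exists2 w, X w & forall v, V v -> line_of w v -> point_of P v) ->
  focal X V.
Proof.
move=> vV mV tight; split=> // W vW [WV nVW] mW; apply: nVW => P VP.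
have [w Xw Hw] := tight P VP; have [v [Wv lv]] := mW w Xw.
have [a a0 vE] := Hw v (WV v Wv) lv.
by apply/(zclosed_scaleE _ (variety_closed vW) a0); rewrite -vE.
Qed.

Lemma meets_wedge V w v y : w != 0 -> V v -> v != 0 -> w = wedge v y ->
  V `&` line_of w !=set0.
Proof. by move=> w0 Vv v0 wE; exists v; split=> //; apply/line_ofP => //; split=> //; exists y. Qed.

Lemma indep2_wedge P Q : indep2 P Q <-> wedge P Q != 0.
Proof.
split=> [[i [j m0]]|/wedge_neq0 //].
apply: contraNneq m0 => w0; apply/eqP.
have -> : P 0 i * Q 0 j - P 0 j * Q 0 i = minor P Q i j by [].
rewrite (@minor_wedge _ _ _ 0 0); first by rewrite /minor !mxE; ring.
rewrite w0; apply/esym/eqP; rewrite wedgeE vec6_eq0 /minor !mxE !mul0r subrr.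
by rewrite eqxx.
Qed.

Lemma span2_line_of P Q : wedge P Q != 0 -> span2 P Q = line_of (wedge P Q).
Proof.
by move=> w0; apply/seteqP; split=> v; [move=> H; apply/line_of_wedge|move/line_of_wedge; apply].
Qed.

Lemma line_ofZ a (w : 'rV[K]_6) : a != 0 -> w != 0 -> line_of (a *: w) = line_of w.
Proof.
move=> a0 w0; have aw0 : a *: w != 0 by rewrite scaler_eq0 negb_or a0.
have sc b P Q : wedge P (b *: Q) = b *: wedge P Q.
  by apply: eq_vec6; rewrite !mxE /=; ring.
apply/seteqP; split=> v /line_ofP[]// v0 [y E]; apply/line_ofP => //; split=> //.
  by exists (a^-1 *: y); rewrite sc -E scalerA mulVf // scale1r.
by exists (a *: y); rewrite sc -E.
Qed.

Lemma eq_span2 a P Q P' Q' : a != 0 -> wedge P' Q' != 0 ->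
  wedge P Q = a *: wedge P' Q' -> span2 P Q = span2 P' Q'.
Proof.
move=> a0 w0 E; rewrite !span2_line_of ?E ?line_ofZ //.
by rewrite scaler_eq0 negb_or a0.
Qed.

Lemma span2_klein P Q : indep2 P Q -> @klein K (wedge P Q).
Proof. by move/indep2_wedge; exact: klein_wedge. Qed.

(* The polarization of the Klein quadric: it vanishes on pairs of meeting lines. *)
Definition klein_form (a w : 'rV[K]_6) : K :=
  a 0 0 * w 0 5 - a 0 1 * w 0 4 + a 0 2 * w 0 3 + a 0 3 * w 0 2 - a 0 4 * w 0 1 + a 0 5 * w 0 0.

Lemma klein_form_meet (a w : 'rV[K]_6) v : a != 0 -> w != 0 ->
  line_of a v -> line_of w v -> klein_form a w = 0.
Proof.
move=> a0 w0 /line_ofP[]// v0 [y ->] /line_ofP[]// _ [z ->].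
by rewrite /klein_form !wedgeE !vec6E /minor; ring.
Qed.

(** For a line, meeting all of [X] is a linear condition on its Pluecker vector: orthogonality to
    [X] for the Klein form. When [X] spans a 3-plane, the focal lines thus lie on the polar line of
    this 3-plane. *)
Lemma meets_all_klein_form X P Q w : indep2 P Q -> meets_all (span2 P Q) X ->
  X w -> w != 0 -> klein_form (wedge P Q) w = 0.
Proof.
move=> /indep2_wedge ipq mX Xw w0; have [v []] := mX w Xw.
by rewrite span2_line_of // => /klein_form_meet H /H; apply.
Qed.

Lemma coord_line01E : axis 0 1 = span2 (vec4 0 0 1 0) (vec4 0 0 0 1).
Proof.
apply/seteqP; split=> v; last first.
  move=> [v0 [a [b vE]]]; split=> //; rewrite vE vec4_lin !vec4E.
  by split; ring.
elim/vec4_ind: v => a b c d [v0]; rewrite !vec4E => -[a0 b0]; split=> //.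
by exists c, d; rewrite a0 b0 vec4_lin; congr vec4; ring.
Qed.

Lemma coord_line23E : axis 2 3 = span2 (vec4 1 0 0 0) (vec4 0 1 0 0).
Proof.
apply/seteqP; split=> v; last first.
  move=> [v0 [a [b vE]]]; split=> //; rewrite vE vec4_lin !vec4E.
  by split; ring.
elim/vec4_ind: v => a b c d [v0]; rewrite !vec4E => -[c0 d0]; split=> //.
by exists a, b; rewrite c0 d0 vec4_lin; congr vec4; ring.
Qed.

Lemma wedge01 : wedge (vec4 0 0 1 0) (vec4 0 0 0 1) = vec6 0 0 0 0 0 1 :> 'rV[K]_6.
Proof. by rewrite wedge_vec4; congr vec6; ring. Qed.

Lemma wedge23 : wedge (vec4 1 0 0 0) (vec4 0 1 0 0) = vec6 1 0 0 0 0 0 :> 'rV[K]_6.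
Proof. by rewrite wedge_vec4; congr vec6; ring. Qed.

Lemma indep2_01 : indep2 (vec4 0 0 1 0 : 'rV[K]_4) (vec4 0 0 0 1).
Proof. by apply/indep2_wedge; rewrite wedge01 vec6_eq0 oner_eq0 !andbF. Qed.

Lemma indep2_23 : indep2 (vec4 1 0 0 0 : 'rV[K]_4) (vec4 0 1 0 0).
Proof. by apply/indep2_wedge; rewrite wedge23 vec6_eq0 oner_eq0. Qed.

Lemma variety_line01 : variety (axis 0 1).
Proof. by rewrite coord_line01E; apply: variety_span2; exact: indep2_01. Qed.

Lemma variety_line23 : variety (axis 2 3).
Proof. by rewrite coord_line23E; apply: variety_span2; exact: indep2_23. Qed.

Lemma is_line01 : is_line (axis 0 1).
Proof. by rewrite coord_line01E; apply/is_lineP; do 2!eexists; split; first exact: indep2_01. Qed.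

Lemma is_line23 : is_line (axis 2 3).
Proof. by rewrite coord_line23E; apply/is_lineP; do 2!eexists; split; first exact: indep2_23. Qed.

Lemma zdim_line01 : zdim (axis 0 1) 1.
Proof. by rewrite coord_line01E; apply: zdim_span2; exact: indep2_01. Qed.

Lemma skew_line01_23 : Defs.skew (axis 0 1) (axis 2 3).
Proof.
apply/seteqP; split=> // v [[v0 [h0 h1]] [_ [h2 h3]]]; case/negP: v0; apply/eqP.
by apply: eq_vec4; rewrite mxE.
Qed.

Lemma vec4_neq0_01 (c d : K) : vec4 0 0 c d != 0 -> (c != 0) || (d != 0).
Proof. by rewrite vec4_eq0 eqxx /= negb_and. Qed.

Lemma point_of_scale P v b : v != 0 -> v = b *: P -> point_of P v.
Proof.
by move=> v0 vE; exists b => //; apply: contraNneq v0 => b0; rewrite vE b0 scale0r.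
Qed.

Lemma line_wedge_mem P Q v : wedge P Q != 0 -> line_of (wedge P Q) v ->
  v != 0 /\ exists a b, v = a *: P + b *: Q.
Proof. by move=> w0 /(line_of_wedge v w0). Qed.

Lemma line_ofl P Q : wedge P Q != 0 -> line_of (wedge P Q) P.
Proof. by move=> w0; rewrite -span2_line_of //; apply: span2_left; apply/indep2_wedge. Qed.

Lemma line_ofr P Q : wedge P Q != 0 -> line_of (wedge P Q) Q.
Proof. by move=> w0; rewrite -span2_line_of //; apply: span2_right; apply/indep2_wedge. Qed.

Lemma meets_skew_join01 : meets_all (axis 0 1) (@skew_join K).
Proof.
move=> w Ew; have w0 := zclosed_neq0 (zclosed_skew_join K) Ew.
have [a [b [c [d wE]]]] := skew_join_coords Ew.
apply: (@meets_wedge _ _ (vec4 0 0 a b) (vec4 (- c) (- d) 0 0)) => //.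
- split; last by rewrite !vec4E.
  apply: contraNneq w0 => /eqP; rewrite vec4_eq0 eqxx /= => /andP[/eqP a0 /eqP b0].
  by rewrite wE a0 b0 !mulr0 vec6_eq0 eqxx.
- apply: contraNneq w0 => /eqP; rewrite vec4_eq0 eqxx /= => /andP[/eqP a0 /eqP b0].
  by rewrite wE a0 b0 !mulr0 vec6_eq0 eqxx.
by rewrite wE wedge_vec4; congr vec6; ring.
Qed.

Lemma meets_skew_join23 : meets_all (axis 2 3) (@skew_join K).
Proof.
move=> w Ew; have w0 := zclosed_neq0 (zclosed_skew_join K) Ew.
have [a [b [c [d wE]]]] := skew_join_coords Ew.
have nz : vec4 c d 0 0 != 0.
  apply: contraNneq w0 => /eqP; rewrite vec4_eq0 eqxx !andbT => /andP[/eqP a0 /eqP b0].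
  by rewrite wE a0 b0 !mul0r vec6_eq0 eqxx.
apply: (@meets_wedge _ _ (vec4 c d 0 0) (vec4 0 0 a b)) => //.
  by split=> //; rewrite !vec4E.
by rewrite wE wedge_vec4; congr vec6; ring.
Qed.

Lemma focal_skew_join01 : focal (@skew_join K) (axis 0 1).
Proof.
apply: focal_of_tight; [exact: variety_line01|exact: meets_skew_join01|].
elim/vec4_ind => a b c d [P0]; rewrite !vec4E => -[a0 b0].
(* The test line joins the given point to a point of the other focal line; it meets [axis 0 1] only
   once. *)
have wE : wedge (vec4 1 0 0 0) (vec4 a b c d) = vec6 0 (1 * c) (1 * d) (0 * c) (0 * d) 0.
  by rewrite wedge_vec4 a0 b0; congr vec6; ring.
have w0 : wedge (vec4 1 0 0 0) (vec4 a b c d) != 0.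
  by rewrite wE vec6_eq0; move: P0; rewrite vec4_eq0 a0 b0 !mul1r !mul0r !eqxx /= andbT.
exists (wedge (vec4 1 0 0 0) (vec4 a b c d)).
  by rewrite wE; apply: skew_join_mem; rewrite -wE.
move=> v [v0 [v00 v01]] /line_wedge_mem[]// _ [x [y vE]].
apply: (point_of_scale v0 (b := y)).
move: v00; rewrite vE vec4_lin !vec4E a0 mulr0 mulr1 addr0 => ->.
by rewrite b0 vec4Z; congr vec4; ring.
Qed.

Lemma focal_skew_join23 : focal (@skew_join K) (axis 2 3).
Proof.
apply: focal_of_tight; [exact: variety_line23|exact: meets_skew_join23|].
elim/vec4_ind => a b c d [P0]; rewrite !vec4E => -[c0 d0].
have wE : wedge (vec4 a b c d) (vec4 0 0 1 0) = vec6 0 (a * 1) (a * 0) (b * 1) (b * 0) 0.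
  by rewrite wedge_vec4 c0 d0; congr vec6; ring.
have w0 : wedge (vec4 a b c d) (vec4 0 0 1 0) != 0.
  by rewrite wE vec6_eq0; move: P0; rewrite vec4_eq0 c0 d0 !mulr1 !mulr0 !eqxx /= !andbT.
exists (wedge (vec4 a b c d) (vec4 0 0 1 0)).
  by rewrite wE; apply: skew_join_mem; rewrite -wE.
move=> v [v0 [v02 v03]] /line_wedge_mem[]// _ [x [y vE]].
apply: (point_of_scale v0 (b := x)).
move: v02; rewrite vE vec4_lin !vec4E c0 mulr0 mulr1 add0r => ->.
by rewrite d0 vec4Z; congr vec4; ring.
Qed.

(** Four lines of the congruence kill the middle coordinates, and on the remaining polar line the
    Klein relation is [a0 a5 = 0], whence two solutions. *)
Lemma focal_lines_skew_join :
  focal_lines (@skew_join K) = [set axis 0 1; axis 2 3].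
Proof.
apply/seteqP; split=> V /=; last first.
  by case=> ->; split; [exact: is_line01|exact: focal_skew_join01
                       |exact: is_line23|exact: focal_skew_join23].
move=> [/is_lineP[P [Q [iPQ ->]]] [_ mV _]].
have [w0 kl] := span2_klein iPQ.
have kf := @meets_all_klein_form _ P Q _ iPQ mV.
move: kl; rewrite -/(wedge P Q); move E : (wedge P Q) w0 kf => w.
elim/vec6_ind: w E => a0 a1 a2 a3 a4 a5 E w0 kf; rewrite !vec6E => kl.
have kf' a b c d : vec6 0 (c * a) (c * b) (d * a) (d * b) 0 != 0 ->
    - (a1 * (d * b)) + a2 * (d * a) + a3 * (c * b) - a4 * (c * a) = 0.
  move=> nz; have := kf _ (skew_join_mem nz) nz; rewrite /klein_form !vec6E => H.
  by rewrite -[RHS]H; ring.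
have e1 : a1 = 0.
  have /kf' H : vec6 0 (0 * 0) (0 * 1) (1 * 0) (1 * 1) 0 != 0 :> 'rV[K]_6.
    by rewrite vec6_eq0 !(mul0r, mulr0, mulr1) oner_eq0 ?andbF.
  by apply: oppr_inj; rewrite oppr0 -[RHS]H; ring.
have e2 : a2 = 0.
  have /kf' H : vec6 0 (0 * 1) (0 * 0) (1 * 1) (1 * 0) 0 != 0 :> 'rV[K]_6.
    by rewrite vec6_eq0 !(mul0r, mulr0, mulr1) oner_eq0 ?andbF.
  by rewrite -[RHS]H; ring.
have e3 : a3 = 0.
  have /kf' H : vec6 0 (1 * 0) (1 * 1) (0 * 0) (0 * 1) 0 != 0 :> 'rV[K]_6.
    by rewrite vec6_eq0 !(mul0r, mulr0, mulr1) oner_eq0 ?andbF.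
  by rewrite -[RHS]H; ring.
have e4 : a4 = 0.
  have /kf' H : vec6 0 (1 * 1) (1 * 0) (0 * 1) (0 * 0) 0 != 0 :> 'rV[K]_6.
    by rewrite vec6_eq0 !(mul0r, mulr0, mulr1) oner_eq0 ?andbF.
  by apply: oppr_inj; rewrite oppr0 -[RHS]H; ring.
rewrite e1 e2 e3 e4 in kl E w0.
have [a00|a00] := eqVneq a0 0.
  left; rewrite coord_line01E; apply: (@eq_span2 a5).
  - by move: w0; rewrite vec6_eq0 a00 eqxx.
  - exact/indep2_wedge/indep2_01.
  - by rewrite E wedge01 vec6Z a00 !mulr0 mulr1.
right; rewrite coord_line23E; apply: (@eq_span2 a0) => //.
  exact/indep2_wedge/indep2_23.
rewrite E wedge23 vec6Z !mulr0 mulr1; congr vec6.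
have /eqP : a0 * a5 = 0 by rewrite -[RHS]kl; ring.
by rewrite mulf_eq0 (negPf a00) => /eqP.
Qed.

Lemma tangent_cone_wedge w : tangent_cone w -> exists (a b c d k : K),
  [/\ (a != 0) || (b != 0) & w = wedge (vec4 0 0 a b) (vec4 (k * a) (k * b) c d)].
Proof.
move=> Ew; have w0 := zclosed_neq0 (zclosed_tangent_cone K) Ew.
have [a [b [k [m wE]]]] := tangent_cone_coords Ew.
have [a0|a0] := eqVneq a 0; last first.
  exists a, b, 0, (m / a), (- k); rewrite a0; split=> //.
  by rewrite wE wedge_vec4; congr vec6; try ring; field.
have [b0|b0] := eqVneq b 0; last first.
  exists a, b, (- m / b), 0, (- k); rewrite b0 orbT; split=> //.
  by rewrite wE wedge_vec4; congr vec6; try ring; field.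
exists 1, 0, 0, m, 0; rewrite oner_eq0; split=> //.
by rewrite wE a0 b0 wedge_vec4; congr vec6; ring.
Qed.

Lemma meets_tangent_cone01 : meets_all (axis 0 1) (@tangent_cone K).
Proof.
move=> w Ew; have w0 := zclosed_neq0 (zclosed_tangent_cone K) Ew.
have [a [b [y0 [y1 [k [ab wE]]]]]] := tangent_cone_wedge Ew.
have nz : vec4 0 0 a b != 0 by rewrite vec4_eq0 eqxx /= negb_and.
apply: (meets_wedge w0 _ nz wE).
by split=> //; rewrite !vec4E.
Qed.

Lemma focal_tangent_cone01 : focal (@tangent_cone K) (axis 0 1).
Proof.
apply: focal_of_tight; [exact: variety_line01|exact: meets_tangent_cone01|].
elim/vec4_ind => a' b' a b [P0]; rewrite !vec4E => -[a0 b0].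
move: P0; rewrite a0 b0 => P0; have ab := vec4_neq0_01 P0.
have wE : wedge (vec4 0 0 a b) (vec4 a b 0 0) =
    vec6 0 (-1 * (a * a)) (-1 * (a * b)) (-1 * (a * b)) (-1 * (b * b)) 0.
  by rewrite wedge_vec4; congr vec6; ring.
have w0 : wedge (vec4 0 0 a b) (vec4 a b 0 0) != 0.
  rewrite wE vec6_eq0 !mulf_eq0 oppr_eq0 oner_eq0 eqxx !orbb /= andbT.
  by case/orP: ab => /negPf ->; rewrite ?andbF.
exists (wedge (vec4 0 0 a b) (vec4 a b 0 0)).
  by rewrite wE; apply: tangent_cone_mem; rewrite -wE.
move=> v [v0 [v00 v01]] /line_wedge_mem[]// _ [x [y vE]].
apply: (point_of_scale v0 (b := x)).
move: v00 v01; rewrite vE vec4_lin !vec4E !mulr0 !add0r => /eqP + /eqP.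
rewrite !mulf_eq0 => h1 h2; have y0 : y = 0.
  by apply/eqP; case/orP: ab => /negPf nz; move: h1 h2; rewrite nz ?orbF.
by rewrite y0 vec4Z; congr vec4; ring.
Qed.

(** Here the polar line [a0 = a1 = a4 = 0], [a3 = - a2] is tangent to the Klein quadric: the Klein
    relation becomes a square, and only one line is left. *)
Lemma focal_lines_tangent_cone : focal_lines (@tangent_cone K) = [set axis 0 1].
Proof.
apply/seteqP; split=> V /=; last first.
  by move=> ->; split; [exact: is_line01|exact: focal_tangent_cone01].
move=> [/is_lineP[P [Q [iPQ ->]]] [_ mV _]].
have [w0 kl] := span2_klein iPQ.
have kf := @meets_all_klein_form _ P Q _ iPQ mV.
move: kl; rewrite -/(wedge P Q); move E : (wedge P Q) w0 kf => w.
elim/vec6_ind: w E => a0 a1 a2 a3 a4 a5 E w0 kf; rewrite !vec6E => kl.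
have kf' a b m : vec6 0 (1 * (a * a)) (1 * (a * b)) (1 * (a * b)) (1 * (b * b)) m != 0 ->
    a0 * m - (a1 * (b * b)) + (a2 + a3) * (a * b) - a4 * (a * a) = 0.
  move=> nz; have := kf _ (tangent_cone_mem nz) nz; rewrite /klein_form !vec6E => H.
  by rewrite -[RHS]H; ring.
have e1 : a1 = 0.
  have /kf' H : vec6 0 (1 * (0 * 0)) (1 * (0 * 1)) (1 * (0 * 1)) (1 * (1 * 1)) 0 != 0 :> 'rV[K]_6.
    by rewrite vec6_eq0 !(mul0r, mulr0, mulr1) oner_eq0 ?andbF.
  by apply: oppr_inj; rewrite oppr0 -[RHS]H; ring.
have e4 : a4 = 0.
  have /kf' H : vec6 0 (1 * (1 * 1)) (1 * (1 * 0)) (1 * (1 * 0)) (1 * (0 * 0)) 0 != 0 :> 'rV[K]_6.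
    by rewrite vec6_eq0 !(mul0r, mulr0, mulr1) oner_eq0 ?andbF.
  by apply: oppr_inj; rewrite oppr0 -[RHS]H; ring.
have e0 : a0 = 0.
  have /kf' H : vec6 0 (1 * (0 * 0)) (1 * (0 * 0)) (1 * (0 * 0)) (1 * (0 * 0)) 1 != 0 :> 'rV[K]_6.
    by rewrite vec6_eq0 !(mul0r, mulr0, mulr1) oner_eq0 ?andbF.
  by rewrite -[RHS]H; ring.
have e23 : a3 = - a2.
  have /kf' H : vec6 0 (1 * (1 * 1)) (1 * (1 * 1)) (1 * (1 * 1)) (1 * (1 * 1)) 0 != 0 :> 'rV[K]_6.
    by rewrite vec6_eq0 !mulr1 oner_eq0 ?andbF.
  by rewrite -[RHS]addr0 -[X in _ + X]H e0 e1 e4; ring.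
have e2 : a2 = 0.
  have /eqP : a2 * a2 = 0 by apply: oppr_inj; rewrite oppr0 -[RHS]kl e0 e1 e23; ring.
  by rewrite mulf_eq0 orbb => /eqP.
rewrite e23 e0 e1 e2 e4 oppr0 in E w0.
rewrite coord_line01E; apply: (@eq_span2 a5).
- by move: w0; rewrite vec6_eq0 eqxx.
- exact/indep2_wedge/indep2_01.
- by rewrite E wedge01 vec6Z !mulr0 mulr1.
Qed.

End Focal.

(** * Focal curves of the cubic scroll *)

Section CubicScroll.
Variable K : numFieldType.
Local Notation axis := (@coord_line K).
Local Notation scroll := (@cubic_scroll K).
Local Notation conic := (@std_conic K).
Implicit Types (V W : set 'rV[K]_4) (v P Q : 'rV[K]_4).

(** The second alternative is the fibre over the common point (0 : 0 : 1 : 0) of the conic and the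
    line, where the join is not determined: it consists of lines through this point in the plane x0
    = 0. *)
Lemma scroll_wedge w : scroll w ->
  (exists t c d, [/\ w = wedge (conic_point t) (vec4 0 0 c d) & (c != 0) || (d != 0)]) \/
  (exists c d, w = wedge (vec4 0 0 1 0) (vec4 0 c 0 d)).
Proof.
move=> Ew; have w0 := zclosed_neq0 (zclosed_cubic_scroll K) Ew.
have [t0 [t1 [r [k wE]]]] := cubic_scroll_coords Ew.
have [t00|t00] := eqVneq t0 0; last first.
  left; exists (t1 / t0), (r * t0), (k * (t0 * t0)).
  have E : w = wedge (conic_point (t1 / t0)) (vec4 0 0 (r * t0) (k * (t0 * t0))).
    by rewrite wE wedge_vec4; congr vec6; by field.
  split=> //; rewrite -negb_and; apply: contraNN w0 => /andP[/eqP r0 /eqP k0].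
  by rewrite E r0 k0 wedge_vec4 !mulr0 ?mul0r !subrr vec6_eq0 eqxx.
right; exists (- (r * t1)), (k * (t1 * t1)).
by rewrite wE t00 wedge_vec4; congr vec6; ring.
Qed.

Lemma scroll_conic_wedge (t c d : K) : vec4 0 0 c d != 0 ->
  wedge (conic_point t) (vec4 0 0 c d) != 0 /\ scroll (wedge (conic_point t) (vec4 0 0 c d)).
Proof.
move=> cd; have E : wedge (conic_point t) (vec4 0 0 c d) = scroll_point 1 t c d.
  by rewrite wedge_vec4; congr vec6; ring.
have w0 : scroll_point 1 t c d != 0.
  rewrite vec6_eq0 !mulr1 eqxx /=; move: (vec4_neq0_01 cd).
  by case/orP => /negPf ->; rewrite ?andbF.
by rewrite E; split=> //; apply: scroll_point_mem.
Qed.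

Lemma meets_scroll01 : meets_all (axis 0 1) scroll.
Proof.
move=> w Ew; have w0 := zclosed_neq0 (zclosed_cubic_scroll K) Ew.
have [[t [c [d [wE cd]]]]|[c [d wE]]] := scroll_wedge Ew.
  have nz : vec4 0 0 c d != 0 by rewrite vec4_eq0 eqxx /= negb_and.
  apply: (@meets_wedge _ _ _ (vec4 0 0 c d) (- conic_point t)) => //.
    by split=> //; rewrite !vec4E.
  by rewrite wE; apply: eq_vec6; rewrite !mxE /=; ring.
apply: (meets_wedge w0 _ _ wE); last by rewrite vec4_eq0 oner_eq0 !andbF.
by split; [rewrite vec4_eq0 oner_eq0 !andbF|rewrite !vec4E].
Qed.

Lemma meets_scroll_conic : meets_all conic scroll.
Proof.
move=> w Ew; have w0 := zclosed_neq0 (zclosed_cubic_scroll K) Ew.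
have [[t [c [d [wE cd]]]]|[c [d wE]]] := scroll_wedge Ew.
  apply: (meets_wedge w0 _ _ wE); first exact: conic_point_mem.
  by case: (conic_point_mem t).
apply: (meets_wedge w0 _ _ wE); last by rewrite vec4_eq0 oner_eq0 !andbF.
by split; [rewrite vec4_eq0 oner_eq0 !andbF|rewrite !vec4E; split=> //; ring].
Qed.

Lemma focal_scroll01 : focal scroll (axis 0 1).
Proof.
apply: focal_of_tight; [exact: variety_line01|exact: meets_scroll01|].
elim/vec4_ind => a b c d [P0]; rewrite !vec4E => -[a0 b0]; move: P0; rewrite a0 b0 => P0.
have [w0 Ew] := scroll_conic_wedge 0 P0.
exists (wedge (conic_point 0) (vec4 0 0 c d)) => // v [v0 [v00 v01]].
move=> /line_wedge_mem[]// _ [x [y vE]].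
apply: (point_of_scale v0 (b := y)).
move: v00; rewrite vE vec4_lin !vec4E mulr1 mulr0 addr0 => ->.
by rewrite vec4Z; congr vec4; ring.
Qed.

Lemma std_conicP v : conic v ->
  (exists t a, a != 0 /\ v = a *: conic_point t) \/ (exists a, a != 0 /\ v = a *: vec4 0 0 1 0).
Proof.
elim/vec4_ind: v => a b c d [v0]; rewrite !vec4E => -[d0 E].
have [a0|a0] := eqVneq a 0; last first.
  left; exists (b / a), a; split=> //; rewrite vec4Z d0; congr vec4; try by field.
  by apply: (mulfI a0); rewrite E; field.
move: E; rewrite a0 mul0r => /esym/eqP; rewrite mulf_eq0 orbb => /eqP b0.
right; exists c; rewrite vec4Z b0 d0 !mulr0 mulr1; split=> //.
by move: v0; rewrite vec4_eq0 a0 b0 d0 !eqxx andbT.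
Qed.

Lemma focal_scroll_conic : focal scroll conic.
Proof.
apply: focal_of_tight; [exact: variety_std_conic|exact: meets_scroll_conic|].
have scale a P Q : a != 0 -> point_of P Q -> point_of (a *: P) Q.
  move=> a0 [b b0 ->]; exists (b / a); rewrite ?mulf_neq0 ?invr_eq0 //.
  by rewrite scalerA mulfVK.
move=> P /std_conicP[[t [a [a0 ->]]]|[a [a0 ->]]].
  have nz : vec4 0 0 0 1 != 0 :> 'rV[K]_4 by rewrite vec4_eq0 oner_eq0 !andbF.
  have [w0 Ew] := scroll_conic_wedge t nz.
  exists (wedge (conic_point t) (vec4 0 0 0 1)) => // v [v0 [v3 _]].
  move=> /line_wedge_mem[]// _ [x [y vE]]; apply: scale => //.
  apply: (point_of_scale v0 (b := x)).
  move: v3; rewrite vE vec4_lin !vec4E mulr0 mulr1 add0r => ->.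
  by rewrite vec4Z; congr vec4; ring.
have w0 : wedge (vec4 0 0 1 0) (vec4 0 0 0 1) != 0 :> 'rV[K]_6.
  exact/indep2_wedge/indep2_01.
(* At the point common to the conic and the line, the focal line itself serves as test line: it
   belongs to the scroll and meets the plane x3 = 0 only there. *)
exists (wedge (vec4 0 0 1 0) (vec4 0 0 0 1)).
  have E : wedge (vec4 0 0 1 0) (vec4 0 0 0 1) = scroll_point 0 1 0 1 :> 'rV[K]_6.
    by rewrite wedge_vec4; congr vec6; ring.
  by rewrite E; apply: scroll_point_mem; rewrite -E.
move=> v [v0 [v3 _]] /line_wedge_mem[]// _ [x [y vE]]; apply: scale => //.
apply: (point_of_scale v0 (b := x)).
move: v3; rewrite vE vec4_lin !vec4E mulr0 mulr1 add0r => ->.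
by rewrite vec4Z; congr vec4; ring.
Qed.

Lemma finite_points_avoid n (Y : set 'rV[K]_n) (f : nat -> 'rV[K]_n) :
  finitely_many_points Y -> (forall i, f i != 0) ->
  (forall i j a, f i = a *: f j -> i = j) ->
  exists N, forall i, (N <= i)%N -> ~ Y (f i).
Proof.
move=> [s Hs] f0 finj.
suff [N HN] : exists N, forall i, (N <= i)%N ->
    ~ exists2 p, p \in s & exists a, f i = a *: p.
  by exists N => i /HN; apply: contra_not; exact: Hs.
elim: s {Hs} => [|p s [N HN]]; first by exists 0%N => i _ [].
have [[i0 [a0 fa0]]|nex] := pselect (exists i a, f i = a *: p); last first.
  exists N => i lei [q]; rewrite inE => /predU1P[->|qs] [a E].
    by apply: nex; exists i, a.
  by apply: (HN i lei); exists q => //; exists a.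
exists (maxn N i0.+1) => i; rewrite geq_max => /andP[lei lti] [q].
rewrite inE => /predU1P[->|qs] [a E]; last by apply: (HN i lei); exists q => //; exists a.
have a00 : a0 != 0.
  by have := f0 i0; apply: contraNneq => E0; rewrite fa0 E0 scale0r.
have /finj E' : f i = (a / a0) *: f i0 by rewrite fa0 scalerA mulfVK.
by rewrite E' ltnn in lti.
Qed.

Lemma zclosed_plane (t : K) : zclosed [set v : 'rV[K]_4 | v != 0 /\ v 0 1 = t * v 0 0].
Proof.
apply: (zclosed_eq (F := 'X_1 - t *: 'X_0)) => [|v].
  by exists 1%N; apply: rpredB; [|apply: rpredZ]; exact: dhomogX1.
by rewrite /evalv mevalB mevalZ !mevalXU.
Qed.

(* Project from a point Q of the conic outside V: the plane joining Q to the line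
   meets V in finitely many points, but every line of the pencil at Q in this plane
   meets V. *)
Lemma focal_curve_scroll V : zdim V 1 -> focal scroll V -> V = axis 0 1 \/ V = conic.
Proof.
move=> [_ nV] [vV mV minV]; apply: contrapT => /not_orP[nb nc].
have cV := variety_closed vV.
have not_sub W : variety W -> meets_all W scroll -> V <> W -> ~ (W `<=` V).
  move=> vW mW nW WV; have [VW|nVW] := pselect (V `<=` W).
    by apply: nW; apply/seteqP.
  by apply: (minV W).
have nbV := not_sub _ (variety_line01 K) meets_scroll01 nb.
have ncV := not_sub _ (variety_std_conic K) meets_scroll_conic nc.
have nVb : ~ (V `<=` axis 0 1).
  by have [_ _ minb] := focal_scroll01 => Vb; apply: (minb V).
have fVc := variety_curveI (variety_std_conic K) (proj2 (zdim_std_conic K)) cV ncV.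
have [|i j a|N HN] := @finite_points_avoid _ _ (fun i => conic_point i%:R) fVc.
- by move=> i; case: (conic_point_mem (i%:R : K)).
- move=> E; have := congr1 (fun v : 'rV_4 => v 0 0) E; rewrite !mxE /= mulr1 => a1.
  have := congr1 (fun v : 'rV_4 => v 0 1) E; rewrite !mxE /= -a1 mul1r => /eqP.
  by rewrite eqr_nat => /eqP.
have nVc i : (N <= i)%N -> ~ V (conic_point i%:R).
  by move=> /HN; apply: contra_not => Vi; split=> //; exact: conic_point_mem.
pose plane (t : K) := [set v : 'rV[K]_4 | v != 0 /\ v 0 1 = t * v 0 0].
(* Two consecutive parameters suffice: their planes meet only in the line [axis 0 1], so at least
   one of them does not contain [V]. *)
have [t [nQ nP]] : exists t, ~ V (conic_point t) /\ ~ (V `<=` plane t).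
  have [h1|h1] := pselect (V `<=` plane N%:R); last by exists N%:R; split=> //; exact: nVc.
  exists N.+1%:R; split=> [|h2]; first exact/nVc/leqnSn.
  apply: nVb => v Vv; have [v0 E1] := h1 v Vv; have [_ E2] := h2 v Vv.
  have v00 : v 0 0 = 0.
    have /eqP : N.+1%:R * v 0 0 - N%:R * v 0 0 = 0 by rewrite -E1 E2 subrr.
    by rewrite -mulrBl -addn1 natrD addrAC subrr add0r mul1r => /eqP.
  by split=> //; split=> //; rewrite E1 v00 mulr0.
have fW := variety_curveI vV nV (zclosed_plane t) nP.
(* The line from Q to (0 : 0 : 1 : i) meets [V] outside Q, so the point can be scaled to have last
   coordinate [i]. Different lines of the pencil thus give different points of [V] in the plane. *)
have /choice[f Hf] (i : nat) : exists v, V v /\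
    exists x, v = vec4 x (x * t) (x * (t * t) + 1) i%:R.
  have nz : vec4 0 0 1 (i%:R : K) != 0 by rewrite vec4_eq0 oner_eq0 !andbF.
  have [w0 Ew] := scroll_conic_wedge t nz.
  have [v [Vv /line_wedge_mem[]// v0 [x [y vE]]]] := mV _ Ew.
  have y0 : y != 0.
    apply: contra_notN nQ => /eqP y0.
    have vx : v = x *: conic_point t by rewrite vE y0 scale0r addr0.
    have x0 : x != 0 by apply: contraNneq v0 => x0; rewrite vx x0 scale0r.
    by apply/(zclosed_scaleE _ cV x0); rewrite -vx.
  exists (y^-1 *: v); split; first by apply: zclosed_scale; rewrite ?invr_eq0.
  exists (x / y); rewrite vE vec4_lin vec4Z; congr vec4; by field.
have [|i j a|M HM] := @finite_points_avoid _ _ f fW.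
- by move=> i; case: (Hf i) => /(zclosed_neq0 cV).
- have [_ [x ->]] := Hf i; have [_ [y ->]] := Hf j; rewrite vec4Z => E.
  have := congr1 (fun v : 'rV_4 => v 0 0) E; have := congr1 (fun v : 'rV_4 => v 0 2) E.
  have := congr1 (fun v : 'rV_4 => v 0 3) E; rewrite !vec4E => E3 E2 E0.
  have a1 : a = 1.
    have : a = a * (y * (t * t) + 1) - (a * y) * (t * t) by ring.
    by rewrite -E2 -E0 addrAC subrr add0r.
  by move: E3; rewrite a1 mul1r => /eqP; rewrite eqr_nat => /eqP.
have [Vf [x fE]] := Hf M; apply: (HM M (leqnn _)); split=> //; split.
  exact: zclosed_neq0 Vf.
by rewrite fE !vec4E mulrC.
Qed.

Lemma focal_curves_scroll : focal_curves scroll = [set axis 0 1; conic].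
Proof.
apply/seteqP; split=> V /=; first by move=> [dV fV]; apply: focal_curve_scroll.
by case=> ->; split; [exact: zdim_line01|exact: focal_scroll01
                     |exact: zdim_std_conic|exact: focal_scroll_conic].
Qed.

End CubicScroll.

(** * The double focal line, and spans of the linear congruences *)

Section TangentCone.
Variable K : numFieldType.
Local Notation axis := (@coord_line K).

Definition std_quadric : {mpoly K[4]} := 'X_0 * 'X_3 - 'X_1 * 'X_2.

Lemma mderivXU n (i j : 'I_n) : ('X_i : {mpoly K[n]})^`M(j) = (i == j)%:R.
Proof.
rewrite mderivX mnm1E; case: eqVneq => [->|_]; last by rewrite scale0r.
by rewrite scale1r (_ : (_ - _)%MM = 0%MM) ?mpolyX0 //; apply/mnmP => k; rewrite !mnmE subnn.
Qed.

Lemma grad_std_quadric (P : 'rV[K]_4) :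
  grad std_quadric P = vec4 (P 0 3) (- P 0 2) (- P 0 1) (P 0 0).
Proof.
apply: eq_vec4; rewrite mxE vec4E /std_quadric /evalv mderivB !mderivM !mderivXU;
  rewrite !(mevalB, mevalD, mevalM, mevalXU) /= ?(meval0, meval1, mulr0n, mulr1n);
  by rewrite ?(meval0, meval1); ring.
Qed.

Lemma tangent_std_quadric (P v : 'rV[K]_4) : tangent_plane std_quadric P v <->
  v != 0 /\ P 0 3 * v 0 0 - P 0 2 * v 0 1 - P 0 1 * v 0 2 + P 0 0 * v 0 3 = 0.
Proof.
have E : (grad std_quadric P *m v^T) 0 0 =
    P 0 3 * v 0 0 - P 0 2 * v 0 1 - P 0 1 * v 0 2 + P 0 0 * v 0 3.
  by rewrite mxE sum_I4 grad_std_quadric !vec4E !mxE; ring.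
split=> -[v0 H]; split=> //; first by rewrite -E H mxE.
by apply/rowP => i; rewrite (ord1 i) [RHS]mxE E.
Qed.

Lemma smooth_std_quadric : smooth_quadric std_quadric.
Proof.
split=> [|P [P0 _]]; first by apply: rpredB; exact: dhomogXX.
rewrite grad_std_quadric vec4_eq0 !oppr_eq0; move: P0; rewrite [P in P != 0]vec4_eta vec4_eq0.
by case: (P 0 0 == 0); case: (P 0 1 == 0); case: (P 0 2 == 0); case: (P 0 3 == 0).
Qed.

Lemma tangent_congruence_std : tangent_congruence std_quadric (axis 0 1) = @tangent_cone K.
Proof.
apply/seteqP; split=> w.
  move=> [[w0 kl] [P [[P0 [P00 P01]] /line_ofP[]// _ [y wE] sub]]].
  rewrite wE in w0 *.
  have /sub/tangent_std_quadric[_] : line_of w y by rewrite wE; apply: line_ofr.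
  rewrite P00 P01 !mul0r subr0 addr0 => /eqP; rewrite subr_eq0 => /eqP E.
  split=> //; rewrite wedgeE !vec6E /minor P00 P01; split; first by ring.
  split; first by rewrite !mul0r !sub0r E.
  transitivity ((P 0 3 * y 0 0) * (P 0 2 * y 0 1)); first by ring.
  by rewrite -E; ring.
move=> Ew; have w0 := zclosed_neq0 (zclosed_tangent_cone K) Ew.
split; first exact: tangent_cone_klein.
have [a [b [c [d [k [ab wE]]]]]] := tangent_cone_wedge Ew.
have nz : vec4 0 0 a b != 0 by rewrite vec4_eq0 eqxx /= negb_and.
exists (vec4 0 0 a b); split.
- by split=> //; rewrite !vec4E.
- by rewrite wE in w0 *; apply: line_ofl.
rewrite wE in w0 * => v /line_wedge_mem[]// v0 [x [y vE]].
apply/tangent_std_quadric; split=> //.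
by rewrite vE vec4_lin !vec4E; ring.
Qed.

Lemma double_focal_tangent_cone : double_focal_line (@tangent_cone K) (axis 0 1).
Proof.
exists std_quadric; split; [exact: smooth_std_quadric| |].
  move=> v [v0 [h0 h1]]; split=> // _ ->.
  by rewrite /evalv /std_quadric mevalB !mevalM !mevalXU h0 h1; ring.
by rewrite tangent_congruence_std.
Qed.

Lemma linear_of_rows (X : set 'rV[K]_6) (r : 'I_4 -> 'rV[K]_6) :
  (forall u : 'I_4 -> K, \sum_i u i *: r i = 0 -> forall i, u i = 0) ->
  (forall w, X w -> w != 0 /\ exists u, w = \sum_i u i *: r i) ->
  linear_congruence X.
Proof.
move=> free span; pose M : 'M[K]_(4, 6) := \matrix_i r i.
have ME (u : 'rV[K]_4) : u *m M = \sum_i u 0 i *: r i.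
  by rewrite mulmx_sum_row; apply: eq_bigr => i _; rewrite rowK.
exists (flat M).
  exists M => //; apply: inj_row_free => u; rewrite ME => /free u0.
  by apply/rowP => i; rewrite mxE u0.
move=> w /span[w0 [u wE]]; split=> //; apply/submxP; exists (\row_i u i).
by rewrite ME wE; apply: eq_bigr => i _; rewrite mxE.
Qed.

Lemma linear_skew_join : linear_congruence (@skew_join K).
Proof.
apply: (@linear_of_rows _ (fun i => [:: vec6 0 1 0 0 0 0; vec6 0 0 1 0 0 0;
   vec6 0 0 0 1 0 0; vec6 0 0 0 0 1 0]`_i)).
  move=> u; rewrite sum_I4 /= => /rowP E.
  apply: forall_I4; [have := E 1|have := E 2|have := E 3|have := E 4];
  by rewrite !mxE /= !(mulr0, mulr1, addr0, add0r).
move=> w [w0 [E0 [E5 _]]]; split=> //; exists (fun i : 'I_4 => [:: w 0 1; w 0 2; w 0 3; w 0 4]`_i).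
by rewrite sum_I4 /=; apply: eq_vec6; rewrite !mxE /= ?E0 ?E5; ring.
Qed.

Lemma linear_tangent_cone : linear_congruence (@tangent_cone K).
Proof.
apply: (@linear_of_rows _ (fun i => [:: vec6 0 1 0 0 0 0; vec6 0 0 1 1 0 0;
   vec6 0 0 0 0 1 0; vec6 0 0 0 0 0 1]`_i)).
  move=> u; rewrite sum_I4 /= => /rowP E.
  apply: forall_I4; [have := E 1|have := E 2|have := E 4|have := E 5];
  by rewrite !mxE /= !(mulr0, mulr1, addr0, add0r).
move=> w [w0 [E0 [E2 _]]]; split=> //; exists (fun i : 'I_4 => [:: w 0 1; w 0 2; w 0 4; w 0 5]`_i).
by rewrite sum_I4 /=; apply: eq_vec6; rewrite !mxE /= ?E0 -?E2; ring.
Qed.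

End TangentCone.

(** * Linear changes of coordinates *)

Lemma mpoly_ring_ind (K : fieldType) n (P : {mpoly K[n]} -> Prop) :
  (forall c, P c%:MP) -> (forall i, P 'X_i) ->
  (forall p q, P p -> P q -> P (p + q)) -> (forall p q, P p -> P q -> P (p * q)) ->
  forall p, P p.
Proof.
move=> PC PX PD PM; elim/mpolyind => [|c m p _ _ Pp]; first by rewrite -(mpolyC0 n K).
apply: (PD) => //; rewrite -mul_mpolyC; apply: (PM) => //; rewrite mpolyXE_id.
apply: big_ind => [|p' q|i _]; [by rewrite -(mpolyC1 n K)|exact: PM|].
elim: (m i) => [|k IH]; first by rewrite expr0 -(mpolyC1 n K).
by rewrite exprS; apply: PM.
Qed.

Section LinearPullback.
Variables (K : numFieldType) (n : nat).
Implicit Types (F G : {mpoly K[n]}) (X Y Z V : set 'rV[K]_n) (v : 'rV[K]_n) (g : 'M[K]_n).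

(** Vectors are rows, so this is the image of [X] under [invmx g]. With preimages, equations are
    transported by plain substitution of linear forms. *)
Definition pb g X : set 'rV[K]_n := [set v | X (v *m g)].

Definition lin_subst g : n.-tuple {mpoly K[n]} := [tuple \sum_i g i j *: 'X_i | j < n].
Definition mpb g F : {mpoly K[n]} := F \mPo lin_subst g.

Lemma evalv_mpb g F v : evalv (mpb g F) v = evalv F (v *m g).
Proof.
rewrite /evalv comp_mpoly_meval; apply: meval_eq => j; rewrite tnth_mktuple mxE.
by rewrite (raddf_sum (meval _)) /=; apply: eq_bigr => i _; rewrite mevalZ mevalXU mulrC.
Qed.

Lemma dhomog_mpb d g F : F \is d.-homog -> mpb g F \is d.-homog.
Proof.
move=> /dhomogP hF; rewrite /mpb comp_mpolyEX big_seq.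
apply: rpred_sum => m /hF /= <-; apply: rpredZ; rewrite comp_mpolyX mdegE.
elim/big_ind2: _ => [|p1 a p2 b h1 h2|i _]; [exact: dhomog1|exact: dhomogM|].
have hX : tnth (lin_subst g) i \is 1.-homog.
  by rewrite tnth_mktuple; apply: rpred_sum => j _; apply: rpredZ; exact: dhomogX1.
by have := dhomogMn (m i) hX; rewrite mul1n.
Qed.

Lemma pbK g : g \in unitmx -> cancel (pb g) (pb (invmx g)).
Proof. by move=> ug X; apply/seteqP; split=> v; rewrite /pb /= mulmxKV. Qed.

Lemma pbKV g : g \in unitmx -> cancel (pb (invmx g)) (pb g).
Proof. by move=> ug X; apply/seteqP; split=> v; rewrite /pb /= mulmxK. Qed.

Lemma pb_inj g : g \in unitmx -> injective (pb g).
Proof. by move=> ug; apply: can_inj (pbK ug). Qed.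

Lemma pb_sub g X Y : X `<=` Y -> pb g X `<=` pb g Y.
Proof. by move=> XY v; apply: XY. Qed.

Lemma pb_subE g X Y : g \in unitmx -> (pb g X `<=` pb g Y) <-> (X `<=` Y).
Proof.
move=> ug; split; last exact: pb_sub.
by move=> /(pb_sub (g := invmx g)); rewrite !pbK.
Qed.

Lemma pb_proper g X Y : g \in unitmx -> (pb g X `<` pb g Y) <-> (X `<` Y).
Proof. by move=> ug; rewrite /proper !pb_subE. Qed.

Lemma mulmx_unit_neq0 g v : g \in unitmx -> (v *m g != 0) = (v != 0).
Proof.
move=> ug; congr negb; apply/eqP/eqP => [E|->]; last exact: mul0mx.
by rewrite -(mulmxK ug v) E mul0mx.
Qed.

Lemma pb_nonempty g X : g \in unitmx -> X !=set0 -> pb g X !=set0.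
Proof. by move=> ug [v Xv]; exists (v *m invmx g); rewrite /pb /= mulmxKV. Qed.

Lemma pb_zeros g (I : set {mpoly K[n]}) : g \in unitmx ->
  pb g (zeros I) = zeros [set G | exists2 F, I F & G = mpb g F].
Proof.
move=> ug; apply/seteqP; split=> v; rewrite /pb /= /zeros /= mulmx_unit_neq0 // => -[v0 H].
  by split=> // _ [F IF ->]; rewrite evalv_mpb; apply: H.
by split=> // F IF; rewrite -evalv_mpb; apply: H; exists F.
Qed.

Lemma zclosed_pb g X : g \in unitmx -> zclosed X -> zclosed (pb g X).
Proof.
move=> ug [I [hI ->]]; rewrite pb_zeros //; apply: zclosed_zeros.
by move=> _ [F /hI[d hF] ->]; exists d; apply: dhomog_mpb.
Qed.

Lemma variety_pb g V : g \in unitmx -> variety V -> variety (pb g V).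
Proof.
move=> ug [cV V0 irrV]; split; [exact: zclosed_pb|exact: pb_nonempty|].
have ug' : invmx g \in unitmx by rewrite unitmx_inv.
move=> Y Z cY cZ; rewrite -(pbKV ug Y) -(pbKV ug Z) => VYZ.
have [||v Vv|h|h] := irrV (pb (invmx g) Y) (pb (invmx g) Z);
  try exact: zclosed_pb.
- have := VYZ (v *m invmx g); rewrite /pb /= !mulmxKV //; exact.
- by left; exact: pb_sub.
- by right; exact: pb_sub.
Qed.

Lemma variety_pbE g V : g \in unitmx -> variety (pb g V) <-> variety V.
Proof.
move=> ug; split; last exact: variety_pb.
by rewrite -{2}(pbK ug V); apply: variety_pb; rewrite unitmx_inv.
Qed.

Lemma variety_chain_pb g X d : g \in unitmx -> variety_chain X d -> variety_chain (pb g X) d.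
Proof.
move=> ug [Z [HZ HZs]]; exists (fun i => pb g (Z i)); split=> i lid.
  by have [vZ ZX] := HZ i lid; split; [exact: variety_pb|exact: pb_sub].
by apply/(pb_proper _ _ ug); apply: HZs.
Qed.

Lemma variety_chain_pbE g X d : g \in unitmx ->
  variety_chain (pb g X) d <-> variety_chain X d.
Proof.
move=> ug; split; last exact: variety_chain_pb.
by rewrite -{2}(pbK ug X); apply: variety_chain_pb; rewrite unitmx_inv.
Qed.

Lemma zdim_pb g X d : g \in unitmx -> zdim (pb g X) d <-> zdim X d.
Proof. by move=> ug; rewrite /zdim !variety_chain_pbE. Qed.

Lemma flat_pb g k (M : 'M[K]_(k, n)) : g \in unitmx -> pb g (flat M) = flat (M *m invmx g).
Proof.
move=> ug; apply/seteqP; split=> v; rewrite /pb /= /flat /= mulmx_unit_neq0 // => -[v0 H];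
  split=> //.
  by rewrite -[v](mulmxK ug); apply: submxMr.
by rewrite -[M](mulmxKV ug); apply: submxMr.
Qed.

Lemma is_flat_pb g k X : g \in unitmx -> is_flat k X -> is_flat k (pb g X).
Proof.
move=> ug [M fM ->]; exists (M *m invmx g); last exact: flat_pb.
by rewrite /row_free mxrankMfree // row_free_unit unitmx_inv.
Qed.

Lemma is_flat_pbE g k X : g \in unitmx -> is_flat k (pb g X) <-> is_flat k X.
Proof.
move=> ug; split; last exact: is_flat_pb.
by rewrite -{2}(pbK ug X); apply: is_flat_pb; rewrite unitmx_inv.
Qed.

Lemma zclosure_pb g X : g \in unitmx -> zclosure (pb g X) = pb g (zclosure X).
Proof.
move=> ug; have ug' : invmx g \in unitmx by rewrite unitmx_inv.
apply/seteqP; split=> v Hv.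
  move=> Y [cY XY]; rewrite -[Y (v *m g)]/(pb g Y v); apply: Hv; split.
    exact: zclosed_pb.
  exact: pb_sub.
move=> Y [cY XY]; rewrite -(pbKV ug Y); apply: (Hv (pb (invmx g) Y)); split.
  exact: zclosed_pb.
by rewrite -(pbK ug X); apply: pb_sub.
Qed.

Lemma mderiv_mpb g F i : (mpb g F)^`M(i) = \sum_j g i j *: mpb g (F^`M(j)).
Proof.
elim/mpoly_ring_ind: F => [c|k|p q Hp Hq|p q Hp Hq].
- rewrite /mpb comp_mpolyC mderivC big1 // => j _.
  by rewrite mderivC comp_mpoly0 scaler0.
- rewrite /mpb comp_mpolyXU -tnth_nth tnth_mktuple.
  rewrite (raddf_sum (mderiv i)) /= (bigD1 i) //= big1 ?addr0; last first.
    by move=> j nji; rewrite mderivZ mderivXU (negPf nji) scaler0.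
  rewrite mderivZ mderivXU eqxx (bigD1 k) //= big1 ?addr0; last first.
    by move=> j nji; rewrite mderivXU eq_sym (negPf nji) comp_mpoly0 scaler0.
  by rewrite mderivXU eqxx comp_mpoly1.
- rewrite /mpb comp_mpolyD mderivD -/(mpb g p) -/(mpb g q) Hp Hq -big_split /=.
  by apply: eq_bigr => j _; rewrite mderivD comp_mpolyD scalerDr.
rewrite /mpb rmorphM /= mderivM -/(mpb g p) -/(mpb g q) Hp Hq mulr_suml mulr_sumr.
rewrite -big_split /=; apply: eq_bigr => j _.
by rewrite mderivM /mpb rmorphD !rmorphM /= scalerDr scalerAl scalerAr.
Qed.

Lemma grad_mpb g F v : grad (mpb g F) v = grad F (v *m g) *m g^T.
Proof.
apply/rowP => i; rewrite !mxE mderiv_mpb /evalv (raddf_sum (meval _)) /=.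
apply: eq_bigr => j _; rewrite mevalZ !mxE mulrC; congr (_ * _).
exact: evalv_mpb.
Qed.

Lemma mpb_neq0 g F : g \in unitmx -> F != 0 -> mpb g F != 0.
Proof.
move=> ug; apply: contraNneq => E; apply/eqP; apply: mpoly_eval_eq0 => v.
have := evalv_mpb g F ((\row_i v i) *m invmx g); rewrite E mulmxKV // /evalv meval0 => H.
by rewrite [RHS]H; apply: meval_eq => i; rewrite mxE.
Qed.

End LinearPullback.

(** * Action on Pluecker coordinates *)

Section Compound.
Variable K : fieldType.
Implicit Types (g h : 'M[K]_4).

(** The second compound matrix, that is, the action of [g] on the exterior square in the ordered
    basis [pl_pair]. *)
Definition compound g : 'M[K]_6 :=
  \matrix_k (let: (i, j) := tnth pl_pair k in wedge (row i g) (row j g)).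

Lemma sum_I6 (V : nmodType) (F : 'I_6 -> V) :
  \sum_i F i = F 0 + F 1 + F 2 + F 3 + F 4 + F 5.
Proof.
rewrite !big_ord_recl big_ord0 addr0 -!addrA.
by congr (F _ + (F _ + (F _ + (F _ + (F _ + F _))))); apply: val_inj.
Qed.

Lemma wedge_mulmx g (x y : 'rV[K]_4) : wedge (x *m g) (y *m g) = wedge x y *m compound g.
Proof.
have coordE k : (wedge x y *m compound g) 0 k =
    minor x y 0 1 * wedge (row 0 g) (row 1 g) 0 k + minor x y 0 2 * wedge (row 0 g) (row 2 g) 0 k
  + minor x y 0 3 * wedge (row 0 g) (row 3 g) 0 k + minor x y 1 2 * wedge (row 1 g) (row 2 g) 0 k
  + minor x y 1 3 * wedge (row 1 g) (row 3 g) 0 k + minor x y 2 3 * wedge (row 2 g) (row 3 g) 0 k.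
  by rewrite mxE sum_I6 !wedgeE !vec6E !mxE.
apply: eq_vec6; rewrite coordE !wedgeE !vec6E /minor !mxE !sum_I4; ring.
Qed.

Lemma compoundM g h : compound (g *m h) = compound g *m compound h.
Proof.
apply/row_matrixP => k; rewrite row_mul !rowK; case: (tnth pl_pair k) => i j.
by rewrite !row_mul wedge_mulmx.
Qed.

Lemma compound1 : compound 1%:M = 1%:M.
Proof.
apply/row_matrixP => k; rewrite rowK; move: k.
by apply: forall_I6; apply: eq_vec6; rewrite [LHS]/= wedgeE vec6E /minor !mxE /=;
   rewrite !(mul0r, mulr0) ?mulr1 subr0.
Qed.

Lemma compound_unit g : g \in unitmx -> compound g \in unitmx.
Proof.
move=> ug; have := compoundM g (invmx g); rewrite mulmxV // compound1 => E.
by case/mulmx1_unit: (esym E).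
Qed.

Lemma compound_inv g : g \in unitmx -> compound (invmx g) = invmx (compound g).
Proof.
move=> ug; have := compoundM g (invmx g); rewrite mulmxV // compound1 => E.
by rewrite -[RHS]mulmx1 E mulKmx // compound_unit.
Qed.

Lemma pluecker_mulmx g (M : 'M[K]_(2, 4)) : pluecker (M *m g) = pluecker M *m compound g.
Proof. by rewrite !pluecker_wedge !row_mul wedge_mulmx. Qed.

End Compound.

(** * Transport of congruences, focal loci and conics *)

Section Transport.
Variable K : numFieldType.
Implicit Types (g : 'M[K]_4) (V W : set 'rV[K]_4) (X Y : set 'rV[K]_6).

Definition pbp g X := pb (compound g) X.

Lemma line_of_mulmx g w (v : 'rV[K]_4) : g \in unitmx ->
  line_of (w *m compound g) (v *m g) <-> line_of w v.
Proof.
move=> ug.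
have imp h u (z : 'rV[K]_4) : h \in unitmx -> line_of u z -> line_of (u *m compound h) (z *m h).
  move=> uh [M <- [z0 zM]]; exists (M *m h); first exact: pluecker_mulmx.
  by split; [rewrite mulmx_unit_neq0|exact: submxMr].
split; last exact: imp.
move=> /(imp (invmx g)); rewrite unitmx_inv => /(_ ug).
by rewrite compound_inv // !mulmxK // compound_unit.
Qed.

(** Invariance through decomposability: [kleinP] writes the vector as a wedge, and wedges go to
    wedges. No determinant is computed. *)
Lemma klein_pb g : g \in unitmx -> pbp g (@klein K) = @klein K.
Proof.
move=> ug; have imp h w : h \in unitmx -> @klein K w -> klein (w *m compound h).
  move=> uh kw; have [w0 _] := kw; have [x [y wE]] := kleinP kw.
  have : w *m compound h != 0 by rewrite mulmx_unit_neq0 // compound_unit.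
  by rewrite wE -wedge_mulmx; exact: klein_wedge.
apply/seteqP; split=> w; last exact: imp.
move=> /(imp (invmx g)); rewrite unitmx_inv => /(_ ug).
by rewrite compound_inv // mulmxK // compound_unit.
Qed.

Lemma meets_all_pb g V X : g \in unitmx ->
  meets_all (pb g V) (pbp g X) <-> meets_all V X.
Proof.
move=> ug; have ucg := compound_unit ug; split=> mV w Xw; last first.
  have [v [Vv lv]] := mV _ Xw; exists (v *m invmx g); split.
    by rewrite /pb /= mulmxKV.
  by apply/(line_of_mulmx w _ ug); rewrite mulmxKV.
have [|v [Vv lv]] := mV (w *m invmx (compound g)); first by rewrite /pbp /pb /= mulmxKV.
exists (v *m g); split=> //.
by move/(line_of_mulmx _ v ug): lv; rewrite mulmxKV.
Qed.

Lemma focal_pb g V X : g \in unitmx -> focal (pbp g X) (pb g V) <-> focal X V.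
Proof.
move=> ug; have ug' : invmx g \in unitmx by rewrite unitmx_inv.
split=> -[vV mV minV]; split.
- exact/(variety_pbE _ ug).
- exact/(meets_all_pb _ _ ug).
- move=> W vW WV mW; apply: (minV (pb g W)).
  + exact/(variety_pbE _ ug).
  + exact/(pb_proper _ _ ug).
  + exact/(meets_all_pb _ _ ug).
- exact/(variety_pbE _ ug).
- exact/(meets_all_pb _ _ ug).
- move=> W; rewrite -(pbKV ug W) => /(variety_pbE _ ug) vW /(pb_proper _ _ ug) WV.
  by move/(meets_all_pb _ _ ug); exact: minV.
Qed.

Lemma pb_set1 g (P : set (set 'rV[K]_4)) V : g \in unitmx ->
  P = [set V] -> [set W | P (pb (invmx g) W)] = [set pb g V].
Proof.
move=> ug ->; apply/seteqP; split=> W /=.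
  by move=> <-; rewrite pbKV.
by move=> ->; rewrite pbK.
Qed.

Lemma pb_set2 g (P : set (set 'rV[K]_4)) V V' : g \in unitmx ->
  P = [set V; V'] -> [set W | P (pb (invmx g) W)] = [set pb g V; pb g V'].
Proof.
move=> ug ->; apply/seteqP; split=> W /=.
  by case=> <-; rewrite pbKV //; tauto.
by case=> ->; rewrite pbK //; tauto.
Qed.

Lemma focal_pbV g W X : g \in unitmx -> focal (pbp g X) W <-> focal X (pb (invmx g) W).
Proof. by move=> ug; have := focal_pb (pb (invmx g) W) X ug; rewrite pbKV. Qed.

Lemma focal_lines_pb g X : g \in unitmx ->
  focal_lines (pbp g X) = [set W | focal_lines X (pb (invmx g) W)].
Proof.
move=> ug; have ug' : invmx g \in unitmx by rewrite unitmx_inv.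
apply/seteqP; split=> W [lW fW]; split.
- exact/(is_flat_pbE _ _ ug').
- exact/(focal_pbV _ _ ug).
- exact/(is_flat_pbE _ _ ug').
- exact/(focal_pbV _ _ ug).
Qed.

Lemma focal_points_pb g X : g \in unitmx ->
  focal_points (pbp g X) = [set W | focal_points X (pb (invmx g) W)].
Proof.
move=> ug; have ug' : invmx g \in unitmx by rewrite unitmx_inv.
apply/seteqP; split=> W [lW fW]; split.
- exact/(is_flat_pbE _ _ ug').
- exact/(focal_pbV _ _ ug).
- exact/(is_flat_pbE _ _ ug').
- exact/(focal_pbV _ _ ug).
Qed.

Lemma focal_curves_pb g X : g \in unitmx ->
  focal_curves (pbp g X) = [set W | focal_curves X (pb (invmx g) W)].
Proof.
move=> ug; have ug' : invmx g \in unitmx by rewrite unitmx_inv.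
apply/seteqP; split=> W [lW fW]; split.
- exact/(zdim_pb _ _ ug').
- exact/(focal_pbV _ _ ug).
- exact/(zdim_pb _ _ ug').
- exact/(focal_pbV _ _ ug).
Qed.

Lemma linear_pb g X : g \in unitmx -> linear_congruence X -> linear_congruence (pbp g X).
Proof.
move=> ug [L fL XL]; exists (pbp g L); last exact: pb_sub.
by apply: is_flat_pb => //; exact: compound_unit.
Qed.

Lemma tangent_plane_pb g q (P v : 'rV[K]_4) : g \in unitmx ->
  tangent_plane (mpb g q) P v <-> tangent_plane q (P *m g) (v *m g).
Proof.
move=> ug; rewrite /tangent_plane /= mulmx_unit_neq0 // grad_mpb.
by rewrite trmx_mul mulmxA.
Qed.

Lemma tangent_congruence_pb g q x : g \in unitmx ->
  pbp g (tangent_congruence q x) = tangent_congruence (mpb g q) (pb g x).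
Proof.
move=> ug; have ug' : invmx g \in unitmx by rewrite unitmx_inv.
apply/seteqP; split=> w.
  move=> [kw [P [xP lP sub]]]; split; first by rewrite -(klein_pb ug).
  exists (P *m invmx g); split; first by rewrite /pb /= mulmxKV.
    by apply/(line_of_mulmx w _ ug); rewrite mulmxKV.
  move=> v lv; apply/(tangent_plane_pb _ _ _ ug); rewrite mulmxKV //.
  by apply: sub; apply/(line_of_mulmx w _ ug).
move=> [kw [P [xP lP sub]]]; split; first by rewrite -(klein_pb ug) in kw.
exists (P *m g); split=> //; first exact/(line_of_mulmx w _ ug).
move=> v lv; have {}lv : line_of w (v *m invmx g).
  by apply/(line_of_mulmx w _ ug); rewrite mulmxKV.
by have /(tangent_plane_pb _ _ _ ug) := sub _ lv; rewrite mulmxKV.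
Qed.

Lemma smooth_quadric_pb g (q : {mpoly K[4]}) : g \in unitmx ->
  smooth_quadric q -> smooth_quadric (mpb g q).
Proof.
move=> ug [hq sq]; split=> [|P [P0 /(_ _ erefl)]]; first exact: dhomog_mpb.
rewrite evalv_mpb grad_mpb mulmx_unit_neq0 ?unitmx_tr // => qP.
by apply: sq; split; [rewrite mulmx_unit_neq0|move=> _ ->].
Qed.

Lemma double_focal_pb g X x : g \in unitmx ->
  double_focal_line X x -> double_focal_line (pbp g X) (pb g x).
Proof.
move=> ug [q [sq xq ->]]; exists (mpb g q); split.
- exact: smooth_quadric_pb.
- move=> v /xq [v0 H]; split=> [|_ ->]; first by rewrite -(mulmx_unit_neq0 _ ug).
  by rewrite evalv_mpb H.
- exact: tangent_congruence_pb.
Qed.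

Lemma pb_zeros1 g (F : {mpoly K[4]}) : g \in unitmx ->
  pb g (zeros [set F]) = zeros [set mpb g F].
Proof.
move=> ug; rewrite pb_zeros //; congr zeros; apply/seteqP; split=> G /=.
  by move=> [_ -> ->].
by move=> ->; exists F.
Qed.

Lemma pb_zeros2 g (F G : {mpoly K[4]}) : g \in unitmx ->
  pb g (zeros [set F; G]) = zeros [set mpb g F; mpb g G].
Proof.
move=> ug; rewrite pb_zeros //; congr zeros; apply/seteqP; split=> H /=.
  by move=> [_ [->|->] ->]; [left|right].
by move=> [->|->]; [exists F => //; left|exists G => //; right].
Qed.

Lemma plane_conic_pb g c : g \in unitmx -> is_plane_conic c -> is_plane_conic (pb g c).
Proof.
move=> ug [l [q [[hl l0 hq ->] [n1 n2]]]]; exists (mpb g l), (mpb g q); split; split.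
- exact: dhomog_mpb.
- exact: mpb_neq0.
- exact: dhomog_mpb.
- exact: pb_zeros2.
- by rewrite -pb_zeros1 // => /(pb_inj ug).
- by move=> /(is_flat_pbE _ _ ug).
Qed.

Lemma smooth_conic_pb g c : g \in unitmx ->
  smooth_plane_conic c -> smooth_plane_conic (pb g c).
Proof.
move=> ug [l [q [hl l0 hq -> sm]]]; exists (mpb g l), (mpb g q); split.
- exact: dhomog_mpb.
- exact: mpb_neq0.
- exact: dhomog_mpb.
- exact: pb_zeros2.
move=> P cP; rewrite !grad_mpb -mul_col_mx /row_free mxrankMfree; first exact: sm.
by rewrite row_free_unit unitmx_tr.
Qed.

End Transport.

Lemma map_compound (K L : fieldType) (f : {rmorphism K -> L}) (g : 'M[K]_4) :
  map_mx f (compound g) = compound (map_mx f g).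
Proof.
apply/row_matrixP => k; rewrite -map_row !rowK; case: (tnth pl_pair k) => i j.
by rewrite -!map_row; apply: eq_vec6; rewrite !mxE /= rmorphB !rmorphM.
Qed.

(** * Real structure and real loci *)

Section RealStructure.
Variable R : realType.
Local Notation C := R[i].
Local Notation rc := (real_complex R).
Local Notation cj := (@conjc R).

Definition cmx m n (g : 'M[R]_(m, n)) : 'M[C]_(m, n) := map_mx rc g.

Lemma cmxM m n p (A : 'M[R]_(m, n)) (B : 'M[R]_(n, p)) : cmx (A *m B) = cmx A *m cmx B.
Proof. exact: map_mxM. Qed.

Lemma cmx_unit n (g : 'M[R]_n) : (cmx g \in unitmx) = (g \in unitmx).
Proof. exact: map_unitmx. Qed.

Lemma cmx_inv n (g : 'M[R]_n) : cmx (invmx g) = invmx (cmx g).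
Proof. exact: map_invmx. Qed.

Lemma conj_cmx m n (g : 'M[R]_(m, n)) : map_mx cj (cmx g) = cmx g.
Proof. by apply/matrixP => i j; rewrite !mxE conjc_real. Qed.

Lemma compound_cmx (g : 'M[R]_4) : compound (cmx g) = cmx (compound g).
Proof. by rewrite /cmx map_compound. Qed.

Lemma is_real_pb n (g : 'M[R]_n) (X : set 'rV[C]_n) : is_real X -> is_real (pb (cmx g) X).
Proof.
move=> rX; have rXE u : X (map_mx cj u) = X u by rewrite -{2}rX.
have E v : map_mx cj v *m cmx g = map_mx cj (v *m cmx g) by rewrite map_mxM conj_cmx.
by apply/seteqP; split=> v; rewrite /pb /= E rXE.
Qed.

Lemma real_locus_pb n (g : 'M[R]_n) (X : set 'rV[C]_n) :
  real_locus (pb (cmx g) X) = pb g (real_locus X).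
Proof. by apply/seteqP; split=> v; rewrite /real_locus /pb /= map_mxM. Qed.

Lemma is_real_of_conj n (X : set 'rV[C]_n) :
  (forall v, X v -> X (map_mx cj v)) -> is_real X.
Proof.
move=> H; apply/seteqP; split=> v; last exact: H.
move=> /H; rewrite -map_mx_comp (_ : map_mx _ v = v) //.
by apply/matrixP => i j; rewrite mxE /= conjcK.
Qed.

Lemma real_line_congruence_pb (g : 'M[R]_4) X : g \in unitmx ->
  real_line_congruence X -> real_line_congruence (pbp (cmx g) X).
Proof.
move=> ug [kX vX dX rX rlX]; have ucg : cmx g \in unitmx by rewrite cmx_unit.
have uc := compound_unit ucg; split.
- by rewrite -(klein_pb ucg); apply: pb_sub.
- exact: variety_pb.
- exact/(zdim_pb _ _ uc).
- by rewrite /pbp compound_cmx; apply: is_real_pb.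
- rewrite /pbp compound_cmx real_locus_pb; apply/zdim_pb => //.
  exact: compound_unit.
Qed.

Lemma hyperbolic_pb (g : 'M[R]_4) X : g \in unitmx ->
  hyperbolic_linear X -> hyperbolic_linear (pbp (cmx g) X).
Proof.
move=> ug [rX lX [l [m [rl rm slm fX]]]].
have ucg : cmx g \in unitmx by rewrite cmx_unit.
split; [exact: real_line_congruence_pb|exact: linear_pb|].
exists (pb (cmx g) l), (pb (cmx g) m); split; try exact: is_real_pb.
  apply/seteqP; split=> // v [lv mv].
  have : (l `&` m) (v *m cmx g) by [].
  by rewrite slm.
by rewrite focal_lines_pb // (pb_set2 ucg fX).
Qed.

Lemma parabolic_pb (g : 'M[R]_4) X : g \in unitmx ->
  parabolic_linear X -> parabolic_linear (pbp (cmx g) X).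
Proof.
move=> ug [rX lX [l fX]].
have ucg : cmx g \in unitmx by rewrite cmx_unit.
split; [exact: real_line_congruence_pb|exact: linear_pb|].
by exists (pb (cmx g) l); rewrite focal_lines_pb // (pb_set1 ucg fX).
Qed.

Lemma quadratic_pb (g : 'M[R]_4) X : g \in unitmx ->
  quadratic X -> quadratic (pbp (cmx g) X).
Proof.
move=> ug [rX [c [l [pc fc ll fl lc]]]].
have ucg : cmx g \in unitmx by rewrite cmx_unit.
split; first exact: real_line_congruence_pb.
exists (pb (cmx g) c), (pb (cmx g) l); split.
- exact: plane_conic_pb.
- exact/(focal_pb _ _ ucg).
- exact: is_flat_pb.
- exact/(focal_pb _ _ ucg).
- exact: (pb_nonempty ucg lc).
Qed.

Lemma cj_eq a b c d : a * b = c * d -> cj a * cj b = cj c * cj d.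
Proof. by move=> E; rewrite -!rmorphM E. Qed.

Lemma conj_neq0 n (v : 'rV[C]_n) : v != 0 -> map_mx cj v != 0.
Proof. by rewrite map_mx_eq0. Qed.

Lemma rc_eq a b : rc a = rc b <-> a = b.
Proof. by split=> [/complexI|->]. Qed.

Lemma is_real_coord_line i j : is_real (@coord_line C i j).
Proof.
apply: is_real_of_conj => v [v0 [h0 h1]].
by split; [exact: conj_neq0|rewrite !mxE h0 h1 rmorph0].
Qed.

Lemma is_real_std_conic : is_real (@std_conic C).
Proof.
apply: is_real_of_conj => v [v0 [h0 h1]].
split; [exact: conj_neq0|rewrite !mxE h0 rmorph0; split=> //; exact: cj_eq].
Qed.

Lemma is_real_cubic_scroll : is_real (@cubic_scroll C).
Proof.
apply: is_real_of_conj => v [v0 [h0 [h1 [h2 h3]]]].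
by split; [exact: conj_neq0|rewrite !mxE h0 rmorph0; do !split=> //; exact: cj_eq].
Qed.

Lemma is_real_skew_join : is_real (@skew_join C).
Proof.
apply: is_real_of_conj => v [v0 [h0 [h1 h2]]].
by split; [exact: conj_neq0|rewrite !mxE h0 h1 rmorph0; do !split=> //; exact: cj_eq].
Qed.

Lemma is_real_tangent_cone : is_real (@tangent_cone C).
Proof.
apply: is_real_of_conj => v [v0 [h0 [h1 h2]]].
split; [exact: conj_neq0|rewrite !mxE h0 rmorph0]; split=> //; split; first by rewrite h1.
exact: cj_eq.
Qed.

(** The equations have real coefficients, so the real locus is the same surface over [R], and its
    dimension is the one already computed over an arbitrary [numFieldType]. *)
Lemma real_locus_cubic_scroll : real_locus (@cubic_scroll C) = @cubic_scroll R.
Proof.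
apply/seteqP; split=> w; rewrite /real_locus /cubic_scroll /= map_mx_eq0 !mxE -!rmorphM.
  by move=> [w0 [h0 [h1 [h2 h3]]]]; do !split=> //; apply/rc_eq.
by move=> [w0 [-> [-> [-> ->]]]]; do !split.
Qed.

Lemma real_locus_skew_join : real_locus (@skew_join C) = @skew_join R.
Proof.
apply/seteqP; split=> w; rewrite /real_locus /skew_join /= map_mx_eq0 !mxE -!rmorphM.
  by move=> [w0 [h0 [h1 h2]]]; do !split=> //; apply/rc_eq.
by move=> [w0 [-> [-> ->]]]; do !split.
Qed.

Lemma real_locus_tangent_cone : real_locus (@tangent_cone C) = @tangent_cone R.
Proof.
apply/seteqP; split=> w; rewrite /real_locus /tangent_cone /= map_mx_eq0 !mxE -!rmorphM.
  by move=> [w0 [h0 [h1 h2]]]; do !split=> //; apply/rc_eq.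
by move=> [w0 [-> [E ->]]]; do !split=> //; rewrite E.
Qed.

Lemma quadratic_cubic_scroll : is_plane_conic (@std_conic C) -> quadratic (@cubic_scroll C).
Proof.
move=> pc; split.
  split; [exact: cubic_scroll_klein| | |exact: is_real_cubic_scroll|].
  - exact: parametrizes_variety (param_cubic_scroll _).
  - exact: zdim_cubic_scroll.
  - by rewrite real_locus_cubic_scroll; exact: zdim_cubic_scroll.
exists (@std_conic C), (@coord_line C 0 1); split=> //.
- exact: focal_scroll_conic.
- exact: is_line01.
- exact: focal_scroll01.
exists (vec4 0 0 1 0); split; split; rewrite ?vec4_eq0 ?oner_eq0 ?andbF ?vec4E //.
by split=> //; ring.
Qed.

Lemma hyperbolic_skew_join : hyperbolic_linear (@skew_join C).
Proof.
split; last 1 first.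
- exists (@coord_line C 0 1), (@coord_line C 2 3); split.
  + exact: is_real_coord_line.
  + exact: is_real_coord_line.
  + exact: skew_line01_23.
  + exact: focal_lines_skew_join.
- split; [exact: skew_join_klein| | |exact: is_real_skew_join|].
  + exact: parametrizes_variety (param_skew_join _).
  + exact: zdim_skew_join.
  + by rewrite real_locus_skew_join; exact: zdim_skew_join.
- exact: linear_skew_join.
Qed.

Lemma parabolic_tangent_cone : parabolic_linear (@tangent_cone C).
Proof.
split; last 1 first.
- exists (@coord_line C 0 1); exact: focal_lines_tangent_cone.
- split; [exact: tangent_cone_klein| | |exact: is_real_tangent_cone|].
  + exact: parametrizes_variety (param_tangent_cone _).
  + exact: zdim_tangent_cone.
  + by rewrite real_locus_tangent_cone; exact: zdim_tangent_cone.
- exact: linear_tangent_cone.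
Qed.

End RealStructure.

(** * Recognizing reduced plane conics *)

Section PlaneConics.
Variable K : numFieldType.

(** The point [P1] of the plane off the conic excludes the whole plane, and three independent points
    exclude a line. *)
Lemma plane_conic_intro (l q : {mpoly K[4]}) (P1 P2 P3 P4 : 'rV[K]_4) :
  l \is 1.-homog -> l != 0 -> q \is 2.-homog ->
  zeros [set l] P1 -> ~ zeros [set l; q] P1 ->
  zeros [set l; q] P2 -> zeros [set l; q] P3 -> zeros [set l; q] P4 ->
  (forall a b c, a *: P2 + b *: P3 + c *: P4 = 0 -> [/\ a = 0, b = 0 & c = 0]) ->
  is_plane_conic (zeros [set l; q]).
Proof.
move=> hl l0 hq lP nP H2 H3 H4 ind; exists l, q; split=> //; split=> [E|].
  by apply: nP; rewrite E.
move=> /is_lineP[A [B [iAB E]]].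
rewrite E in H2 H3 H4; have [_ [a2 [b2 e2]]] := H2.
have [_ [a3 [b3 e3]]] := H3; have [_ [a4 [b4 e4]]] := H4.
(* Three vectors in the span of [A] and [B] satisfy the relation whose coefficients are their 2 by 2
   minors; independence makes these minors vanish. *)
have [z2 z3 z4] : [/\ a3 * b4 - a4 * b3 = 0, a4 * b2 - a2 * b4 = 0 & a2 * b3 - a3 * b2 = 0].
  apply: ind; rewrite e2 e3 e4; apply/rowP => i; rewrite !mxE; ring.
have [] : [/\ b3 = 0, - b2 = 0 & 0 = 0 :> K].
  apply: ind; rewrite e2 e3 e4; apply/rowP => i; rewrite !mxE.
  transitivity (- (a2 * b3 - a3 * b2) * (- A 0 i)); first by ring.
  by rewrite z4; ring.
move=> b30 /eqP; rewrite oppr_eq0 => /eqP b20 _.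
have [] : [/\ a3 = 0, - a2 = 0 & 0 = 0 :> K].
  by apply: ind; rewrite e2 e3 e4 b30 b20; apply/rowP => i; rewrite !mxE; ring.
move=> a30 _ _; have [_ /eqP] : [/\ 0 = 0 :> K, 1 = 0 :> K & 0 = 0 :> K].
  by apply: ind; rewrite e3 a30 b30; apply/rowP => i; rewrite !mxE; ring.
by rewrite oner_eq0.
Qed.

End PlaneConics.

(** * Parametric congruences and the normal form *)

Section ParametricCongruence.
Variable K : numFieldType.
Implicit Types (phi : 'M[K]_(3, 2) -> 'rV[K]_4) (x y : 'M[K]_(3, 2)) (g : 'M[K]_4).

(** [param_line] for an arbitrary function, so that a normal form composed with coordinate changes
    need not be turned into a coefficient vector. *)
Definition pline phi (k : 'I_3) x : set 'rV[K]_4 :=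
  [set v | v != 0 /\
     exists y, [/\ in_P1x3 y, forall l, l != k -> row l y = row l x & v = phi y]].

Definition lines_at phi (k : 'I_3) : set 'rV[K]_6 :=
  [set p | @klein K p /\ exists2 x, in_P1x3 x & line_of p = pline phi k x].

Definition cong phi (k : 'I_3) : set 'rV[K]_6 := zclosure (lines_at phi k).

Lemma param_congruenceE (w : 'rV[K]_ncoef) k : param_congruence w k = cong (tri_map w) k.
Proof. by []. Qed.

Lemma zclosed_cong phi k : zclosed (cong phi k).
Proof. by apply: zclosed_zclosure => p [[]]. Qed.

Definition reparam (tau : {perm 'I_3}) (h : 'I_3 -> 'M[K]_2) x : 'M[K]_(3, 2) :=
  \matrix_l (row (tau l) x *m h l).

Lemma row_reparam tau h x l : row l (reparam tau h x) = row (tau l) x *m h l.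
Proof. by rewrite rowK. Qed.

Lemma in_P1x3_reparam tau h x : (forall l, h l \in unitmx) ->
  in_P1x3 x -> in_P1x3 (reparam tau h x).
Proof. by move=> uh xP l; rewrite row_reparam mulmx_unit_neq0. Qed.

Lemma reparam_inv tau h x : (forall l, h l \in unitmx) ->
  exists x', [/\ in_P1x3 x -> in_P1x3 x' & reparam tau h x' = x].
Proof.
move=> uh; pose h' l := invmx (h ((tau^-1)%g l)).
have uh' l : h' l \in unitmx by rewrite unitmx_inv.
exists (reparam tau^-1 h' x); split; first exact: in_P1x3_reparam.
by apply/row_matrixP => l; rewrite !row_reparam /h' permK mulmxKV.
Qed.

Lemma pline_equiv phi phi' tau h g k x : (forall l, h l \in unitmx) -> g \in unitmx ->
  (forall y, phi y = phi' (reparam tau h y) *m g) ->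
  pline phi (tau k) x = pb (invmx g) (pline phi' k (reparam tau h x)).
Proof.
move=> uh ug E; have ug' : invmx g \in unitmx by rewrite unitmx_inv.
apply/seteqP; split=> v.
  move=> [v0 [y [yP yx vE]]]; split; first by rewrite mulmx_unit_neq0.
  exists (reparam tau h y); split; first exact: in_P1x3_reparam.
    by move=> l lk; rewrite !row_reparam yx // (inj_eq perm_inj).
  by rewrite vE E mulmxK.
move=> [v0 [y' [yP yx vE]]]; have [y [yP' yE]] := reparam_inv tau y' uh.
split; first by rewrite -(mulmx_unit_neq0 _ ug').
exists y; split; first exact: yP'.
  move=> l lk; have := yx ((tau^-1)%g l).
  rewrite -yE !row_reparam permKV => /(_ _)/(can_inj (mulmxK (uh _))); apply.
  by apply: contraNneq lk => <-; rewrite permKV.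
by rewrite E yE -vE mulmxKV.
Qed.

Lemma cong_equiv phi phi' tau h g k : (forall l, h l \in unitmx) -> g \in unitmx ->
  (forall y, phi y = phi' (reparam tau h y) *m g) ->
  cong phi (tau k) = pbp (invmx g) (cong phi' k).
Proof.
move=> uh ug E; have ug' : invmx g \in unitmx by rewrite unitmx_inv.
rewrite /cong /pbp -zclosure_pb ?compound_unit //; congr zclosure.
have lE p : line_of p = pb (invmx g) (line_of (p *m compound (invmx g))).
  by apply/seteqP; split=> v; rewrite /pb /=; [move=> ?; apply/line_of_mulmx|move/line_of_mulmx; apply].
apply/seteqP; split=> p [kp [x xP Hp]].
  split; first by rewrite -(klein_pb ug') in kp.
  exists (reparam tau h x); first exact: in_P1x3_reparam.
  by apply: (pb_inj ug'); rewrite -lE Hp; apply: pline_equiv.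
split; first by rewrite -(klein_pb ug').
have [x' [xP' xE]] := reparam_inv tau x uh; exists x'; first exact: xP'.
by rewrite lE Hp (pline_equiv _ _ uh ug E) xE.
Qed.

Section Ruled.
Variables (phi A B : 'M[K]_(3, 2) -> 'rV[K]_4) (k : 'I_3).
Hypothesis phiE : forall x, phi x = x k 0 *: A x + x k 1 *: B x.
Hypothesis A_row : forall x y, (forall l, l != k -> row l y = row l x) -> A y = A x.
Hypothesis B_row : forall x y, (forall l, l != k -> row l y = row l x) -> B y = B x.

Lemma pline_sub x : pline phi k x `<=` [set v | v != 0 /\ exists a b, v = a *: A x + b *: B x].
Proof.
move=> v [v0 [y [_ yx vE]]]; split=> //; exists (y k 0), (y k 1).
by rewrite vE phiE (A_row yx) (B_row yx).
Qed.

Lemma sub_pline x : in_P1x3 x -> span2 (A x) (B x) `<=` pline phi k x.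
Proof.
move=> xP v [v0 [a [b vE]]]; split=> //.
pose y : 'M[K]_(3, 2) := \matrix_(l, j) (if l == k then (if j == 0 then a else b) else x l j).
have yx l : l != k -> row l y = row l x.
  by move=> /negPf lk; apply/rowP => j; rewrite !mxE lk.
exists y; split=> //; last by rewrite phiE (A_row yx) (B_row yx) vE !mxE eqxx.
move=> l; have [lk|lk] := eqVneq l k; last by rewrite yx.
apply: contraNneq v0 => /rowP E; have := E 0; have := E 1; rewrite !mxE lk eqxx /= => b0 a0.
by rewrite vE a0 b0 !scale0r addr0.
Qed.

(** A parametric line that is a true line contains two independent points, both combinations of
    [A x] and [B x]; so its Pluecker vector is a nonzero multiple of their wedge, and degenerate
    fibres contribute nothing. *)
Lemma cong_sub (Y : set 'rV[K]_6) : zclosed Y ->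
  (forall x, in_P1x3 x -> wedge (A x) (B x) != 0 -> Y (wedge (A x) (B x))) ->
  cong phi k `<=` Y.
Proof.
move=> cY HY; apply: zclosure_sub => // p [kp [x xP Hp]].
have [p0 _] := kp; have [P [Q pE]] := kleinP kp; rewrite pE in p0 Hp *.
have /pline_sub[_ [a [b PE]]] : pline phi k x P by rewrite -Hp; apply: line_ofl.
have /pline_sub[_ [c [d QE]]] : pline phi k x Q by rewrite -Hp; apply: line_ofr.
move: p0; rewrite PE QE wedge_lin scaler_eq0 negb_or => /andP[d0 w0].
by apply: zclosed_scale => //; exact: HY.
Qed.

Lemma cong_mem x : in_P1x3 x -> wedge (A x) (B x) != 0 -> cong phi k (wedge (A x) (B x)).
Proof.
move=> xP w0; apply: sub_zclosure; split; first exact: klein_wedge.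
exists x => //; rewrite -span2_line_of //; apply/seteqP; split; first exact: sub_pline.
by move=> v /pline_sub[v0 H]; split.
Qed.

Lemma cong_eq g (E : set 'rV[K]_6) : g \in unitmx -> zclosed E ->
  (forall x, wedge (A x *m g) (B x *m g) != 0 -> E (wedge (A x *m g) (B x *m g))) ->
  (forall Y, zclosed Y -> (forall x, in_P1x3 x -> wedge (A x *m g) (B x *m g) != 0 ->
       Y (wedge (A x *m g) (B x *m g))) -> E `<=` Y) ->
  cong phi k = pbp g E.
Proof.
move=> ug cE HE EY; have ucg := compound_unit ug.
apply/seteqP; split.
  apply: cong_sub; first exact: zclosed_pb.
  move=> x xP w0; rewrite /pbp /pb /= -wedge_mulmx; apply: HE.
  by rewrite wedge_mulmx mulmx_unit_neq0.
rewrite -[X in _ `<=` X](pbKV ucg); apply: pb_sub; apply: EY.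
  by apply: zclosed_pb; [rewrite unitmx_inv|exact: zclosed_cong].
move=> x xP; rewrite wedge_mulmx mulmx_unit_neq0 // => w0.
by rewrite /pb /= mulmxK //; exact: cong_mem.
Qed.

End Ruled.

Definition mk6 (s0 s1 t0 t1 u0 u1 : K) : 'M[K]_(3, 2) :=
  \matrix_(l, j) nth 0 (nth [::] [:: [:: s0; s1]; [:: t0; t1]; [:: u0; u1]] l) j.

Lemma mk6E s0 s1 t0 t1 u0 u1 (x := mk6 s0 s1 t0 t1 u0 u1) :
  (x 0 0 = s0) * (x 0 1 = s1) * (x 1 0 = t0) * (x 1 1 = t1) * (x 2 0 = u0) * (x 2 1 = u1).
Proof. by rewrite /x !mxE. Qed.

Lemma forall_I3 (P : 'I_3 -> Prop) : P 0 -> P 1 -> P 2 -> forall i, P i.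
Proof.
move=> P0 P1 P2 i; have : [|| i == 0, i == 1 | i == 2] by case: i => [[|[|[|]]]].
by case/or3P => /eqP ->.
Qed.

Lemma forall_I2 (P : 'I_2 -> Prop) : P 0 -> P 1 -> forall i, P i.
Proof.
move=> P0 P1 i; have : (i == 0) || (i == 1) by case: i => [[|[|]]].
by case/orP => /eqP ->.
Qed.

Lemma in_P1x3_mk6 s0 s1 t0 t1 u0 u1 :
  (s0 != 0) || (s1 != 0) -> (t0 != 0) || (t1 != 0) -> (u0 != 0) || (u1 != 0) ->
  in_P1x3 (mk6 s0 s1 t0 t1 u0 u1).
Proof.
move=> s t u; apply: forall_I3; apply/eqP => /rowP E; have := E 0; have := E 1;
  rewrite !mxE /= => b0 a0.
- by move: s; rewrite a0 b0 eqxx.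
- by move: t; rewrite a0 b0 eqxx.
- by move: u; rewrite a0 b0 eqxx.
Qed.

(* The normal form of a birational map of type (1,1,2): in suitable coordinates, the
   pencils of planes of the inverse are (x0 : x1) and (x0 : x2). *)
Definition nf (d00 d10 d01 d11 e00 e10 e01 e11 : K) x : 'rV[K]_4 :=
  vec4 (x 0 0 * x 1 0 * x 2 0) (x 0 1 * x 1 0 * x 2 0) (x 0 0 * x 1 1 * x 2 0)
   (x 2 0 * (d00 * (x 0 0 * x 1 0) + d10 * (x 0 1 * x 1 0)
             + d01 * (x 0 0 * x 1 1) + d11 * (x 0 1 * x 1 1))
    + x 2 1 * (e00 * (x 0 0 * x 1 0) + e10 * (x 0 1 * x 1 0)
             + e01 * (x 0 0 * x 1 1) + e11 * (x 0 1 * x 1 1))).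

Section NormalForm.
Variables d00 d10 d01 d11 e00 e10 e01 e11 : K.
Local Notation phi := (nf d00 d10 d01 d11 e00 e10 e01 e11).

(** The coefficients of s0 and s1 in the normal form (below, those of t0 and t1): they span the
    parametric line. *)
Definition nfSA x : 'rV[K]_4 := vec4 (x 1 0 * x 2 0) 0 (x 1 1 * x 2 0)
  (x 2 0 * (d00 * x 1 0 + d01 * x 1 1) + x 2 1 * (e00 * x 1 0 + e01 * x 1 1)).
Definition nfSB x : 'rV[K]_4 := vec4 0 (x 1 0 * x 2 0) 0
  (x 2 0 * (d10 * x 1 0 + d11 * x 1 1) + x 2 1 * (e10 * x 1 0 + e11 * x 1 1)).
Definition nfTA x : 'rV[K]_4 := vec4 (x 0 0 * x 2 0) (x 0 1 * x 2 0) 0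
  (x 2 0 * (d00 * x 0 0 + d10 * x 0 1) + x 2 1 * (e00 * x 0 0 + e10 * x 0 1)).
Definition nfTB x : 'rV[K]_4 := vec4 0 0 (x 0 0 * x 2 0)
  (x 2 0 * (d01 * x 0 0 + d11 * x 0 1) + x 2 1 * (e01 * x 0 0 + e11 * x 0 1)).

Lemma row_entry x y l j : row l y = row l x -> y l j = x l j.
Proof. by move=> /rowP/(_ j); rewrite !mxE. Qed.

Lemma congS_eq g (E : set 'rV[K]_6) : g \in unitmx -> zclosed E ->
  (forall x, wedge (nfSA x *m g) (nfSB x *m g) != 0 -> E (wedge (nfSA x *m g) (nfSB x *m g))) ->
  (forall Y, zclosed Y -> (forall x, in_P1x3 x -> wedge (nfSA x *m g) (nfSB x *m g) != 0 ->
       Y (wedge (nfSA x *m g) (nfSB x *m g))) -> E `<=` Y) ->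
  cong phi 0 = pbp g E.
Proof.
apply: cong_eq => [x|x y xy|x y xy].
- by rewrite vec4_lin; congr vec4; ring.
- by rewrite /nfSA !(row_entry _ (xy 1 isT)) !(row_entry _ (xy 2 isT)).
- by rewrite /nfSB !(row_entry _ (xy 1 isT)) !(row_entry _ (xy 2 isT)).
Qed.

Lemma congT_eq g (E : set 'rV[K]_6) : g \in unitmx -> zclosed E ->
  (forall x, wedge (nfTA x *m g) (nfTB x *m g) != 0 -> E (wedge (nfTA x *m g) (nfTB x *m g))) ->
  (forall Y, zclosed Y -> (forall x, in_P1x3 x -> wedge (nfTA x *m g) (nfTB x *m g) != 0 ->
       Y (wedge (nfTA x *m g) (nfTB x *m g))) -> E `<=` Y) ->
  cong phi 1 = pbp g E.
Proof.
apply: cong_eq => [x|x y xy|x y xy].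
- by rewrite vec4_lin; congr vec4; ring.
- by rewrite /nfTA !(row_entry _ (xy 0 isT)) !(row_entry _ (xy 2 isT)).
- by rewrite /nfTB !(row_entry _ (xy 0 isT)) !(row_entry _ (xy 2 isT)).
Qed.

End NormalForm.

Definition lin4 (r0 r1 r2 r3 : 'rV[K]_4) : 'M[K]_4 := \matrix_i [:: r0; r1; r2; r3]`_i.

Lemma mul_lin4 r0 r1 r2 r3 a b c d :
  vec4 a b c d *m lin4 r0 r1 r2 r3 = a *: r0 + b *: r1 + c *: r2 + d *: r3.
Proof. by rewrite mulmx_sum_row sum_I4 !rowK !vec4E. Qed.

Lemma unit_of_inverse (g h : 'M[K]_4) :
  (forall a b c d, vec4 a b c d *m g *m h = vec4 a b c d) -> g \in unitmx.
Proof.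
move=> E; have : g *m h = 1%:M.
  apply/row_matrixP => i; rewrite row_mul !rowE mulmx1.
  by rewrite (vec4_eta (delta_mx 0 i)) E.
by move/mulmx1_unit => [].
Qed.

(** Coordinate changes that bring the congruences of the normal forms to the standard surfaces. The
    third one, [gsw], exchanges x1 and x2, which corresponds to exchanging s and t in the normal
    form. *)
Definition gA : 'M[K]_4 := lin4 (vec4 0 1 0 0) (vec4 0 0 (-1) 0) (vec4 1 0 0 0) (vec4 0 0 0 1).
Definition gB : 'M[K]_4 := lin4 (vec4 1 0 0 0) (vec4 0 0 0 1) (vec4 0 1 0 1) (vec4 0 0 (-1) 0).
Definition gsw : 'M[K]_4 := lin4 (vec4 1 0 0 0) (vec4 0 0 1 0) (vec4 0 1 0 0) (vec4 0 0 0 1).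

Lemma mul_gA a b c d : vec4 a b c d *m gA = vec4 c a (- b) d.
Proof. by rewrite mul_lin4; apply: eq_vec4; rewrite !mxE /=; ring. Qed.

Lemma mul_gB a b c d : vec4 a b c d *m gB = vec4 a c (- d) (b + c).
Proof. by rewrite mul_lin4; apply: eq_vec4; rewrite !mxE /=; ring. Qed.

Lemma mul_gsw a b c d : vec4 a b c d *m gsw = vec4 a c b d.
Proof. by rewrite mul_lin4; apply: eq_vec4; rewrite !mxE /=; ring. Qed.

Lemma gA_unit : gA \in unitmx.
Proof.
apply: (@unit_of_inverse _ (lin4 (vec4 0 0 1 0) (vec4 1 0 0 0) (vec4 0 (-1) 0 0) (vec4 0 0 0 1))).
by move=> *; rewrite mul_gA mul_lin4; apply: eq_vec4; rewrite !mxE /=; ring.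
Qed.

Lemma gB_unit : gB \in unitmx.
Proof.
apply: (@unit_of_inverse _ (lin4 (vec4 1 0 0 0) (vec4 0 (-1) 1 0) (vec4 0 0 0 (-1)) (vec4 0 1 0 0))).
by move=> *; rewrite mul_gB mul_lin4; apply: eq_vec4; rewrite !mxE /=; ring.
Qed.

Lemma gsw_unit : gsw \in unitmx.
Proof. by apply: (@unit_of_inverse _ gsw) => *; rewrite !mul_gsw. Qed.

End ParametricCongruence.

(** * Congruences of the five normal forms *)

Section NormalFormCongruences.
Variable K : numFieldType.
Local Notation axis := (@coord_line K).

(** The letter tells whether [e11] is nonzero (A) or zero (B). The bilinear form e has rank 2 in
    [nfA1] and [nfB1], and rank 1 in the others. Cases 1 to 5 of the classification are [nfA1],
    [nfB1], [nfA0], [nfB2], [nfB3], in this order. *)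
Definition nfA1 : 'M[K]_(3, 2) -> 'rV[K]_4 := nf 0 0 0 0 1 0 0 1.
Definition nfA0 : 'M[K]_(3, 2) -> 'rV[K]_4 := nf 0 0 0 0 0 0 0 1.
Definition nfB1 : 'M[K]_(3, 2) -> 'rV[K]_4 := nf 0 0 0 1 0 1 1 0.
Definition nfB2 : 'M[K]_(3, 2) -> 'rV[K]_4 := nf 0 0 0 1 0 1 0 0.
Definition nfB3 : 'M[K]_(3, 2) -> 'rV[K]_4 := nf 0 0 0 1 1 0 0 0.

Lemma nz1 : (1 != 0 :> K) || (0 != 0 :> K).
Proof. by rewrite oner_eq0. Qed.

Lemma congS_nfA1 : cong nfA1 0 = pbp (gA K) (@cubic_scroll K).
Proof.
pose d0 : K := 0; pose S := fun x : 'M[K]_(3, 2) => scroll_point (x 1 1) (x 1 0)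
  (- (x 1 0 * x 2 0 * x 2 0)) (x 2 0 * x 2 1).
have WE x : wedge (nfSA 0 0 1 0 x *m gA K) (nfSB 0 0 0 1 x *m gA K) = S x.
  by rewrite /nfSA /nfSB !mul_gA wedge_vec4; congr vec6; ring.
apply: congS_eq; [exact: gA_unit|exact: zclosed_cubic_scroll| |].
  by move=> x; rewrite WE; exact: scroll_point_mem.
move=> Y cY HY; apply: cubic_scroll_sub => // t0 t1 r k t00 t10 r0 k0.
(* The first two arguments of [S] force (t1 : t0); with u0 = 1, the value of u1 is solved from the
   ratio of [r] and [k]. The row of s is arbitrary, as S-lines do not depend on it. *)
pose x := mk6 1 0 t1 t0 1 (- (k * t1 / r)).
have SE : scroll_point t0 t1 r k = (- (r / t1)) *: S x.
  by rewrite /S !mk6E vec6Z; congr vec6; field; rewrite ?r0 ?t10.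
rewrite SE; apply: zclosed_scale => //; first by rewrite oppr_eq0 mulf_neq0 ?invr_eq0.
rewrite -WE; apply: HY; first by apply: in_P1x3_mk6; rewrite ?t10 ?oner_eq0.
rewrite WE; apply: contraNneq (mulf_neq0 r0 t00) => S0.
have := congr1 (fun w : 'rV_6 => w 0 1) SE.
by rewrite S0 scaler0 !mxE /= => ->.
Qed.

Lemma congS_nfB1 : cong nfB1 0 = pbp (gB K) (@cubic_scroll K).
Proof.
pose S := fun x : 'M[K]_(3, 2) => scroll_point (x 1 0) (x 1 1)
  (- (x 2 0 * (x 2 0 * x 1 1 + x 2 1 * x 1 0))) (x 2 0 * x 2 0).
have WE x : wedge (nfSA 0 0 0 1 x *m gB K) (nfSB 0 1 1 0 x *m gB K) = S x.
  by rewrite /nfSA /nfSB !mul_gB wedge_vec4; congr vec6; ring.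
apply: congS_eq; [exact: gB_unit|exact: zclosed_cubic_scroll| |].
  by move=> x; rewrite WE; exact: scroll_point_mem.
move=> Y cY HY; apply: cubic_scroll_sub => // t0 t1 r k t00 t10 r0 k0.
pose x := mk6 1 0 t0 t1 1 (- (r / k + t1) / t0).
have SE : scroll_point t0 t1 r k = k *: S x.
  by rewrite /S !mk6E vec6Z; congr vec6; field; rewrite ?k0 ?t00.
rewrite SE; apply: zclosed_scale => //.
rewrite -WE; apply: HY; first by apply: in_P1x3_mk6; rewrite ?t00 ?oner_eq0.
rewrite WE; apply: contraNneq (mulf_neq0 r0 t00) => S0.
have := congr1 (fun w : 'rV_6 => w 0 1) SE.
by rewrite S0 scaler0 !mxE /= => ->.
Qed.

Lemma congS_nfA0 : cong nfA0 0 = pbp (gsw K) (@skew_join K).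
Proof.
pose J (a b c d : K) := vec6 0 (c * a) (c * b) (d * a) (d * b) 0.
pose S := fun x : 'M[K]_(3, 2) =>
  J (x 1 0 * x 2 0) (x 2 1 * x 1 1) (x 1 0 * x 2 0) (x 1 1 * x 2 0).
have WE x : wedge (nfSA 0 0 0 0 x *m gsw K) (nfSB 0 0 0 1 x *m gsw K) = S x.
  by rewrite /nfSA /nfSB !mul_gsw wedge_vec4; congr vec6; ring.
apply: congS_eq; [exact: gsw_unit|exact: zclosed_skew_join| |].
  by move=> x; rewrite WE; exact: skew_join_mem.
move=> Y cY HY; apply: skew_join_sub => // a b c d a0 b0 c0 d0.
pose x := mk6 1 0 c d 1 (b * c / (a * d)).
have SE : J a b c d = (a / c) *: S x.
  by rewrite /S !mk6E vec6Z; congr vec6; field; rewrite ?c0 ?a0 ?d0.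
rewrite -/(J a b c d) SE; apply: zclosed_scale => //; first by rewrite mulf_neq0 ?invr_eq0.
rewrite -WE; apply: HY; first by apply: in_P1x3_mk6; rewrite ?c0 ?oner_eq0.
rewrite WE; apply: contraNneq (mulf_neq0 c0 a0) => S0.
have := congr1 (fun w : 'rV_6 => w 0 1) SE.
by rewrite S0 scaler0 !mxE /= => ->.
Qed.

Lemma congS_nfB2 : cong nfB2 0 = pbp (gsw K) (@skew_join K).
Proof.
pose J (a b c d : K) := vec6 0 (c * a) (c * b) (d * a) (d * b) 0.
pose S := fun x : 'M[K]_(3, 2) =>
  J (x 1 0 * x 2 0) (x 2 0 * x 1 1 + x 2 1 * x 1 0) (x 1 0 * x 2 0) (x 1 1 * x 2 0).
have WE x : wedge (nfSA 0 0 0 0 x *m gsw K) (nfSB 0 1 1 0 x *m gsw K) = S x.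
  by rewrite /nfSA /nfSB !mul_gsw wedge_vec4; congr vec6; ring.
apply: congS_eq; [exact: gsw_unit|exact: zclosed_skew_join| |].
  by move=> x; rewrite WE; exact: skew_join_mem.
move=> Y cY HY; apply: skew_join_sub => // a b c d a0 b0 c0 d0.
pose x := mk6 1 0 c d 1 ((b * c / a - d) / c).
have SE : J a b c d = (a / c) *: S x.
  by rewrite /S !mk6E vec6Z; congr vec6; field; rewrite ?c0 ?a0.
rewrite -/(J a b c d) SE; apply: zclosed_scale => //; first by rewrite mulf_neq0 ?invr_eq0.
rewrite -WE; apply: HY; first by apply: in_P1x3_mk6; rewrite ?c0 ?oner_eq0.
rewrite WE; apply: contraNneq (mulf_neq0 c0 a0) => S0.
have := congr1 (fun w : 'rV_6 => w 0 1) SE.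
by rewrite S0 scaler0 !mxE /= => ->.
Qed.

(** Among the five forms, [nfB2] alone is not symmetric in s and t, so its T is computed directly
    and not by [cong_swap]. *)
Lemma congT_nfB2 : cong nfB2 1 = @tangent_cone K.
Proof.
have -> : @tangent_cone K = pbp 1%:M (@tangent_cone K).
  by apply/seteqP; split=> w; rewrite /pbp /pb /= compound1 mulmx1.
pose J (a b k m : K) := vec6 0 (k * (a * a)) (k * (a * b)) (k * (a * b)) (k * (b * b)) m.
pose S := fun x : 'M[K]_(3, 2) =>
  J (x 0 0) (x 0 1) (x 2 0 * x 2 0) (- (x 2 0 * x 2 1 * x 0 0 * x 0 1)).
have WE x : wedge (nfTA 0 0 0 1 x *m 1%:M) (nfTB 0 1 0 0 x *m 1%:M) = S x.
  by rewrite !mulmx1 wedge_vec4; congr vec6; ring.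
apply: congT_eq; [exact: unitmx1|exact: zclosed_tangent_cone| |].
  by move=> x; rewrite WE; exact: tangent_cone_mem.
move=> Y cY HY; apply: tangent_cone_sub => // a b k m a0 b0 k0 m0.
pose x := mk6 a b 1 0 1 (- (m / (k * a * b))).
have SE : J a b k m = k *: S x.
  by rewrite /S !mk6E vec6Z; congr vec6; field; rewrite ?k0 ?a0 ?b0.
rewrite -/(J a b k m) SE; apply: zclosed_scale => //.
rewrite -WE; apply: HY; first by apply: in_P1x3_mk6; rewrite ?a0 ?oner_eq0.
rewrite WE; apply: contraNneq m0 => S0.
have := congr1 (fun w : 'rV_6 => w 0 5) SE.
by rewrite S0 scaler0 !mxE /= => ->.
Qed.

Lemma congS_nfB3 : cong nfB3 0 = pbp (gsw K) (@tangent_cone K).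
Proof.
pose J (a b k m : K) := vec6 0 (k * (a * a)) (k * (a * b)) (k * (a * b)) (k * (b * b)) m.
pose S := fun x : 'M[K]_(3, 2) =>
  J (x 1 0) (x 1 1) (x 2 0 * x 2 0) (- (x 2 0 * x 2 1 * x 1 0 * x 1 0)).
have WE x : wedge (nfSA 0 0 1 0 x *m gsw K) (nfSB 0 1 0 0 x *m gsw K) = S x.
  by rewrite /nfSA /nfSB !mul_gsw wedge_vec4; congr vec6; ring.
apply: congS_eq; [exact: gsw_unit|exact: zclosed_tangent_cone| |].
  by move=> x; rewrite WE; exact: tangent_cone_mem.
move=> Y cY HY; apply: tangent_cone_sub => // a b k m a0 b0 k0 m0.
pose x := mk6 1 0 a b 1 (- (m / (k * a * a))).
have SE : J a b k m = k *: S x.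
  by rewrite /S !mk6E vec6Z; congr vec6; field; rewrite ?k0 ?a0.
rewrite -/(J a b k m) SE; apply: zclosed_scale => //.
rewrite -WE; apply: HY; first by apply: in_P1x3_mk6; rewrite ?a0 ?oner_eq0.
rewrite WE; apply: contraNneq m0 => S0.
have := congr1 (fun w : 'rV_6 => w 0 5) SE.
by rewrite S0 scaler0 !mxE /= => ->.
Qed.

Lemma mul_gsw_row (v : 'rV[K]_4) : v *m gsw K = vec4 (v 0 0) (v 0 2) (v 0 1) (v 0 3).
Proof. by rewrite {1}(vec4_eta v) mul_gsw. Qed.

Lemma invmx_gsw : invmx (gsw K) = gsw K.
Proof.
have E : gsw K *m gsw K = 1%:M.
  apply/row_matrixP => i; rewrite row_mul !rowE mulmx1.
  by rewrite (vec4_eta (delta_mx 0 i)) !mul_gsw.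
by rewrite -[LHS]mulmx1 -E mulKmx // gsw_unit.
Qed.

Lemma cong_swap phi phi' : (forall x, phi x = phi' (reparam (tperm 0 1) (fun=> 1%:M) x) *m gsw K) ->
  cong phi 1 = pbp (gsw K) (cong phi' 0) /\ cong phi 0 = pbp (gsw K) (cong phi' 1).
Proof.
move=> E; split.
  rewrite -{1}[1](tpermL 0 1) -invmx_gsw; apply: cong_equiv E; last exact: gsw_unit.
  by move=> _; exact: unitmx1.
rewrite -{1}[0](tpermR 0 1) -invmx_gsw; apply: cong_equiv E; last exact: gsw_unit.
by move=> _; exact: unitmx1.
Qed.

Lemma nf_swap d00 d10 d01 d11 e00 e10 e01 e11 x :
  nf d00 d10 d01 d11 e00 e10 e01 e11 x =
  nf d00 d01 d10 d11 e00 e01 e10 e11 (reparam (tperm 0 1) (fun=> 1%:M) x) *m gsw K.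
Proof.
have E l j : reparam (tperm 0 1) (fun=> 1%:M) x l j = x (tperm 0 1 l) j.
  by rewrite mxE mulmx1 mxE.
by rewrite mul_gsw_row /nf !vec4E !E !tpermL !tpermR !tpermD //; congr vec4; ring.
Qed.

End NormalFormCongruences.

(** * Conics and focal loci in coordinates *)

Section ConicsInCoordinates.
Variable K : numFieldType.
Local Notation axis := (@coord_line K).

Lemma e4E (i j : 'I_4) : e4 K i 0 j = (j == i)%:R.
Proof. by rewrite !mxE eqxx. Qed.

Lemma e4_neq0 (i : 'I_4) : e4 K i != 0.
Proof. by apply/eqP => /rowP/(_ i)/eqP; rewrite e4E eqxx mxE oner_eq0. Qed.

Lemma plane_conic_axes (i j k m : 'I_4) : uniq [:: i; j; k; m] ->
  is_plane_conic (axis i j `|` axis i k).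
Proof.
move=> /= /and4P[]; rewrite !inE !negb_or => /and3P[ij ik im] /andP[jk jm] km _.
have -> : axis i j `|` axis i k = zeros [set 'X_i; 'X_j * 'X_k].
  apply/seteqP; split=> v.
    move=> [] [v0 [h1 h2]]; split=> // _ [->|->];
      by rewrite ?evalvM !evalvX ?h1 ?h2 ?mul0r ?mulr0.
  move=> [v0 H]; have := H _ (or_introl erefl); have := H _ (or_intror erefl).
  rewrite evalvM !evalvX => /eqP; rewrite mulf_eq0 => /orP[]/eqP h2 h1; [left|right]; by [].
have ev (P : 'rV[K]_4) : P != 0 -> P 0 i = 0 -> P 0 j * P 0 k = 0 ->
    zeros [set 'X_i; 'X_j * 'X_k] P.
  by move=> P0 h1 h2; split=> // _ [->|->]; rewrite ?evalvM !evalvX.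
apply: (@plane_conic_intro _ _ _ (e4 K j + e4 K k) (e4 K j) (e4 K k) (e4 K m)).
- exact: dhomogX1.
- by apply/eqP => /(congr1 (fun p => p@_U_(i)%MM))/eqP; rewrite mcoeffXU eqxx mcoeff0 oner_eq0.
- exact: dhomogXX.
- split=> [|_ ->]; last by rewrite evalvX mxE !e4E (negPf ij) (negPf ik) addr0.
  apply/eqP => /rowP/(_ j)/eqP; rewrite mxE !e4E eqxx (negPf jk) addr0 mxE.
  by rewrite oner_eq0.
- have Pj : (e4 K j + e4 K k) 0 j = 1 by rewrite mxE !e4E eqxx (negPf jk) addr0.
  have Pk : (e4 K j + e4 K k) 0 k = 1.
    by rewrite mxE !e4E eqxx eq_sym (negPf jk) add0r.
  move=> [_ /(_ _ (or_intror erefl))/eqP]; rewrite evalvM !evalvX Pj Pk mulr1.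
  by rewrite oner_eq0.
- apply: ev; first exact: e4_neq0.
    by rewrite e4E (negPf ij).
  by rewrite !e4E eqxx eq_sym (negPf jk) mulr0.
- apply: ev; first exact: e4_neq0.
    by rewrite e4E (negPf ik).
  by rewrite !e4E eqxx (negPf jk) mul0r.
- apply: ev; first exact: e4_neq0.
    by rewrite e4E (negPf im).
  by rewrite !e4E (negPf jm) mul0r.
move=> a b c /rowP E.
have E' l : a * (l == j)%:R + b * (l == k)%:R + c * (l == m)%:R = 0.
  by have := E l; rewrite mxE [X in X + _]mxE !(mxE _ _ _ l) -/(e4 K _) ?e4E => <-.
split.
- by have := E' j; rewrite eqxx (negPf jk) (negPf jm) !mulr0 mulr1 !addr0.
- by have := E' k; rewrite eqxx eq_sym (negPf jk) (negPf km) !mulr0 mulr1 addr0 add0r.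
- have := E' m; rewrite eqxx [m == j]eq_sym [m == k]eq_sym (negPf jm) (negPf km).
  by rewrite !mulr0 mulr1 !add0r.
Qed.

Definition std_conic_form : {mpoly K[4]} := 'X_0 * 'X_2 - 'X_1 * 'X_1.

Lemma std_conicE : @std_conic K = zeros [set 'X_3; std_conic_form].
Proof.
apply/seteqP; split=> v [v0].
  move=> [h3 h]; split=> // _ [->|->]; first by rewrite evalvX.
  by rewrite /evalv /std_conic_form mevalB !mevalM !mevalXU h subrr.
move=> H; split=> //; split; first by have := H _ (or_introl erefl); rewrite evalvX.
have := H _ (or_intror erefl).
by rewrite /evalv /std_conic_form mevalB !mevalM !mevalXU => /eqP; rewrite subr_eq0 => /eqP.
Qed.

Lemma dhomog_std_conic_form : std_conic_form \is 2.-homog.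
Proof. by apply: rpredB; exact: dhomogXX. Qed.

Lemma mpolyX_neq0 (i : 'I_4) : 'X_i != 0 :> {mpoly K[4]}.
Proof.
by apply/eqP => /(congr1 (fun p => p@_U_(i)%MM))/eqP; rewrite mcoeffXU eqxx mcoeff0 oner_eq0.
Qed.

Lemma plane_conic_std : is_plane_conic (@std_conic K).
Proof.
rewrite std_conicE.
have nz (a b c d : K) : (a != 0) || (b != 0) || (c != 0) -> vec4 a b c d != 0.
  by rewrite vec4_eq0; case/orP => [/orP[]|] /negPf ->; rewrite ?andbF.
have o1 : 1 != 0 :> K by exact: oner_neq0.
apply: (@plane_conic_intro _ _ _ (vec4 0 1 0 0) (vec4 1 0 0 0) (vec4 0 0 1 0) (vec4 1 1 1 0)).
- exact: dhomogX1.
- exact: mpolyX_neq0.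
- exact: dhomog_std_conic_form.
- by split=> [|_ ->]; [apply: nz; rewrite o1 orbT|rewrite evalvX vec4E].
- by rewrite -std_conicE => -[_ [_]]; rewrite !vec4E mulr0 mulr1 => /esym/eqP; rewrite oner_eq0.
- by rewrite -std_conicE; split; [apply: nz; rewrite o1|rewrite !vec4E; split=> //; ring].
- by rewrite -std_conicE; split; [apply: nz; rewrite o1 orbT|rewrite !vec4E; split=> //; ring].
- by rewrite -std_conicE; split; [apply: nz; rewrite o1|rewrite !vec4E; split=> //; ring].
move=> a b c /rowP E; have := E 0; have := E 1; have := E 2; rewrite !mxE /=.
rewrite !mulr0 !mulr1 !add0r !addr0 => h2 h1 h0.
by move: h0 h2; rewrite h1 !addr0 => -> ->.
Qed.

Lemma row_free_col_mx (p q : 'rV[K]_4) : indep2 p q -> row_free (col_mx p q).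
Proof.
move=> [i [j m0]]; apply: inj_row_free => u.
rewrite -[u]hsubmxK mul_row_col => /rowP E.
have eE k : lsubmx u 0 0 * p 0 k + rsubmx u 0 0 * q 0 k = 0.
  by have := E k; rewrite mxE [X in X + _]mxE [X in _ + X]mxE !big_ord1 [RHS]mxE.
have u0 : lsubmx u 0 0 = 0.
  apply/eqP; rewrite -[_ == 0]orbF -(negPf m0) -mulf_eq0; apply/eqP.
  transitivity (q 0 j * (lsubmx u 0 0 * p 0 i + rsubmx u 0 0 * q 0 i)
              - q 0 i * (lsubmx u 0 0 * p 0 j + rsubmx u 0 0 * q 0 j)); first by ring.
  by rewrite !eE !mulr0 subrr.
have u1 : rsubmx u 0 0 = 0.
  apply/eqP; rewrite -[_ == 0]orbF -(negPf m0) -mulf_eq0; apply/eqP.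
  transitivity (p 0 i * (lsubmx u 0 0 * p 0 j + rsubmx u 0 0 * q 0 j)
              - p 0 j * (lsubmx u 0 0 * p 0 i + rsubmx u 0 0 * q 0 i)); first by ring.
  by rewrite !eE !mulr0 subrr.
have L0 : lsubmx u = 0 by apply/rowP => k; rewrite (ord1 k) u0 [RHS]mxE.
have R0 : rsubmx u = 0 by apply/rowP => k; rewrite (ord1 k) u1 [RHS]mxE.
by rewrite L0 R0 row_mx0.
Qed.

Lemma smooth_std_conic : smooth_plane_conic (@std_conic K).
Proof.
exists 'X_3, std_conic_form; split.
- exact: dhomogX1.
- exact: mpolyX_neq0.
- exact: dhomog_std_conic_form.
- exact: std_conicE.
move=> P [P0 [P3 PE]]; apply: row_free_col_mx.
have -> : grad 'X_3 P = vec4 0 0 0 1.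
  by apply: eq_vec4; rewrite mxE vec4E mderivXU /evalv /= ?mulr0n ?mulr1n ?meval0 ?meval1.
have -> : grad std_conic_form P = vec4 (P 0 2) (- (P 0 1 + P 0 1)) (P 0 0) 0.
  apply: eq_vec4; rewrite mxE vec4E /std_conic_form /evalv mderivB !mderivM !mderivXU;
    rewrite !(mevalB, mevalD, mevalM, mevalXU) /= ?(meval0, meval1, mulr0n, mulr1n);
    by rewrite ?(meval0, meval1); ring.
apply/indep2_wedge; rewrite wedge_vec4 vec6_eq0 !mul0r !sub0r !mul1r !oppr_eq0 !eqxx /=.
move: P0; rewrite [P in P != 0]vec4_eta vec4_eq0 P3 eqxx andbT.
apply: contraNN => /and3P[/eqP p2 _ /eqP p0].
move: PE; rewrite p2 p0 mulr0 => /esym/eqP; rewrite mulf_eq0 orbb => ->.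
by rewrite !eqxx.
Qed.

Lemma pb_gsw_axis02 : pb (gsw K) (axis 0 2) = axis 0 1.
Proof.
by apply/seteqP; split=> v; rewrite /pb /coord_line /= mulmx_unit_neq0 ?gsw_unit // mul_gsw_row !vec4E.
Qed.

Lemma pb_gsw_axis01 : pb (gsw K) (axis 0 1) = axis 0 2.
Proof.
by apply/seteqP; split=> v; rewrite /pb /coord_line /= mulmx_unit_neq0 ?gsw_unit // mul_gsw_row !vec4E.
Qed.

Lemma pb_gsw_axis23 : pb (gsw K) (axis 2 3) = axis 1 3.
Proof.
by apply/seteqP; split=> v; rewrite /pb /coord_line /= mulmx_unit_neq0 ?gsw_unit // mul_gsw_row !vec4E.
Qed.

Lemma pb_gsw_axis13 : pb (gsw K) (axis 1 3) = axis 2 3.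
Proof.
by apply/seteqP; split=> v; rewrite /pb /coord_line /= mulmx_unit_neq0 ?gsw_unit // mul_gsw_row !vec4E.
Qed.

Lemma mul_gA_row (v : 'rV[K]_4) : v *m gA K = vec4 (v 0 2) (v 0 0) (- v 0 1) (v 0 3).
Proof. by rewrite {1}(vec4_eta v) mul_gA. Qed.

Lemma mul_gB_row (v : 'rV[K]_4) : v *m gB K = vec4 (v 0 0) (v 0 2) (- v 0 3) (v 0 1 + v 0 2).
Proof. by rewrite {1}(vec4_eta v) mul_gB. Qed.

Lemma pb_gA_axis01 : pb (gA K) (axis 0 1) = axis 0 2.
Proof.
by apply/seteqP; split=> v; rewrite /pb /coord_line /= mulmx_unit_neq0 ?gA_unit //
  mul_gA_row !vec4E => -[v0 [h1 h2]].
Qed.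

Lemma pb_gB_axis01 : pb (gB K) (axis 0 1) = axis 0 2.
Proof.
by apply/seteqP; split=> v; rewrite /pb /coord_line /= mulmx_unit_neq0 ?gB_unit //
  mul_gB_row !vec4E.
Qed.

(** This conic lies in the plane x3 = 0 and avoids the apex (0 : 0 : 0 : 1); [conicB] lies in the
    plane x1 + x2 = 0 and passes through it. That distinguishes the first two cases. *)
Definition conicA : set 'rV[K]_4 := pb (gA K) (@std_conic K).
Definition conicB : set 'rV[K]_4 := pb (gB K) (@std_conic K).

Lemma conicAE v : conicA v <-> v != 0 /\ (v 0 3 = 0 /\ v 0 2 * - v 0 1 = v 0 0 * v 0 0).
Proof. by rewrite /conicA /pb /std_conic /= mulmx_unit_neq0 ?gA_unit // mul_gA_row !vec4E. Qed.

Lemma conicBE v : conicB v <->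
  v != 0 /\ (v 0 1 + v 0 2 = 0 /\ v 0 0 * - v 0 3 = v 0 2 * v 0 2).
Proof. by rewrite /conicB /pb /std_conic /= mulmx_unit_neq0 ?gB_unit // mul_gB_row !vec4E. Qed.

Lemma pb_gsw_conicA : pb (gsw K) conicA = conicA.
Proof.
apply/seteqP; split=> v; rewrite /pb /= => /conicAE H; apply/conicAE; move: H;
  rewrite mulmx_unit_neq0 ?gsw_unit // mul_gsw_row !vec4E => -[v0 [h1 h2]];
  by split=> //; split=> //; rewrite -h2; ring.
Qed.

Lemma pb_gsw_conicB : pb (gsw K) conicB = conicB.
Proof.
apply/seteqP; split=> v; rewrite /pb /= => /conicBE H; apply/conicBE; move: H;
  rewrite mulmx_unit_neq0 ?gsw_unit // mul_gsw_row !vec4E => -[v0 [h1 h2]];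
  (split=> //; split; first by rewrite addrC);
  move/eqP: h1; rewrite addr_eq0 => /eqP h1; by rewrite h2 h1; ring.
Qed.

Lemma axis_neq (i j k l : 'I_4) m : m != i -> m != j -> (m == k) || (m == l) -> axis i j <> axis k l.
Proof.
move=> mi mj mkl E; have : axis i j (e4 K m).
  split; first exact: e4_neq0.
  by rewrite !e4E eq_sym (negPf mi) eq_sym (negPf mj).
rewrite E => -[_]; rewrite !e4E => -[hk hl].
by case/orP: mkl => /eqP E'; [move: hk|move: hl]; rewrite E' eqxx => /eqP; rewrite oner_eq0.
Qed.

Lemma axis01_02 : axis 0 1 <> axis 0 2. Proof. exact: (@axis_neq _ _ _ _ 2). Qed.
Lemma axis13_02 : axis 1 3 <> axis 0 2. Proof. exact: (@axis_neq _ _ _ _ 2). Qed.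
Lemma axis13_01 : axis 1 3 <> axis 0 1. Proof. exact: (@axis_neq _ _ _ _ 0). Qed.
Lemma axis13_23 : axis 1 3 <> axis 2 3. Proof. exact: (@axis_neq _ _ _ _ 2). Qed.
Lemma axis23_02 : axis 2 3 <> axis 0 2. Proof. exact: (@axis_neq _ _ _ _ 0). Qed.
Lemma axis23_01 : axis 2 3 <> axis 0 1. Proof. exact: (@axis_neq _ _ _ _ 0). Qed.

Definition apex : set 'rV[K]_4 := point_of (vec4 0 0 0 1).

Lemma axis_meet : apex = axis 0 1 `&` axis 0 2.
Proof.
apply/seteqP; split=> v.
  move=> [a a0 ->]; rewrite vec4Z !mulr0 mulr1; split; split; rewrite ?vec4E //;
  by rewrite vec4_eq0 (negPf a0) !andbF.
move=> [[v0 [h0 h1]] [_ [_ h2]]]; exists (v 0 3).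
  apply: contraNneq v0 => h3; apply/eqP; by apply: eq_vec4; rewrite mxE.
by rewrite vec4Z !mulr0 mulr1 [LHS]vec4_eta h0 h1 h2.
Qed.

Lemma is_point_apex : is_point apex.
Proof. by apply/is_pointP; exists (vec4 0 0 0 1); rewrite ?vec4_eq0 ?oner_eq0 ?andbF. Qed.

Lemma is_line02 : is_line (axis 0 2).
Proof. by rewrite -pb_gsw_axis01; apply: is_flat_pb; [exact: gsw_unit|exact: is_line01]. Qed.

Lemma is_line13 : is_line (axis 1 3).
Proof. by rewrite -pb_gsw_axis23; apply: is_flat_pb; [exact: gsw_unit|exact: is_line23]. Qed.

Lemma cong_nfA1_swap : cong (@nfA1 K) 1 = pbp (gsw K) (cong (@nfA1 K) 0).
Proof. by have [] := @cong_swap K _ (@nfA1 K) (nf_swap 0 0 0 0 1 0 0 1). Qed.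

Lemma cong_nfA0_swap : cong (@nfA0 K) 1 = pbp (gsw K) (cong (@nfA0 K) 0).
Proof. by have [] := @cong_swap K _ (@nfA0 K) (nf_swap 0 0 0 0 0 0 0 1). Qed.

Lemma cong_nfB1_swap : cong (@nfB1 K) 1 = pbp (gsw K) (cong (@nfB1 K) 0).
Proof. by have [] := @cong_swap K _ (@nfB1 K) (nf_swap 0 0 0 1 0 1 1 0). Qed.

Lemma cong_nfB3_swap : cong (@nfB3 K) 1 = pbp (gsw K) (cong (@nfB3 K) 0).
Proof. by have [] := @cong_swap K _ (@nfB3 K) (nf_swap 0 0 0 1 1 0 0 0). Qed.

Lemma focal_curves_nfA1 : focal_curves (cong (@nfA1 K) 0) = [set axis 0 2; conicA] /\
  focal_curves (cong (@nfA1 K) 1) = [set axis 0 1; conicA].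
Proof.
have S : focal_curves (cong (@nfA1 K) 0) = [set axis 0 2; conicA].
  rewrite congS_nfA1 focal_curves_pb ?gA_unit // -pb_gA_axis01.
  by apply: pb_set2; [exact: gA_unit|exact: focal_curves_scroll].
split=> //; rewrite cong_nfA1_swap focal_curves_pb ?gsw_unit // -pb_gsw_axis02 -{1}pb_gsw_conicA.
by apply: pb_set2 => //; exact: gsw_unit.
Qed.

Lemma focal_curves_nfB1 : focal_curves (cong (@nfB1 K) 0) = [set axis 0 2; conicB] /\
  focal_curves (cong (@nfB1 K) 1) = [set axis 0 1; conicB].
Proof.
have S : focal_curves (cong (@nfB1 K) 0) = [set axis 0 2; conicB].
  rewrite congS_nfB1 focal_curves_pb ?gB_unit // -pb_gB_axis01.
  by apply: pb_set2; [exact: gB_unit|exact: focal_curves_scroll].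
split=> //; rewrite cong_nfB1_swap focal_curves_pb ?gsw_unit // -pb_gsw_axis02 -{1}pb_gsw_conicB.
by apply: pb_set2 => //; exact: gsw_unit.
Qed.

Lemma focal_lines_nfA0 : focal_lines (cong (@nfA0 K) 0) = [set axis 0 2; axis 1 3] /\
  focal_lines (cong (@nfA0 K) 1) = [set axis 0 1; axis 2 3].
Proof.
have S : focal_lines (cong (@nfA0 K) 0) = [set axis 0 2; axis 1 3].
  rewrite congS_nfA0 focal_lines_pb ?gsw_unit // -pb_gsw_axis01 -pb_gsw_axis23.
  by apply: pb_set2; [exact: gsw_unit|exact: focal_lines_skew_join].
split=> //; rewrite cong_nfA0_swap focal_lines_pb ?gsw_unit // -pb_gsw_axis02 -pb_gsw_axis13.
by apply: pb_set2 => //; exact: gsw_unit.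
Qed.

Lemma focal_lines_nfB2 : focal_lines (cong (@nfB2 K) 0) = [set axis 0 2; axis 1 3].
Proof.
rewrite congS_nfB2 focal_lines_pb ?gsw_unit // -pb_gsw_axis01 -pb_gsw_axis23.
by apply: pb_set2; [exact: gsw_unit|exact: focal_lines_skew_join].
Qed.

Lemma focal_lines_nfB3 : focal_lines (cong (@nfB3 K) 0) = [set axis 0 2] /\
  focal_lines (cong (@nfB3 K) 1) = [set axis 0 1].
Proof.
have S : focal_lines (cong (@nfB3 K) 0) = [set axis 0 2].
  rewrite congS_nfB3 focal_lines_pb ?gsw_unit // -pb_gsw_axis01.
  by apply: pb_set1; [exact: gsw_unit|exact: focal_lines_tangent_cone].
split=> //; rewrite cong_nfB3_swap focal_lines_pb ?gsw_unit // -pb_gsw_axis02.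
by apply: pb_set1 => //; exact: gsw_unit.
Qed.

End ConicsInCoordinates.

(** * The five cases, and their transport by real coordinate changes *)

Section Classified.
Variable R : realType.
Local Notation C := R[i].
Local Notation axis := (@coord_line C).

(** The five cases as a property of a pair of congruences: it can be checked on the normal forms and
    carried to the given map by one real matrix. *)
Definition classified_with (S T : set 'rV[C]_6) (a b O c : set 'rV[C]_4) : Prop :=
  [/\ is_line a, is_line b, a <> b, is_point O /\ O = a `&` b & is_plane_conic c] /\
  [\/ [/\ smooth_plane_conic c, ~ (O `<=` c),
          quadratic S /\ focal_curves S = [set b; c] &
          quadratic T /\ focal_curves T = [set a; c]],
      [/\ smooth_plane_conic c, O `<=` c,
          quadratic S /\ focal_curves S = [set b; c] &
          quadratic T /\ focal_curves T = [set a; c]],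
      (exists x y : set 'rV[C]_4,
         [/\ is_line x, is_line y, c = x `|` y &
             [/\ x <> y, x <> a, x <> b, y <> a & y <> b]] /\
         [/\ hyperbolic_linear S /\ focal_lines S = [set b; x] &
             hyperbolic_linear T /\ focal_lines T = [set a; y]]) |
      (exists x : set 'rV[C]_4,
         [/\ is_line x, c = x `|` a,
             hyperbolic_linear S /\ focal_lines S = [set b; x] &
             [/\ parabolic_linear T, focal_lines T = [set a] & double_focal_line T a]]) \/
      [/\ c = b `|` a,
          [/\ parabolic_linear S, focal_lines S = [set b] & double_focal_line S b] &
          [/\ parabolic_linear T, focal_lines T = [set a] & double_focal_line T a]]].

Definition classified (S T : set 'rV[C]_6) : Prop :=
  exists a b O c, classified_with S T a b O c.

Lemma classified_pb (g : 'M[R]_4) S T : g \in unitmx ->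
  classified S T -> classified (pbp (cmx g) S) (pbp (cmx g) T).
Proof.
move=> ug [a [b [O [c [[la lb ab [ptO OE] pc] H]]]]].
have ucg : cmx g \in unitmx by rewrite cmx_unit.
exists (pb (cmx g) a), (pb (cmx g) b), (pb (cmx g) O), (pb (cmx g) c).
have nn (x y : set 'rV[C]_4) : x <> y -> pb (cmx g) x <> pb (cmx g) y.
  by move=> xy /(pb_inj ucg).
have fc X x y : focal_curves X = [set x; y] ->
    focal_curves (pbp (cmx g) X) = [set pb (cmx g) x; pb (cmx g) y].
  by move=> E; rewrite focal_curves_pb // (pb_set2 ucg E).
have fl2 X x y : focal_lines X = [set x; y] ->
    focal_lines (pbp (cmx g) X) = [set pb (cmx g) x; pb (cmx g) y].
  by move=> E; rewrite focal_lines_pb // (pb_set2 ucg E).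
have fl1 X x : focal_lines X = [set x] ->
    focal_lines (pbp (cmx g) X) = [set pb (cmx g) x].
  by move=> E; rewrite focal_lines_pb // (pb_set1 ucg E).
have par X x : [/\ parabolic_linear X, focal_lines X = [set x] & double_focal_line X x] ->
    [/\ parabolic_linear (pbp (cmx g) X), focal_lines (pbp (cmx g) X) = [set pb (cmx g) x]
      & double_focal_line (pbp (cmx g) X) (pb (cmx g) x)].
  by move=> [h1 h2 h3]; split; [exact: parabolic_pb|exact: fl1|exact: double_focal_pb].
have hyp X x y : hyperbolic_linear X /\ focal_lines X = [set x; y] ->
    hyperbolic_linear (pbp (cmx g) X) /\
    focal_lines (pbp (cmx g) X) = [set pb (cmx g) x; pb (cmx g) y].
  by move=> [h1 h2]; split; [exact: hyperbolic_pb|exact: fl2].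
have qua X x y : quadratic X /\ focal_curves X = [set x; y] ->
    quadratic (pbp (cmx g) X) /\
    focal_curves (pbp (cmx g) X) = [set pb (cmx g) x; pb (cmx g) y].
  by move=> [h1 h2]; split; [exact: quadratic_pb|exact: fc].
split.
  split; [exact: is_flat_pb|exact: is_flat_pb|exact: nn| |exact: plane_conic_pb].
  by split; [exact: is_flat_pb|rewrite OE].
case: H => [[h1 h2 h3 h4]|[h1 h2 h3 h4]|[x [y [[lx ly cE [n1 n2 n3 n4 n5]] [h1 h2]]]]|[[x [lx cE h1 h2]]|[cE h1 h2]]].
- apply: Or41; split; [exact: smooth_conic_pb| |exact: qua|exact: qua].
  by move=> /(pb_subE _ _ ucg).
- apply: Or42; split; [exact: smooth_conic_pb| |exact: qua|exact: qua].
  exact: pb_sub.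
- apply: Or43; exists (pb (cmx g) x), (pb (cmx g) y); split.
    split; [exact: is_flat_pb|exact: is_flat_pb|by rewrite cE|].
    by split; exact: nn.
  by split; exact: hyp.
- apply: Or44; left; exists (pb (cmx g) x).
  by split; [exact: is_flat_pb|rewrite cE|exact: hyp|exact: par].
- by apply: Or44; right; split; [rewrite cE|exact: par|exact: par].
Qed.

Lemma cmx_lin4 (r0 r1 r2 r3 : 'rV[R]_4) :
  cmx (lin4 r0 r1 r2 r3) = lin4 (cmx r0) (cmx r1) (cmx r2) (cmx r3).
Proof.
by apply/row_matrixP => i; rewrite /cmx -map_row !rowK; move: i; apply: forall_I4.
Qed.

Lemma cmx_vec4 (a b c d : R) : cmx (vec4 a b c d) = vec4 (real_complex R a) (real_complex R b) (real_complex R c) (real_complex R d).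
Proof. by apply: eq_vec4; rewrite !mxE. Qed.

Lemma cmx_gA : cmx (gA R) = gA C.
Proof. by rewrite /gA cmx_lin4 !cmx_vec4 !(rmorph0, rmorph1, rmorphN1). Qed.

Lemma cmx_gB : cmx (gB R) = gB C.
Proof. by rewrite /gB cmx_lin4 !cmx_vec4 !(rmorph0, rmorph1, rmorphN1). Qed.

Lemma cmx_gsw : cmx (gsw R) = gsw C.
Proof. by rewrite /gsw cmx_lin4 !cmx_vec4 !(rmorph0, rmorph1). Qed.

Lemma apex_axes : is_point (@apex C) /\ @apex C = axis 0 1 `&` axis 0 2.
Proof. by split; [exact: is_point_apex|exact: axis_meet]. Qed.

Lemma quadratic_scroll_pb (g : 'M[R]_4) : g \in unitmx ->
  quadratic (pbp (cmx g) (@cubic_scroll C)).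
Proof. by move=> ug; apply: quadratic_pb => //; apply: quadratic_cubic_scroll; exact: plane_conic_std. Qed.

Lemma quadratic_nfA1 : quadratic (cong (@nfA1 C) 0) /\ quadratic (cong (@nfA1 C) 1).
Proof.
have S : quadratic (cong (@nfA1 C) 0).
  by rewrite congS_nfA1 -cmx_gA; apply: quadratic_scroll_pb; exact: gA_unit.
split=> //; rewrite cong_nfA1_swap -cmx_gsw; apply: quadratic_pb => //; exact: gsw_unit.
Qed.

Lemma quadratic_nfB1 : quadratic (cong (@nfB1 C) 0) /\ quadratic (cong (@nfB1 C) 1).
Proof.
have S : quadratic (cong (@nfB1 C) 0).
  by rewrite congS_nfB1 -cmx_gB; apply: quadratic_scroll_pb; exact: gB_unit.
split=> //; rewrite cong_nfB1_swap -cmx_gsw; apply: quadratic_pb => //; exact: gsw_unit.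
Qed.

Lemma hyperbolic_gsw : hyperbolic_linear (pbp (gsw C) (@skew_join C)).
Proof.
by rewrite -cmx_gsw; apply: hyperbolic_pb; [exact: gsw_unit|exact: hyperbolic_skew_join].
Qed.

Lemma parabolic_gsw : parabolic_linear (pbp (gsw C) (@tangent_cone C)).
Proof.
by rewrite -cmx_gsw; apply: parabolic_pb; [exact: gsw_unit|exact: parabolic_tangent_cone].
Qed.

Lemma classified_nfA1 : classified (cong (@nfA1 C) 0) (cong (@nfA1 C) 1).
Proof.
exists (axis 0 1), (axis 0 2), (@apex C), (@conicA C); split.
  split; [exact: is_line01|exact: is_line02|exact: axis01_02|exact: apex_axes|].
  by apply: plane_conic_pb; [exact: gA_unit|exact: plane_conic_std].
have [S T] := focal_curves_nfA1 C; have [qS qT] := quadratic_nfA1.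
apply: Or41; split=> //; first by apply: smooth_conic_pb; [exact: gA_unit|exact: smooth_std_conic].
move=> /(_ (vec4 0 0 0 1)); case/(_ _)/conicAE.
  by exists 1; rewrite ?oner_eq0 ?scale1r.
by move=> _ []; rewrite vec4E => /eqP; rewrite oner_eq0.
Qed.

Lemma classified_nfB1 : classified (cong (@nfB1 C) 0) (cong (@nfB1 C) 1).
Proof.
exists (axis 0 1), (axis 0 2), (@apex C), (@conicB C); split.
  split; [exact: is_line01|exact: is_line02|exact: axis01_02|exact: apex_axes|].
  by apply: plane_conic_pb; [exact: gB_unit|exact: plane_conic_std].
have [S T] := focal_curves_nfB1 C; have [qS qT] := quadratic_nfB1.
apply: Or42; split=> //; first by apply: smooth_conic_pb; [exact: gB_unit|exact: smooth_std_conic].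
move=> _ [a a0 ->]; apply/conicBE; rewrite vec4Z !vec4E !mulr0 mulr1 addr0 mul0r.
by rewrite vec4_eq0 (negPf a0) !andbF.
Qed.

Lemma classified_nfA0 : classified (cong (@nfA0 C) 0) (cong (@nfA0 C) 1).
Proof.
exists (axis 0 1), (axis 0 2), (@apex C), (axis 3 1 `|` axis 3 2).
have sym i j : axis i j = axis j i.
  by apply/seteqP; split=> v [v0 [h1 h2]]; split.
split.
  split; [exact: is_line01|exact: is_line02|exact: axis01_02|exact: apex_axes|].
  exact: (@plane_conic_axes _ _ _ _ 0).
have [S T] := focal_lines_nfA0 C.
have hS : hyperbolic_linear (cong (@nfA0 C) 0) by rewrite congS_nfA0; exact: hyperbolic_gsw.
have hT : hyperbolic_linear (cong (@nfA0 C) 1).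
  by rewrite cong_nfA0_swap -cmx_gsw; apply: hyperbolic_pb => //; exact: gsw_unit.
apply: Or43; exists (axis 1 3), (axis 2 3); split; last by [].
split; [exact: is_line13|exact: is_line23|by rewrite (sym 1) (sym 2)|].
by split; [exact: axis13_23|exact: axis13_01|exact: axis13_02|exact: axis23_01|exact: axis23_02].
Qed.

Lemma classified_nfB2 : classified (cong (@nfB2 C) 0) (cong (@nfB2 C) 1).
Proof.
(* The component y of the conic has moved into a = [axis 0 1]; both components lie in the plane x1 =
   0. *)
exists (axis 0 1), (axis 0 2), (@apex C), (axis 1 3 `|` axis 1 0).
have sym i j : axis i j = axis j i.
  by apply/seteqP; split=> v [v0 [h1 h2]]; split.
split.
  split; [exact: is_line01|exact: is_line02|exact: axis01_02|exact: apex_axes|].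
  exact: (@plane_conic_axes _ _ _ _ 2).
apply: Or44; left; exists (axis 1 3); split.
- exact: is_line13.
- by rewrite (sym 1 0).
- by split; [rewrite congS_nfB2; exact: hyperbolic_gsw|exact: focal_lines_nfB2].
rewrite congT_nfB2; split; [exact: parabolic_tangent_cone|exact: focal_lines_tangent_cone|].
exact: double_focal_tangent_cone.
Qed.

Lemma classified_nfB3 : classified (cong (@nfB3 C) 0) (cong (@nfB3 C) 1).
Proof.
exists (axis 0 1), (axis 0 2), (@apex C), (axis 0 2 `|` axis 0 1); split.
  split; [exact: is_line01|exact: is_line02|exact: axis01_02|exact: apex_axes|].
  exact: (@plane_conic_axes _ _ _ _ 3).
have [S T] := focal_lines_nfB3 C.
have dS : double_focal_line (cong (@nfB3 C) 0) (axis 0 2).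
  rewrite congS_nfB3 -pb_gsw_axis01; apply: double_focal_pb; first exact: gsw_unit.
  exact: double_focal_tangent_cone.
have pS : parabolic_linear (cong (@nfB3 C) 0) by rewrite congS_nfB3; exact: parabolic_gsw.
apply: Or44; right; split=> //; split=> //; rewrite cong_nfB3_swap.
  by rewrite -cmx_gsw; apply: parabolic_pb => //; exact: gsw_unit.
by rewrite -pb_gsw_axis02; apply: double_focal_pb => //; exact: gsw_unit.
Qed.

End Classified.

(** * The focal point of the u-lines *)

Section FocalPoint.
Variable K : numFieldType.
Variables d00 d10 d01 d11 e00 e10 e01 e11 : K.
Local Notation phi := (nf d00 d10 d01 d11 e00 e10 e01 e11).

Definition nfUA (x : 'M[K]_(3, 2)) : 'rV[K]_4 :=
  vec4 (x 0 0 * x 1 0) (x 0 1 * x 1 0) (x 0 0 * x 1 1)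
   (d00 * (x 0 0 * x 1 0) + d10 * (x 0 1 * x 1 0)
             + d01 * (x 0 0 * x 1 1) + d11 * (x 0 1 * x 1 1)).
Definition nfUB (x : 'M[K]_(3, 2)) : 'rV[K]_4 :=
  vec4 0 0 0 (e00 * (x 0 0 * x 1 0) + e10 * (x 0 1 * x 1 0)
             + e01 * (x 0 0 * x 1 1) + e11 * (x 0 1 * x 1 1)).

Lemma nfUE x : phi x = x 2 0 *: nfUA x + x 2 1 *: nfUB x.
Proof. by rewrite vec4_lin; congr vec4; ring. Qed.

Lemma nfUA_row x y : (forall l, l != 2 -> row l y = row l x) -> nfUA y = nfUA x.
Proof. by move=> xy; rewrite /nfUA !(row_entry _ (xy 0 isT)) !(row_entry _ (xy 1 isT)). Qed.

Lemma nfUB_row x y : (forall l, l != 2 -> row l y = row l x) -> nfUB y = nfUB x.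
Proof. by move=> xy; rewrite /nfUB !(row_entry _ (xy 0 isT)) !(row_entry _ (xy 1 isT)). Qed.

Definition apex_star : set 'rV[K]_6 :=
  [set w : 'rV[K]_6 | w != 0 /\ (w 0 0 = 0 /\ (w 0 1 = 0 /\ w 0 3 = 0))].

Lemma congU_sub : cong phi 2 `<=` apex_star.
Proof.
apply: (cong_sub nfUE nfUA_row nfUB_row).
  by do !apply: zclosed_and; exact: zclosed_coord0.
by move=> x _ w0; split=> //; rewrite wedge_vec4 !vec6E; do !split; ring.
Qed.

Lemma meets_apex_star : meets_all (@apex K) apex_star.
Proof.
move=> w [w0 [h0 [h1 h3]]].
apply: (@meets_wedge _ _ _ (vec4 0 0 0 1) (vec4 (- w 0 2) (- w 0 4) (- w 0 5) 0)) => //.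
- by exists 1; rewrite ?oner_eq0 ?scale1r.
- by rewrite vec4_eq0 oner_eq0 !andbF.
- by rewrite [LHS]vec6_eta h0 h1 h3 wedge_vec4; congr vec6; ring.
Qed.

(** The two hypotheses say that e does not vanish at s = (1 : 1) with t = (1 : 1) and with t = (1 :
    2). Both parameters then give true u-lines, and these meet only at the apex. *)
Lemma focal_points_nf : e00 + e10 + e01 + e11 != 0 ->
  e00 + e10 + 2 * e01 + 2 * e11 != 0 -> focal_points (cong phi 2) = [set @apex K].
Proof.
move=> nz1 nz2; have o1 : (1 : K) != 0 by exact: oner_neq0.
have mapex : meets_all (@apex K) (cong phi 2) by move=> w /congU_sub; exact: meets_apex_star.
have apex_nz : vec4 0 0 0 1 != 0 :> 'rV[K]_4 by rewrite vec4_eq0 oner_eq0 !andbF.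
apply/seteqP; split=> V /=; last first.
  move=> ->; split; first exact: is_point_apex.
  split=> //; first exact: variety_point.
  move=> W [cW [v Wv] _] [WV nVW] _; apply: nVW => _ [a a0 ->].
  have [b b0 vE] := WV v Wv; apply: zclosed_scale => //.
  by apply/(zclosed_scaleE _ cW b0); rewrite -vE.
move=> [/is_pointP[p p0 ->] [_ mp _]].
pose e (t : K) := e00 + e10 + t * e01 + t * e11.
have line t : e t != 0 -> exists a b, p = a *: vec4 1 1 t (d00 + d10 + t * d01 + t * d11)
    + b *: vec4 0 0 0 1.
  move=> et; pose x := mk6 1 1 1 t 1 0.
  have AE : nfUA x = vec4 1 1 t (d00 + d10 + t * d01 + t * d11).
    by rewrite /nfUA !mk6E; congr vec4; ring.
  have BE : nfUB x = vec4 0 0 0 (e t) by rewrite /nfUB !mk6E /e; congr vec4; ring.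
  have w0 : wedge (nfUA x) (nfUB x) != 0.
    rewrite AE BE wedge_vec4 !mulr0 !mul1r ?mul0r ?subr0 vec6_eq0 (negPf et).
    by rewrite !andbF.
  have xP : in_P1x3 x by apply: in_P1x3_mk6; rewrite oner_eq0.
  have [v [[a a0 vE] /line_wedge_mem[]// v0 [b [c vE']]]] :=
    mp _ (cong_mem nfUE nfUA_row nfUB_row xP w0).
  exists (b / a), (c * e t / a).
  have -> : p = a^-1 *: v by rewrite vE scalerA mulVf // scale1r.
  rewrite vE' AE BE !vec4_lin vec4Z; congr vec4; by field.
have [a [b E1]] := line 1 ltac:(by rewrite /e !mul1r).
have [c [d E2]] := line 2 ltac:(by []).
(* Coordinates 0 and 2 give [a = c] and [a = 2 c]. *)
have a0 : a = 0.
  have := congr1 (fun v : 'rV_4 => v 0 0) E1; rewrite {1}E2 !vec4_lin !vec4E !mulr1 !mulr0 !addr0 => ac.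
  have := congr1 (fun v : 'rV_4 => v 0 2) E1; rewrite {1}E2 !vec4_lin !vec4E !mulr1 !mulr0 !addr0 ac.
  by move=> /eqP; rewrite mulr_natr mulr2n -subr_eq0 addrK => /eqP.
rewrite E1 a0 scale0r add0r in p0 *.
have b0 : b != 0 by apply: contraNneq p0 => ->; rewrite scale0r.
apply/seteqP; split=> v [k k0 ->].
  by exists (k * b); rewrite ?mulf_neq0 // scalerA.
by exists (k / b); rewrite ?mulf_neq0 ?invr_eq0 // scalerA mulfVK.
Qed.

End FocalPoint.

(** * Birational maps of type (1,1,2) *)

Section TrilinearForms.
Variable K : fieldType.

Definition coefv (w : 'rV[K]_ncoef) (j : multi_index) : 'rV[K]_4 := \row_i coef w i j.

Lemma tri_mapE (w : 'rV[K]_ncoef) (x : 'M[K]_(3, 2)) :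
  tri_map w x = \sum_(j : multi_index) (\prod_(k < 3) x k (j k)) *: coefv w j.
Proof.
apply/rowP => i; rewrite mxE /tri_poly evalv_sum summxE; apply: eq_bigr => j _.
rewrite evalvZ !mxE mulrC; congr (_ * _).
rewrite /evalv rmorph_prod /=; apply: eq_bigr => k _.
by rewrite mevalXU mxvecE.
Qed.

Definition index3 (a b c : 'I_2) : multi_index := [ffun k => tnth [tuple a; b; c] k].

Definition tcoef (w : 'rV[K]_ncoef) (a b c : 'I_2) : 'rV[K]_4 := coefv w (index3 a b c).

Lemma tri_map_sum (w : 'rV[K]_ncoef) (x : 'M[K]_(3, 2)) :
  tri_map w x = \sum_a \sum_b \sum_c (x 0 a * x 1 b * x 2 c) *: tcoef w a b c.
Proof.
rewrite tri_mapE.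
rewrite (reindex (fun p : 'I_2 * 'I_2 * 'I_2 => index3 p.1.1 p.1.2 p.2)); last first.
  exists (fun j : multi_index => (j 0, j 1, j 2)) => [[[a b] c] _|j _] /=.
    by rewrite !ffunE.
  by apply/ffunP => k; rewrite ffunE; move: k; apply: forall_I3.
rewrite -(pair_bigA _ (fun p c => (\prod_(k < 3) x k (index3 p.1 p.2 c k)) *: coefv w (index3 p.1 p.2 c))) /=.
rewrite -(pair_bigA _ (fun a b => \sum_c (\prod_(k < 3) x k (index3 a b c k)) *: coefv w (index3 a b c))) /=.
apply: eq_bigr => a _; apply: eq_bigr => b _; apply: eq_bigr => c _; congr (_ *: _).
rewrite !big_ord_recl big_ord0 mulr1 !ffunE mulrA.
by congr (_ * _ * _); congr (x _ _); apply: val_inj.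
Qed.

Lemma sum_I2 (V : nmodType) (F : 'I_2 -> V) : \sum_i F i = F 0 + F 1.
Proof.
by rewrite !big_ord_recl big_ord0 addr0; congr (F _ + F _); apply: val_inj.
Qed.

Lemma eval_subst_tri (w : 'rV[K]_ncoef) p (x : 'M[K]_(3, 2)) :
  evalv (subst_tri w p) (mxvec x) = evalv p (tri_map w x).
Proof.
by rewrite /evalv comp_mpoly_meval; apply: meval_eq => i; rewrite tnth_mktuple mxE.
Qed.

Definition dot (v X : 'rV[K]_4) : K := \sum_i v 0 i * X 0 i.

Lemma dotZl a v X : dot (a *: v) X = a * dot v X.
Proof. by rewrite mulr_sumr; apply: eq_bigr => i _; rewrite mxE mulrA. Qed.

Lemma dotDr v X Y : dot v (X + Y) = dot v X + dot v Y.
Proof. by rewrite -big_split; apply: eq_bigr => i _; rewrite mxE mulrDr. Qed.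

Lemma dotZr a v X : dot v (a *: X) = a * dot v X.
Proof. by rewrite mulr_sumr; apply: eq_bigr => i _; rewrite mxE mulrCA. Qed.

Lemma dot_sum (I : Type) (r : seq I) (P : pred I) (F : I -> 'rV[K]_4) X :
  dot (\sum_(i <- r | P i) F i) X = \sum_(i <- r | P i) dot (F i) X.
Proof.
rewrite /dot exchange_big /=; apply: eq_bigr => i _.
by rewrite summxE mulr_suml.
Qed.

Definition linear_form (X : 'rV[K]_4) : {mpoly K[4]} := \sum_i X 0 i *: 'X_i.

Lemma eval_linear_form X v : evalv (linear_form X) v = dot v X.
Proof. by rewrite evalv_sum; apply: eq_bigr => i _; rewrite evalvZ evalvX mulrC. Qed.

Lemma dhomog_linear_form X : linear_form X \is 1.-homog.
Proof. by apply: rpred_sum => i _; apply: rpredZ; rewrite dhomogX /= mdeg1. Qed.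

Lemma linear_formP (F : {mpoly K[4]}) : F \is 1.-homog ->
  exists X, forall v, evalv F v = dot v X.
Proof.
move=> /dhomogP hF; exists (\row_i F@_U_(i)) => v; rewrite /evalv mevalE.
pose idx (m : 'X_{1..4}) : option 'I_4 := [pick i | m == U_(i)%MM].
have mE m : m \in msupp F -> exists i, m = U_(i)%MM.
  move=> /hF /= /eqP; rewrite mdegE => md.
  have [i mi] : exists i, m i != 0%N.
    apply: contrapT => nex; move: md; rewrite big1 // => i _.
    by apply: contrapT => /eqP mi; apply: nex; exists i.
  exists i; apply/mnmP => j; rewrite mnm1E.
  move: md; rewrite (bigD1 i) //=; have [<-|ji] := eqVneq i j.
    by move: mi; case: (m i) => [|[|k]] // _; rewrite addSn => /eqP [].
  rewrite (bigD1 j) /=; last by rewrite eq_sym.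
  by move: mi; case: (m i) => [|[|k]] // _; rewrite ?addSn //; case: (m j).
transitivity (\sum_(m <- msupp F) \sum_i (if m == U_(i)%MM then F@_U_(i) * v 0 i else 0)).
  rewrite big_seq [RHS]big_seq; apply: eq_bigr => m mF; have [i ->] := mE m mF.
  rewrite [RHS](bigD1 i) //= eqxx [X in _ + X]big1 ?addr0; last first.
    move=> j ji; case: eqP => // /mnmP/(_ j); rewrite !mnm1E eqxx.
    by rewrite eq_sym (negPf ji).
  congr (_ * _); rewrite (bigD1 i) //= mnm1E eqxx expr1 big1 ?mulr1 // => j ji.
  by rewrite mnm1E eq_sym (negPf ji) expr0.
rewrite exchange_big /=; apply: eq_bigr => i _; rewrite !mxE.
have [iF|iF] := boolP (U_(i)%MM \in msupp F); last first.
  rewrite (memN_msupp_eq0 iF) mulr0 big_seq big1 // => m mF.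
  by case: eqP => // mE'; rewrite -mE' mF in iF.
rewrite (bigD1_seq U_(i)%MM) ?msupp_uniq //= eqxx big1 ?addr0; first by rewrite mulrC.
by move=> m /negPf ->.
Qed.

End TrilinearForms.

Lemma mxvec_pair (K : fieldType) (x : 'M[K]_(3, 2)) k e : mxvec x 0 (pair_var k e) = x k e.
Proof. exact: mxvecE. Qed.

Lemma evalv_cross (K : fieldType) n (v : 'rV[K]_n) (p q : {mpoly K[n]}) i j :
  p * 'X_i = q * 'X_j -> evalv p v * v 0 i = evalv q v * v 0 j.
Proof. by move=> E; have := congr1 (fun p => evalv p v) E; rewrite !evalvM !evalvX. Qed.

(** * From the complex inverse to real pencils *)

Section Birational.
Variable R : realType.
Local Notation C := R[i].
Local Notation rc := (real_complex R).
Variable w : 'rV[R]_ncoef.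
Local Notation phi := (tri_map w).

Lemma tri_map_cplx (x : 'M[R]_(3, 2)) : tri_map (cplx w) (cmx x) = cmx (phi x).
Proof.
apply/rowP => i; rewrite !tri_mapE !mxE !summxE rmorph_sum; apply: eq_bigr => j _.
rewrite !mxE rmorphM rmorph_prod; congr (_ * _); last by rewrite /coef mxE.
by apply: eq_bigr => k _; rewrite mxE.
Qed.

Definition natmx (S : pzSemiRingType) (v : 'I_(3 * 2) -> nat) : 'M[S]_(3, 2) :=
  \matrix_(k, e) (v (mxvec_index k e))%:R.

Lemma cmx_natmx v : cmx (natmx R v) = natmx C v.
Proof. by apply/matrixP => i j; rewrite !mxE rmorph_nat. Qed.

(** Natural points come from [R], so a nonzero complex polynomial is already nonzero at some real
    parameter; statements about [cplx w] thereby reach [w]. *)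
Lemma mpoly6_neq0 (p : {mpoly C[3 * 2]}) : p != 0 ->
  exists v, evalv p (mxvec (cmx (natmx R v))) != 0.
Proof.
move=> p0; apply: contrapT => nex; case/negP: p0; apply/eqP; apply: mpoly_nat_eq0 => v.
apply: contrapT => /eqP pv; apply: nex; exists v; rewrite cmx_natmx.
rewrite /evalv (meval_eq (v2 := fun i => (v i)%:R)) // => i.
by case/mxvec_indexP: i => k e; rewrite mxvecE mxE.
Qed.

Section Inverse.
Variable psi : 'M[{mpoly C[4]}]_(3, 2).
Hypothesis psi_inv : rational_inverse (cplx w) psi.
Hypothesis psi_homog : forall k e, psi k e \is (type112 k).-homog.

Lemma psi_eval k (x : 'M[C]_(3, 2)) :
  evalv (psi k 0) (tri_map (cplx w) x) * x k 1 = evalv (psi k 1) (tri_map (cplx w) x) * x k 0.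
Proof.
have [_ /(_ k) /(evalv_cross (mxvec x)) E _ _] := psi_inv.
pose ES e := eval_subst_tri (cplx w) (psi k e) x; pose EX e := mxvec_pair x k e.
exact: etrans (congr2 _ (esym (ES 0)) (esym (EX 1))) (etrans E (congr2 _ (ES 1) (EX 0))).
Qed.

Lemma psi_neq0 k : exists e, subst_tri (cplx w) (psi k e) != 0.
Proof. by have [/(_ k)] := psi_inv. Qed.

(** With [f] the composite of phi after [psi], the vectors [f i0 (v) v] and [v i0 f(v)] agree.
    Evaluating [P] on both gives [f i0 ^ d * P = 0], because [P] vanishes on the image of phi. *)
Lemma dominant d (P : {mpoly C[4]}) : P \is d.-homog ->
  subst_tri (cplx w) P = 0 -> P = 0.
Proof.
move=> hP P0; have [_ _ [i0 H0] HE] := psi_inv.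
pose f i := subst_pairs psi (tri_poly (cplx w) i).
suff : f i0 ^+ d * P = 0.
  by move/eqP; rewrite mulf_eq0 expf_eq0 (negPf H0) andbF => /eqP.
apply: mpoly_eval_eq0 => v'; pose v : 'rV[C]_4 := \row_i v' i.
have vE (p : {mpoly C[4]}) : p.@[v'] = evalv p v by apply: meval_eq => i; rewrite mxE.
rewrite vE evalvM evalvXn -evalv_scale //.
have fE i : evalv (f i0) v * v 0 i = evalv (f i) v * v 0 i0.
  exact: evalv_cross (HE i0 i).
have -> : evalv (f i0) v *: v = v 0 i0 *: (\row_i evalv (f i) v).
  by apply/rowP => i; rewrite [LHS]mxE [RHS]mxE fE mulrC; congr (_ * _); rewrite mxE.
rewrite (evalv_scale _ _ hP).
have -> : evalv P (\row_i evalv (f i) v) = 0.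
  have := congr1 (meval (fun z => evalv (mxvec psi 0 z) v)) P0.
  rewrite meval0 comp_mpoly_meval => <-; apply: meval_eq => i.
  rewrite mxE tnth_mktuple /f /subst_pairs /evalv comp_mpoly_meval.
  by apply: meval_eq => z; rewrite tnth_mktuple.
by rewrite mulr0.
Qed.

Lemma Re_dot (v : 'rV[R]_4) (X : 'rV[C]_4) :
  complex.Re (dot (cmx v) X) = dot v (map_mx (@complex.Re R) X) /\
  complex.Im (dot (cmx v) X) = dot v (map_mx (@complex.Im R) X).
Proof.
have ReD (a b : C) : complex.Re (a + b) = complex.Re a + complex.Re b by case: a; case: b.
have ImD (a b : C) : complex.Im (a + b) = complex.Im a + complex.Im b by case: a; case: b.
have ReM r (b : C) : complex.Re (rc r * b) = r * complex.Re b.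
  by case: b => b1 b2 /=; rewrite mul0r subr0.
have ImM r (b : C) : complex.Im (rc r * b) = r * complex.Im b.
  by case: b => b1 b2 /=; rewrite mul0r addr0.
by rewrite /dot !sum_I4 !(ReD, ImD) !mxE !(ReM, ImM).
Qed.

(** At real parameters the relation between [L0] and [L1] has real coefficients, so their real and
    imaginary parts satisfy it separately; at least one of the two is nonzero along phi. *)
Lemma real_pencil k : type112 k = 1%N -> exists L0 L1 : 'rV[R]_4,
  (forall x, dot (phi x) L0 * x k 1 = dot (phi x) L1 * x k 0) /\
  exists x, dot (phi x) L0 != 0 \/ dot (phi x) L1 != 0.
Proof.
move=> k1; have hL e : psi k e \is 1.-homog by have := psi_homog k e; rewrite k1.
have [L0 L0E] := linear_formP (hL 0); have [L1 L1E] := linear_formP (hL 1).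
have eqC x : dot (cmx (phi x)) L0 * rc (x k 1) = dot (cmx (phi x)) L1 * rc (x k 0).
  by have := psi_eval k (cmx x); rewrite tri_map_cplx L0E L1E !mxE.
have ReM (b : C) r : complex.Re (b * rc r) = complex.Re b * r.
  by case: b => b1 b2 /=; rewrite mulr0 subr0.
have ImM (b : C) r : complex.Im (b * rc r) = complex.Im b * r.
  by case: b => b1 b2 /=; rewrite mulr0 add0r.
have eqRe x : dot (phi x) (map_mx (@complex.Re R) L0) * x k 1
            = dot (phi x) (map_mx (@complex.Re R) L1) * x k 0.
  by have := congr1 (@complex.Re R) (eqC x); rewrite !ReM !(Re_dot _ _).1.
have eqIm x : dot (phi x) (map_mx (@complex.Im R) L0) * x k 1
            = dot (phi x) (map_mx (@complex.Im R) L1) * x k 0.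
  by have := congr1 (@complex.Im R) (eqC x); rewrite !ImM !(Re_dot _ _).2.
have [e /mpoly6_neq0[v]] := psi_neq0 k; rewrite eval_subst_tri tri_map_cplx.
set x := natmx R v => nz.
have nzC (z : C) : z != 0 -> complex.Re z != 0 \/ complex.Im z != 0.
  case: z => a b; rewrite eq_complex /= negb_and => /orP[]; [by left|by right].
have : dot (cmx (phi x)) L0 != 0 \/ dot (cmx (phi x)) L1 != 0.
  have : (e == 0) || (e == 1) by case: e {nz} => [[|[|]]].
  by case/orP => /eqP e0; move: nz; rewrite e0 ?L0E ?L1E; [left|right].
case=> /nzC[]; rewrite ?(Re_dot _ _).1 ?(Re_dot _ _).2 => nz'.
- by exists (map_mx (@complex.Re R) L0), (map_mx (@complex.Re R) L1); split=> //; exists x; left.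
- by exists (map_mx (@complex.Im R) L0), (map_mx (@complex.Im R) L1); split=> //; exists x; left.
- by exists (map_mx (@complex.Re R) L0), (map_mx (@complex.Re R) L1); split=> //; exists x; right.
- by exists (map_mx (@complex.Im R) L0), (map_mx (@complex.Im R) L1); split=> //; exists x; right.
Qed.

End Inverse.
End Birational.

Lemma comp_mpolyM (K : comNzRingType) n k (t : n.-tuple {mpoly K[k]}) (p q : {mpoly K[n]}) :
  (p * q) \mPo t = (p \mPo t) * (q \mPo t).
Proof. exact: (rmorphM (comp_mpoly t)). Qed.

(** * Division by a linear form *)

Section LinearDivision.
Variables (K : numFieldType) (c : 'rV[K]_4) (k : 'I_4).
Hypothesis ck : c 0 k != 0.

(** A linear projection onto the hyperplane where [linear_form c] vanishes. A polynomial killed by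
    this substitution is divisible by the linear form, which settles coprimality of linear forms
    without factorization. *)
Definition eliminate : 4.-tuple {mpoly K[4]} :=
  [tuple (if i == k then 'X_k - (c 0 k)^-1 *: linear_form c else 'X_i) | i < 4].

Lemma divides_sub_eliminate (P : {mpoly K[4]}) :
  exists h, P - (P \mPo eliminate) = linear_form c * h.
Proof.
elim/mpoly_ring_ind: P => [a|i|p q [h ph] [h' qh]|p q [h ph] [h' qh]].
- by exists 0; rewrite comp_mpolyC subrr mulr0.
- rewrite comp_mpolyXU -tnth_nth tnth_mktuple; case: eqP => [->|_]; last first.
    by exists 0; rewrite subrr mulr0.
  by exists ((c 0 k)^-1)%:MP; rewrite opprB addrC subrK mulrC mul_mpolyC.
- by exists (h + h'); rewrite comp_mpolyD mulrDr -ph -qh; ring.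
- exists (h * q + (p \mPo eliminate) * h'); rewrite rmorphM /= mulrDr mulrA -ph.
  by rewrite mulrCA -qh; ring.
Qed.

Lemma evalv_eliminate (F : {mpoly K[4]}) v : evalv (F \mPo eliminate) v =
  evalv F (\row_i (if i == k then v 0 k - (c 0 k)^-1 * dot v c else v 0 i)).
Proof.
rewrite /evalv comp_mpoly_meval; apply: meval_eq => i; rewrite tnth_mktuple mxE.
case: eqP => _; last exact: mevalXU.
by rewrite mevalB mevalZ mevalXU -/(evalv _ _) eval_linear_form.
Qed.

Lemma linear_form_eliminate X :
  linear_form X \mPo eliminate = linear_form (X - (X 0 k / c 0 k) *: c).
Proof.
apply/eqP; rewrite -subr_eq0; apply/eqP; apply: mpoly_eval_eq0 => v'.
pose v : 'rV[K]_4 := \row_i v' i.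
have vE (p : {mpoly K[4]}) : p.@[v'] = evalv p v by apply: meval_eq => i; rewrite mxE.
rewrite mevalB !vE evalv_eliminate !eval_linear_form /dot.
rewrite (bigD1 k) //= mxE eqxx [X in _ - X](bigD1 k) //=.
rewrite [X in _ + X - _](eq_bigr (fun i => v 0 i * X 0 i)); last first.
  by move=> i /negPf ik; rewrite mxE ik.
rewrite [X in _ - (_ + X)](eq_bigr (fun i => v 0 i * X 0 i - (X 0 k / c 0 k) * (v 0 i * c 0 i))); last first.
  by move=> i _; rewrite !mxE; ring.
rewrite sumrB -mulr_sumr (bigD1 k) //= !mxE.
by set S := \sum_(i | _) _; set T := \sum_(i | _) _; field.
Qed.

End LinearDivision.

Lemma linear_form_eq0 (K : numFieldType) (X : 'rV[K]_4) : linear_form X = 0 -> X = 0.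
Proof.
move=> E; apply/rowP => i; rewrite mxE.
have := eval_linear_form X (delta_mx 0 i); rewrite E /evalv meval0 /dot (bigD1 i) //= big1.
  by rewrite mxE !eqxx mul1r addr0.
by move=> j /negPf ji; rewrite mxE ji andbF mul0r.
Qed.

(** Modulo [linear_form m0] the cross relation becomes a product equal to zero, in which the residue
    of [m1] is nonzero by independence; hence [u0] is divisible by [linear_form m0]. *)
Lemma linear_forms_coprime (K : numFieldType) (m0 m1 : 'rV[K]_4) (k : 'I_4)
    (u0 u1 : {mpoly K[4]}) : m0 0 k != 0 -> m1 - (m1 0 k / m0 0 k) *: m0 != 0 ->
  u0 * linear_form m1 = u1 * linear_form m0 ->
  exists h, u0 = linear_form m0 * h /\ u1 = linear_form m1 * h.
Proof.
move=> ck ind cross; have [h uh] := divides_sub_eliminate m0 k u0.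
have z0 : linear_form m0 \mPo eliminate m0 k = 0.
  rewrite linear_form_eliminate // mulfV // scale1r subrr.
  by rewrite /linear_form big1 // => i _; rewrite mxE scale0r.
have u0E : u0 \mPo eliminate m0 k = 0.
  have := congr1 (comp_mpoly (eliminate m0 k)) cross.
  rewrite !comp_mpolyM z0 mulr0 linear_form_eliminate // => /eqP.
  rewrite mulf_eq0 => /orP[/eqP //|/eqP/linear_form_eq0 E].
  by rewrite E eqxx in ind.
rewrite u0E subr0 in uh; exists h; split=> //.
have lf0 : linear_form m0 != 0.
  by apply: contraNneq ck => /linear_form_eq0 ->; rewrite mxE.
by apply: (mulIf lf0); rewrite -cross uh; ring.
Qed.

(** * The component of degree 2 of the inverse *)

Section NoLinearInverse.
Variable R : realType.
Local Notation C := R[i].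
Local Notation rc := (real_complex R).
Variable w : 'rV[R]_ncoef.
Local Notation phi := (tri_map w).
Variable psi : 'M[{mpoly C[4]}]_(3, 2).
Hypothesis psi_inv : rational_inverse (cplx w) psi.
Hypothesis psi_homog : forall k e, psi k e \is (type112 k).-homog.
Hypothesis psi_coprime : forall k, no_common_factor (psi k).

Lemma subst_tri_eq0 (p : {mpoly C[4]}) (q : {mpoly C[3 * 2]}) : q != 0 ->
  (forall v, evalv p (cmx (phi (natmx R v))) * evalv q (mxvec (cmx (natmx R v))) = 0) ->
  subst_tri (cplx w) p = 0.
Proof.
move=> q0 H; apply/eqP/negPn/negP => p0.
have /mpoly6_neq0[v] : subst_tri (cplx w) p * q != 0 by rewrite mulf_neq0.
by rewrite evalvM eval_subst_tri tri_map_cplx H eqxx.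
Qed.

Lemma pair_var_neq0 k (a b : C) : (a != 0) || (b != 0) ->
  a *: 'X_(pair_var k 0) + b *: 'X_(pair_var k 1) != 0.
Proof.
move=> ab; apply/eqP => E.
have ev (x : 'M[C]_(3, 2)) : a * x k 0 + b * x k 1 = 0.
  have := congr1 (fun p => evalv p (mxvec x)) E.
  by rewrite evalvD !evalvZ !evalvX !mxvec_pair /evalv meval0.
have := ev (delta_mx k 0); have := ev (delta_mx k 1); rewrite !mxE !eqxx /=.
rewrite !mulr0 !mulr1 addr0 add0r => b0 a0.
by rewrite a0 b0 eqxx in ab.
Qed.

Lemma psi_nat k v (x := natmx R v) :
  evalv (psi k 0) (cmx (phi x)) * rc (x k 1) = evalv (psi k 1) (cmx (phi x)) * rc (x k 0).
Proof. by have := psi_eval psi_inv k (cmx x); rewrite tri_map_cplx !mxE. Qed.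

(** By dominance a linear pair would be proportional to the pair of degree 2. If the linear forms
    are independent, they divide that pair with a common quotient; the quotient is constant by
    coprimality, so a nonzero form would have degrees 1 and 2 at once. *)
Lemma no_linear_inverse (l0 l1 : 'rV[R]_4) :
  (forall x, dot (phi x) l0 * x 2 1 = dot (phi x) l1 * x 2 0) -> l0 = 0 /\ l1 = 0.
Proof.
move=> Hl; pose m0 := cmx l0; pose m1 := cmx l1.
have dotC v (l : 'rV[R]_4) : dot (cmx v) (cmx l) = rc (dot v l).
  by rewrite /dot rmorph_sum; apply: eq_bigr => i _; rewrite !mxE rmorphM.
have HlC x : dot (cmx (phi x)) m0 * rc (x 2 1) = dot (cmx (phi x)) m1 * rc (x 2 0).
  by rewrite /m0 /m1 !dotC -!rmorphM Hl.
(* For a dependent pair the relation becomes a linear form of phi times a nonzero combination of u0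
   and u1; the linear form vanishes along phi and dominance makes it zero. *)
have dep a b : (a != 0) || (b != 0) -> a *: m0 + b *: m1 = 0 -> m0 = 0 /\ m1 = 0.
  move=> ab E; have Ed v : a * dot v m0 + b * dot v m1 = 0.
    by rewrite -!dotZr -dotDr E /dot big1 // => i _; rewrite mxE mulr0.
  have kill (l : 'rV[C]_4) : (forall x, dot (cmx (phi x)) l * (a * rc (x 2 0) + b * rc (x 2 1)) = 0) ->
      l = 0.
    move=> H; apply: linear_form_eq0; apply: (dominant psi_inv (dhomog_linear_form l)).
    apply: (subst_tri_eq0 (pair_var_neq0 2 ab)) => v.
    rewrite eval_linear_form evalvD !evalvZ !evalvX !mxvec_pair !mxE -[RHS](H (natmx R v)).
    by rewrite !mxE.
  split; apply: kill => x.
    transitivity (rc (x 2 0) * (a * dot (cmx (phi x)) m0) + b * (dot (cmx (phi x)) m0 * rc (x 2 1))).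
      by ring.
    rewrite HlC; transitivity (rc (x 2 0) * (a * dot (cmx (phi x)) m0 + b * dot (cmx (phi x)) m1)).
      by ring.
    by rewrite Ed mulr0.
  transitivity (a * (dot (cmx (phi x)) m1 * rc (x 2 0)) + rc (x 2 1) * (b * dot (cmx (phi x)) m1)).
    by ring.
  rewrite -HlC; transitivity (rc (x 2 1) * (a * dot (cmx (phi x)) m0 + b * dot (cmx (phi x)) m1)).
    by ring.
  by rewrite Ed mulr0.
suff [E0 E1] : m0 = 0 /\ m1 = 0.
  by split; apply/eqP; rewrite -(map_mx_eq0 rc); apply/eqP.
have [m00|m00] := eqVneq m0 0.
  by apply: (dep 1 0); rewrite ?oner_eq0 // m00 scaler0 scale0r addr0.
have [k ck] := nonzero_coord m00.
have [E|ind] := eqVneq (m1 - (m1 0 k / m0 0 k) *: m0) 0.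
  apply: (dep (- (m1 0 k / m0 0 k)) 1); first by rewrite oner_eq0 orbT.
  by rewrite scale1r scaleNr addrC.
pose u0 := psi 2 0; pose u1 := psi 2 1.
have cross : u0 * linear_form m1 = u1 * linear_form m0.
  apply/eqP; rewrite -subr_eq0; apply/eqP; apply: (dominant psi_inv (d := 2 + 1)).
    apply: rpredB; apply: dhomogM; try exact: dhomog_linear_form.
      exact: psi_homog.
    exact: psi_homog.
  (* One relation carries the factor u1 and the other u0, so they can be compared after
     multiplication by u0 u1. *)
  have q0 : 'X_(pair_var 2 0) * 'X_(pair_var 2 1) != 0 :> {mpoly C[3 * 2]}.
    have X0 k' e : 'X_(pair_var k' e) != 0 :> {mpoly C[3 * 2]}.
      by apply/eqP => /(congr1 (fun p => p@_U_(pair_var k' e)%MM))/eqP;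
         rewrite mcoeffXU eqxx mcoeff0 oner_eq0.
    by rewrite mulf_neq0.
  apply: (subst_tri_eq0 q0) => v; rewrite /evalv mevalB -!/(evalv _ _) !evalvM !eval_linear_form.
  set x := natmx R v; have cE j : cmx x 2 j = rc (x 2 j) by rewrite mxE.
  have h1 := psi_nat 2 v; have h2 := HlC x; rewrite -/x -/u0 -/u1 in h1.
  rewrite !evalvX !mxvec_pair !cE.
  transitivity ((evalv u0 (cmx (phi x)) * rc (x 2 1)) * (dot (cmx (phi x)) m1 * rc (x 2 0))
    - (evalv u1 (cmx (phi x)) * rc (x 2 0)) * (dot (cmx (phi x)) m0 * rc (x 2 1))).
    by ring.
  by rewrite h1 h2 subrr.
have [h [uh u1h]] := linear_forms_coprime ck ind cross.
have [|kk kk0 hE] := psi_coprime (k := 2) (g := h).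
  move=> e; have : (e == 0) || (e == 1) by case: e => [[|[|]]].
  case/orP => /eqP ->; [exists (linear_form m0)|exists (linear_form m1)].
    by rewrite -/u0 uh mulrC.
  by rewrite -/u1 u1h mulrC.
have h1 : u0 \is 1.-homog.
  by rewrite uh hE mulrC mul_mpolyC; apply: rpredZ; exact: dhomog_linear_form.
have h2 : u0 \is 2.-homog by exact: psi_homog.
have u00 : u0 != 0.
  rewrite uh hE mulf_neq0 // ?mpolyC_eq0 //.
  by apply: contraNneq m00 => /linear_form_eq0 ->.
by have := dhomog_uniq u00 h1 h2.
Qed.

(** If phi vanished on the fibre over [u], adding [u] to the third row would not change phi,
    although the inverse recovers the third factor from the value of phi. *)
Lemma row2_nonconstant (u : 'rV[R]_2) : u != 0 -> exists x, row 2 x = u /\ phi x != 0.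
Proof.
move=> u0; apply: contrapT => nex.
have Hu x : row 2 x = u -> phi x = 0.
  by move=> xu; apply: contrapT => /eqP nz; apply: nex; exists x.
have [e pe] := psi_neq0 psi_inv 2.
(* These are the coefficients of the linear form whose nonvanishing says that the third row is not
   proportional to [u]. *)
have u01 : (rc (u 0 1) != 0) || (- rc (u 0 0) != 0).
  rewrite oppr_eq0 -negb_and; apply: contraNN u0 => /andP[/eqP h1 /eqP h0].
  apply/eqP/rowP => i; rewrite mxE; have : (i == 0) || (i == 1) by case: i => [[|[|]]].
  by case/orP => /eqP ->; apply: (@complexI R); rewrite ?h1 ?h0 rmorph0.
have [v] := mpoly6_neq0 (mulf_neq0 pe (pair_var_neq0 2 u01)).
rewrite evalvM eval_subst_tri tri_map_cplx evalvD !evalvZ !evalvX !mxvec_pair.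
set x := natmx R v; rewrite mulf_eq0 negb_or => /andP[nz1 nz2].
pose z : 'M[R]_(3, 2) := \matrix_(l, j) (if l == 2 then u 0 j else x l j).
pose y : 'M[R]_(3, 2) := \matrix_(l, j) (if l == 2 then x l j + u 0 j else x l j).
have phiy : phi y = phi x.
  have -> : phi y = phi x + phi z.
    rewrite !tri_map_sum -big_split; apply: eq_bigr => a _ /=.
    rewrite -big_split; apply: eq_bigr => b _ /=; rewrite -big_split; apply: eq_bigr => c _ /=.
    by rewrite -scalerDl !mxE /=; congr (_ *: _); ring.
  by rewrite (Hu z) ?addr0 //; apply/rowP => j; rewrite !mxE ?eqxx.
have E1 := psi_eval psi_inv 2 (cmx x); have E2 := psi_eval psi_inv 2 (cmx y).
rewrite !tri_map_cplx phiy in E1 E2.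
set a := evalv (psi 2 0) _ in E1 E2; set b := evalv (psi 2 1) _ in E1 E2.
have cy j : cmx y 2 j = cmx x 2 j + rc (u 0 j) by rewrite !mxE ?eqxx rmorphD.
rewrite !cy !mulrDr E1 in E2; move/addrI in E2.
have ab : (a != 0) || (b != 0).
  have : (e == 0) || (e == 1) by case: e {pe} nz1 => [[|[|]]].
  by case/orP => /eqP e0; move: nz1; rewrite e0 => ->; rewrite ?orbT.
case/negP: nz2; apply/eqP.
have [a0|a0] := eqVneq a 0.
  move: ab E1 E2; rewrite a0 eqxx /= !mul0r => b0 /esym/eqP + /esym/eqP.
  rewrite !mulf_eq0 !(negPf b0) /= => /eqP -> /eqP ->.
  by rewrite mulr0 oppr0 mul0r addr0.
apply: (mulfI a0); rewrite mulr0.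
transitivity (cmx x 2 0 * (a * rc (u 0 1)) - (a * cmx x 2 1) * rc (u 0 0)); first by ring.
by rewrite E1 E2; ring.
Qed.

End NoLinearInverse.

(** * Construction of the normal form *)

Section NormalFormExists.
Variable K : numFieldType.

Lemma det2 (M : 'M[K]_2) : \det M = M 0 0 * M 1 1 - M 0 1 * M 1 0.
Proof.
rewrite (expand_det_row _ 0) sum_I2 /cofactor !det_mx11 !mxE /= expr0 expr1 mul1r mulN1r mulrN.
by congr (_ * M _ _ - _ * M _ _); apply: val_inj.
Qed.

Lemma complete2 (l0 l1 : K) : (l0 != 0) || (l1 != 0) ->
  exists h : 'M[K]_2, [/\ h \in unitmx, h 0 0 = l0 & h 1 0 = l1].
Proof.
pose h (b d : K) : 'M[K]_2 := \matrix_(i, j) (if j == 0 then (if i == 0 then l0 else l1)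
                                   else (if i == 0 then b else d)).
have hE b d : \det (h b d) = l0 * d - b * l1 by rewrite det2 !mxE.
have [l00|l00] := eqVneq l0 0 => /= l1n.
  exists (h 1 0); rewrite unitmxE hE !mxE /= l00 mul0r mul1r sub0r unitfE oppr_eq0.
  by split.
exists (h 0 1); rewrite unitmxE hE !mxE /= mulr1 mul0r subr0 unitfE.
by split.
Qed.

Lemma complete4 (X0 X1 X2 : 'rV[K]_4) :
  (forall a b c, a *: X0 + b *: X1 + c *: X2 = 0 -> [/\ a = 0, b = 0 & c = 0]) ->
  exists X3, lin4 X0 X1 X2 X3 \in unitmx.
Proof.
move=> ind; pose N : 'M[K]_(3, 4) := \matrix_i [:: X0; X1; X2]`_i.
have [i ni] : exists i, ~~ ((delta_mx 0 i : 'rV[K]_4) <= N)%MS.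
  apply: contrapT => nex; have : (1%:M <= N)%MS.
    apply/row_subP => i; rewrite row1; apply: contrapT => /negP ni; apply: nex.
    by exists i.
  by move/mxrankS; rewrite mxrank1 => /leq_trans/(_ (rank_leq_row N)).
exists (delta_mx 0 i); rewrite -row_free_unit; apply: inj_row_free.
elim/vec4_ind => a b c d; rewrite mul_lin4 => E.
have d0 : d = 0.
  apply: contraNeq ni => d0; apply/submxP.
  exists (\row_j [:: - a / d; - b / d; - c / d]`_j).
  have -> : delta_mx 0 i = (- d^-1) *: (a *: X0 + b *: X1 + c *: X2).
    apply: (scalerI d0); rewrite scalerA mulrN mulfV // scaleN1r.
    by apply/eqP; rewrite -addr_eq0 addrC E.
  rewrite mulmx_sum_row !big_ord_recl big_ord0 addr0 !rowK !mxE /= !scalerDr !scalerA -!addrA.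
  by congr (_ *: _ + (_ *: _ + _ *: _)); field.
move: E; rewrite d0 scale0r addr0 => /ind[-> -> ->].
by apply: eq_vec4; rewrite vec4E mxE.
Qed.

Section Dot.
Variable w : 'rV[K]_ncoef.
Local Notation phi := (tri_map w).

Lemma dot_tri X x : dot (phi x) X =
  \sum_a \sum_b \sum_c x 0 a * x 1 b * x 2 c * dot (tcoef w a b c) X.
Proof.
rewrite tri_map_sum dot_sum; apply: eq_bigr => a _; rewrite dot_sum.
by apply: eq_bigr => b _; rewrite dot_sum; apply: eq_bigr => c _; rewrite dotZl.
Qed.

Lemma pencil0 L0 L1 :
  (forall x, dot (phi x) L0 * x 0 1 = dot (phi x) L1 * x 0 0) ->
  exists al : 'I_2 -> 'I_2 -> K, forall (x : 'M[K]_(3, 2)) (A := \sum_b \sum_c x 1 b * x 2 c * al b c),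
    dot (phi x) L0 = x 0 0 * A /\ dot (phi x) L1 = x 0 1 * A.
Proof.
move=> HL; pose c0 a b c := dot (tcoef w a b c) L0; pose c1 a b c := dot (tcoef w a b c) L1.
have H b c s0 s1 : (s0 * c0 0 b c + s1 * c0 1 b c) * s1 = (s0 * c1 0 b c + s1 * c1 1 b c) * s0.
  have := HL (mk6 s0 s1 (b == 0)%:R (b == 1)%:R (c == 0)%:R (c == 1)%:R).
  rewrite !dot_tri !sum_I2 !mk6E -/(c0 _ _ _) -/(c1 _ _ _).
  by move: b c; do 2!apply: forall_I2; rewrite /= ?(mulr0, mulr1, mul0r, addr0, add0r).
have z1 b c : c1 0 b c = 0.
  by have := H b c 1 0; rewrite !(mul0r, mul1r, mulr0, mulr1, addr0) => <-.
have z0 b c : c0 1 b c = 0.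
  by have := H b c 0 1; rewrite !(mul0r, mul1r, mulr0, mulr1, add0r) => ->.
have z b c : c1 1 b c = c0 0 b c.
  by have := H b c 1 1; rewrite !mul1r !mulr1 z1 z0 add0r addr0.
exists (c0 0) => x A; rewrite /A !dot_tri !sum_I2 -!/(c0 _ _ _) -!/(c1 _ _ _) !z1 !z0 !z.
by split; ring.
Qed.

Lemma pencil1 M0 M1 :
  (forall x, dot (phi x) M0 * x 1 1 = dot (phi x) M1 * x 1 0) ->
  exists be : 'I_2 -> 'I_2 -> K, forall (x : 'M[K]_(3, 2)) (B := \sum_a \sum_c x 0 a * x 2 c * be a c),
    dot (phi x) M0 = x 1 0 * B /\ dot (phi x) M1 = x 1 1 * B.
Proof.
move=> HM; pose c0 a b c := dot (tcoef w a b c) M0; pose c1 a b c := dot (tcoef w a b c) M1.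
have H a c s0 s1 : (s0 * c0 a 0 c + s1 * c0 a 1 c) * s1 = (s0 * c1 a 0 c + s1 * c1 a 1 c) * s0.
  have := HM (mk6 (a == 0)%:R (a == 1)%:R s0 s1 (c == 0)%:R (c == 1)%:R).
  rewrite !dot_tri !sum_I2 !mk6E -/(c0 _ _ _) -/(c1 _ _ _).
  by move: a c; do 2!apply: forall_I2; rewrite /= ?(mulr0, mulr1, mul0r, mul1r, addr0, add0r).
have z1 a c : c1 a 0 c = 0.
  by have := H a c 1 0; rewrite !(mul0r, mul1r, mulr0, mulr1, addr0) => <-.
have z0 a c : c0 a 1 c = 0.
  by have := H a c 0 1; rewrite !(mul0r, mul1r, mulr0, mulr1, add0r) => ->.
have z a c : c1 a 1 c = c0 a 0 c.
  by have := H a c 1 1; rewrite !mul1r !mulr1 z1 z0 add0r addr0.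
exists (fun a c => c0 a 0 c) => x B; rewrite /B !dot_tri !sum_I2.
rewrite -!/(c0 _ _ _) -!/(c1 _ _ _) !z1 !z0 !z.
by split; ring.
Qed.

Lemma trilinear_reparam (h : 'I_3 -> 'M[K]_2) (T : 'I_2 -> 'I_2 -> 'I_2 -> K) :
  (forall l, h l \in unitmx) -> exists T' : 'I_2 -> 'I_2 -> 'I_2 -> K,
  forall (x : 'M[K]_(3, 2)) (y := reparam 1 h x),
    \sum_a \sum_b \sum_c x 0 a * x 1 b * x 2 c * T a b c =
    \sum_a \sum_b \sum_c y 0 a * y 1 b * y 2 c * T' a b c.
Proof.
move=> uh; pose k l := invmx (h l).
exists (fun a b c => \sum_a' \sum_b' \sum_c' k 0 a a' * k 1 b b' * k 2 c c' * T a' b' c') => x y.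
have xE l j : x l j = y l 0 * k l 0 j + y l 1 * k l 1 j.
  have : row l x = row l y *m k l by rewrite row_reparam perm1 mulmxK.
  by move=> /rowP/(_ j); rewrite mxE mxE sum_I2 !mxE.
rewrite !sum_I2 !xE; ring.
Qed.

End Dot.

Lemma normal_form_exists (w : 'rV[K]_ncoef) (phi := tri_map w) (L0 L1 M0 M1 : 'rV[K]_4) :
  (forall x, dot (phi x) L0 * x 0 1 = dot (phi x) L1 * x 0 0) ->
  (exists x, dot (phi x) L0 != 0 \/ dot (phi x) L1 != 0) ->
  (forall x, dot (phi x) M0 * x 1 1 = dot (phi x) M1 * x 1 0) ->
  (exists x, dot (phi x) M0 != 0 \/ dot (phi x) M1 != 0) ->
  (forall l0 l1, (forall x, dot (phi x) l0 * x 2 1 = dot (phi x) l1 * x 2 0) -> l0 = 0 /\ l1 = 0) ->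
  (forall u : 'rV[K]_2, u != 0 -> exists x, row 2 x = u /\ phi x != 0) ->
  exists g h d00 d10 d01 d11 e00 e10 e01 e11,
    [/\ g \in unitmx, (forall l, h l \in unitmx),
        (forall x, phi x = nf d00 d10 d01 d11 e00 e10 e01 e11 (reparam 1 h x) *m g),
        (d11 != 0) || (e11 != 0) &
        [|| e00 != 0, e10 != 0, e01 != 0 | e11 != 0]].
Proof.
move=> HL HL0 HM HM0 NL F4.
have [al Hal] := pencil0 HL; have [be Hbe] := pencil1 HM.
pose A (x : 'M[K]_(3, 2)) := \sum_b \sum_c x 1 b * x 2 c * al b c.
pose B (x : 'M[K]_(3, 2)) := \sum_a \sum_c x 0 a * x 2 c * be a c.
have dL0 x : dot (phi x) L0 = x 0 0 * A x by case: (Hal x).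
have dL1 x : dot (phi x) L1 = x 0 1 * A x by case: (Hal x).
have dM0 x : dot (phi x) M0 = x 1 0 * B x by case: (Hbe x).
have dM1 x : dot (phi x) M1 = x 1 1 * B x by case: (Hbe x).
have [xA Ax] : exists x, A x != 0.
  by have [x [|]] := HL0; rewrite ?dL0 ?dL1 mulf_eq0 negb_or => /andP[_ nz]; exists x.
have [xB Bx] : exists x, B x != 0.
  by have [x [|]] := HM0; rewrite ?dM0 ?dM1 mulf_eq0 negb_or => /andP[_ nz]; exists x.
(* Along phi the product [A * B] expands as the sum over c of u_c times the left side, and also as
   the sum of u_c times the right side. The two differences form a linear pair for u, so [NL]
   annihilates them. *)
have rel c : al 0 c *: M0 + al 1 c *: M1 = be 0 c *: L0 + be 1 c *: L1.
  pose l0 := al 0 1 *: M0 + al 1 1 *: M1 + (-1) *: (be 0 1 *: L0 + be 1 1 *: L1).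
  pose l1 := be 0 0 *: L0 + be 1 0 *: L1 + (-1) *: (al 0 0 *: M0 + al 1 0 *: M1).
  have [] : l0 = 0 /\ l1 = 0.
    apply: NL => x; rewrite /l0 /l1 !(dotDr, dotZr) dL0 dL1 dM0 dM1 /A /B !sum_I2; ring.
  rewrite /l0 /l1 !scaleN1r => /eqP + /eqP; rewrite !subr_eq0 => /eqP E1 /eqP E0.
  by move: c; apply: forall_I2.
have [c0 muP] : exists c, (al 0 c != 0) || (al 1 c != 0).
  apply: contrapT => nex; case/negP: Ax; rewrite /A !sum_I2.
  have z c : al 0 c = 0 /\ al 1 c = 0.
    by split; apply: contrapT => /eqP nz; apply: nex; exists c; rewrite nz ?orbT.
  by rewrite !(z _).1 !(z _).2 !mulr0 !addr0.
pose mu0 := al 0 c0; pose mu1 := al 1 c0; pose la0 := be 0 c0; pose la1 := be 1 c0.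
(* For c = c0 this separates the variables: mu(t) B(s,u) = la(s) A(t,u). Fixing t with mu(t) = 1, or
   s with la(s) = 1, extracts the factors. *)
have AB (x : 'M[K]_(3, 2)) : (x 1 0 * mu0 + x 1 1 * mu1) * B x = (x 0 0 * la0 + x 0 1 * la1) * A x.
  transitivity (dot (phi x) (al 0 c0 *: M0 + al 1 c0 *: M1)).
    by rewrite dotDr !dotZr dM0 dM1 /mu0 /mu1; ring.
  by rewrite rel dotDr !dotZr dL0 dL1 /la0 /la1; ring.
have [t [t' tmu]] : exists t t', t * mu0 + t' * mu1 = 1.
  case/orP: muP => nz; [exists mu0^-1, 0|exists 0, mu1^-1];
    by rewrite mul0r ?addr0 ?add0r mulVf.
have Bsu (x y : 'M[K]_(3, 2)) : row 0 x = row 0 y -> row 2 x = row 2 y -> B x = B y.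
  by move=> E0 E2; rewrite /B !sum_I2 !(row_entry _ E0) !(row_entry _ E2).
have Atu (x y : 'M[K]_(3, 2)) : row 1 x = row 1 y -> row 2 x = row 2 y -> A x = A y.
  by move=> E0 E2; rewrite /A !sum_I2 !(row_entry _ E0) !(row_entry _ E2).
have laP : (la0 != 0) || (la1 != 0).
  rewrite -negb_and; apply/negP => /andP[/eqP l0 /eqP l1]; case/negP: Bx; apply/eqP.
  pose x := mk6 (xB 0 0) (xB 0 1) t t' (xB 2 0) (xB 2 1).
  have <- : B x = B xB by apply: Bsu; apply/rowP; apply: forall_I2; rewrite !mxE.
  by have := AB x; rewrite l0 l1 !mulr0 addr0 mul0r /x !mk6E tmu mul1r.
have [s [s' sla]] : exists s s', s * la0 + s' * la1 = 1.
  case/orP: laP => nz; [exists la0^-1, 0|exists 0, la1^-1];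
    by rewrite mul0r ?addr0 ?add0r mulVf.
(* The common factor C(u) is [B] evaluated at the chosen s with la(s) = 1. *)
pose ga c := s * be 0 c + s' * be 1 c.
pose Cu (x : 'M[K]_(3, 2)) := x 2 0 * ga 0 + x 2 1 * ga 1.
have AE (x : 'M[K]_(3, 2)) : A x = (x 1 0 * mu0 + x 1 1 * mu1) * Cu x.
  pose y := mk6 s s' (x 1 0) (x 1 1) (x 2 0) (x 2 1).
  have -> : A x = A y by apply: Atu; apply/rowP; apply: forall_I2; rewrite !mxE.
  have := AB y; rewrite /y !mk6E sla mul1r => <-; congr (_ * _).
  by rewrite /B /Cu !sum_I2 !mk6E /ga; ring.
have BE (x : 'M[K]_(3, 2)) : B x = (x 0 0 * la0 + x 0 1 * la1) * Cu x.
  pose y := mk6 (x 0 0) (x 0 1) t t' (x 2 0) (x 2 1).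
  have -> : B x = B y by apply: Bsu; apply/rowP; apply: forall_I2; rewrite !mxE.
  by have := AB y; rewrite AE /Cu /y !mk6E tmu !mul1r.
have gaP : (ga 0 != 0) || (ga 1 != 0).
  rewrite -negb_and; apply: contraNN Ax => /andP[/eqP l0 /eqP l1].
  by rewrite AE /Cu l0 l1 !mulr0 addr0 mulr0.
(* The new coordinates s0, t0 and u0 are the linear forms la(s), mu(t) and C(u). *)
have [hs [us hs0 hs1]] := complete2 laP.
have [ht [ut ht0 ht1]] := complete2 (muP : (mu0 != 0) || (mu1 != 0)).
have [hu [uu hu0 hu1]] := complete2 gaP.
pose h (l : 'I_3) : 'M[K]_2 := [:: hs; ht; hu]`_l.
have uh l : h l \in unitmx by move: l; apply: forall_I3.
have yE (x : 'M[K]_(3, 2)) l j : reparam 1 h x l j = x l 0 * h l 0 j + x l 1 * h l 1 j.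
  by rewrite mxE mxE sum_I2 perm1 !mxE.
pose X0 := la0 *: L0 + la1 *: L1.
pose X1 := hs 0 1 *: L0 + hs 1 1 *: L1.
pose X2 := ht 0 1 *: M0 + ht 1 1 *: M1.
have dX0 (x : 'M[K]_(3, 2)) (y := reparam 1 h x) : dot (phi x) X0 = y 0 0 * y 1 0 * y 2 0.
  by rewrite /y !yE /h /= hs0 hs1 ht0 ht1 hu0 hu1 dotDr !dotZr dL0 dL1 AE /Cu; ring.
have dX1 (x : 'M[K]_(3, 2)) (y := reparam 1 h x) : dot (phi x) X1 = y 0 1 * y 1 0 * y 2 0.
  by rewrite /y !yE /h /= ht0 ht1 hu0 hu1 dotDr !dotZr dL0 dL1 AE /Cu; ring.
have dX2 (x : 'M[K]_(3, 2)) (y := reparam 1 h x) : dot (phi x) X2 = y 0 0 * y 1 1 * y 2 0.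
  by rewrite /y !yE /h /= hs0 hs1 hu0 hu1 dotDr !dotZr dM0 dM1 BE /Cu; ring.
have dot0 v : dot v 0 = 0 :> K by rewrite /dot big1 // => i _; rewrite mxE mulr0.
(* Along phi the forms [X0], [X1], [X2] are u0 times distinct monomials in s and t, hence
   independent. *)
have [X3 uN] : exists X3, lin4 X0 X1 X2 X3 \in unitmx.
  apply: complete4 => a b c E.
  have H (y : 'M[K]_(3, 2)) : y 2 0 * (a * (y 0 0 * y 1 0) + b * (y 0 1 * y 1 0) + c * (y 0 0 * y 1 1)) = 0.
    have [x [_ <-]] := reparam_inv 1 y uh.
    by rewrite -(dot0 (phi x)) -E !dotDr !dotZr dX0 dX1 dX2; ring.
  have := H (mk6 1 0 1 0 1 0); have := H (mk6 0 1 1 0 1 0); have := H (mk6 1 0 0 1 1 0).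
  by rewrite !mk6E !(mulr0, mulr1, mul0r, mul1r, addr0, add0r).
have [T TE] := trilinear_reparam (fun a b c => dot (tcoef w a b c) X3) uh.
have dX3 (x : 'M[K]_(3, 2)) (y := reparam 1 h x) : dot (phi x) X3 =
    y 2 0 * (T 0 0 0 * (y 0 0 * y 1 0) + T 1 0 0 * (y 0 1 * y 1 0)
           + T 0 1 0 * (y 0 0 * y 1 1) + T 1 1 0 * (y 0 1 * y 1 1))
  + y 2 1 * (T 0 0 1 * (y 0 0 * y 1 0) + T 1 0 1 * (y 0 1 * y 1 0)
           + T 0 1 1 * (y 0 0 * y 1 1) + T 1 1 1 * (y 0 1 * y 1 1)).
  by rewrite dot_tri TE !sum_I2 /y; ring.
pose N := lin4 X0 X1 X2 X3.
have uNT : N^T \in unitmx by rewrite unitmx_tr.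
have phiN (x : 'M[K]_(3, 2)) : phi x *m N^T = nf (T 0 0 0) (T 1 0 0) (T 0 1 0) (T 1 1 0)
    (T 0 0 1) (T 1 0 1) (T 0 1 1) (T 1 1 1) (reparam 1 h x).
  have cE j : (phi x *m N^T) 0 j = dot (phi x) (row j N).
    by rewrite mxE; apply: eq_bigr => i _; rewrite !mxE.
  by apply: eq_vec4; rewrite cE rowK vec4E /= ?dX0 ?dX1 ?dX2 ?dX3.
exists (invmx N^T), h, (T 0 0 0), (T 1 0 0), (T 0 1 0), (T 1 1 0),
  (T 0 0 1), (T 1 0 1), (T 0 1 1), (T 1 1 1); split=> //.
- by rewrite unitmx_inv.
- by move=> x; rewrite -phiN mulmxK.
(* Without a term in s1 t1, both d and e are expressed through x0, x1 and x2: then [l0] takes the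
   value u0 e and [l1] the value u1 e, both up to the same factor u0, a linear inverse for u
   excluded by [NL]. *)
- rewrite -negb_and; apply/negP => /andP[/eqP d11 /eqP e11].
  have NL' l0 l1 : (forall x : 'M[K]_(3, 2), dot (phi x) l0 * reparam 1 h x 2 1 = dot (phi x) l1 * reparam 1 h x 2 0) ->
      l0 = 0 /\ l1 = 0.
    move=> H; pose k := hu.
    have [E1 E2] : k 1 1 *: l0 + (- k 1 0) *: l1 = 0 /\ k 0 0 *: l1 + (- k 0 1) *: l0 = 0.
      apply: NL => x; have := H x; rewrite !yE /h /= -/k !(dotDr, dotZr) => Hx.
      apply/eqP; rewrite -subr_eq0; apply/eqP.
      transitivity (dot (phi x) l0 * (x 2 0 * k 0 1 + x 2 1 * k 1 1)
                  - dot (phi x) l1 * (x 2 0 * k 0 0 + x 2 1 * k 1 0)); first by ring.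
      by rewrite Hx subrr.
    have dk : \det k != 0 by rewrite -unitfE -unitmxE.
    have dkE : \det k = k 0 0 * k 1 1 - k 0 1 * k 1 0 by rewrite det2.
    split; apply: (scalerI dk); rewrite scaler0 dkE.
      transitivity (k 0 0 *: (k 1 1 *: l0 + (- k 1 0) *: l1)
                  + k 1 0 *: (k 0 0 *: l1 + (- k 0 1) *: l0)).
        by apply/rowP => i; rewrite !mxE; ring.
      by rewrite E1 E2 !scaler0 addr0.
    transitivity (k 0 1 *: (k 1 1 *: l0 + (- k 1 0) *: l1)
                + k 1 1 *: (k 0 0 *: l1 + (- k 0 1) *: l0)).
      by apply/rowP => i; rewrite !mxE; ring.
    by rewrite E1 E2 !scaler0 addr0.
  pose l0 := T 0 0 1 *: X0 + T 1 0 1 *: X1 + T 0 1 1 *: X2.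
  pose l1 := (- T 0 0 0) *: X0 + (- T 1 0 0) *: X1 + (- T 0 1 0) *: X2 + 1 *: X3.
  have [_ l10] : l0 = 0 /\ l1 = 0.
    apply: NL' => x; rewrite /l0 /l1 !dotDr !dotZr dX0 dX1 dX2 dX3 d11 e11; ring.
  have : vec4 (- T 0 0 0) (- T 1 0 0) (- T 0 1 0) 1 *m N = 0 by rewrite mul_lin4.
  move/(canRL (mulmxK uN)); rewrite mul0mx => /(congr1 (fun v : 'rV_4 => v 0 3)).
  by rewrite vec4E mxE => /eqP; rewrite oner_eq0.
(* If e = 0, then phi vanishes on the whole fibre over the preimage of u = (0 : 1), against [F4]. *)
- rewrite -!negb_and; apply/negP => /and4P[/eqP z00 /eqP z10 /eqP z01 /eqP z11].
  pose u : 'rV[K]_2 := delta_mx 0 1 *m invmx hu.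
  have u0 : u != 0.
    rewrite mulmx_unit_neq0 ?unitmx_inv //; apply/eqP => /rowP/(_ 1).
    by rewrite !mxE !eqxx => /eqP; rewrite oner_eq0.
  have [x [xu /eqP]] := F4 u u0; apply.
  have : row 2 (reparam 1 h x) = delta_mx 0 1.
    by rewrite row_reparam perm1 xu /h /= /u mulmxKV.
  move=> /rowP E; have := E 0; rewrite mxE [RHS]mxE /= => y0.
  apply/eqP; rewrite -[_ == 0]negbK -(mulmx_unit_neq0 _ uNT).
  rewrite phiN /nf y0 z00 z10 z01 z11 !(mulr0, mul0r, addr0) negbK.
  by rewrite vec4_eq0 eqxx.
Qed.

End NormalFormExists.

(** * Reduction to the five forms *)

Section Equivalent.
Variable K : numFieldType.
Implicit Types phi : 'M[K]_(3, 2) -> 'rV[K]_4.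

Definition equivalent phi phi' : Prop :=
  exists (h : 'I_3 -> 'M[K]_2) (g : 'M[K]_4),
    [/\ forall l, h l \in unitmx, g \in unitmx & forall x, phi x = phi' (reparam 1 h x) *m g].

Lemma equivalent_trans phi1 phi2 phi3 :
  equivalent phi1 phi2 -> equivalent phi2 phi3 -> equivalent phi1 phi3.
Proof.
move=> [h [g [uh ug E]]] [h' [g' [uh' ug' E']]].
exists (fun l => h l *m h' l), (g' *m g); split.
- by move=> l; rewrite unitmx_mul uh uh'.
- by rewrite unitmx_mul ug' ug.
move=> x; rewrite E E' -mulmxA; congr (phi3 _ *m _).
by apply/row_matrixP => l; rewrite !row_reparam !perm1 mulmxA.
Qed.

Definition shear (p a : K) : 'M[K]_2 := \matrix_(i, j) nth 0 (nth [::] [:: [:: 1; p]; [:: 0; a]] i) j.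

Lemma shear_unit p a : a != 0 -> shear p a \in unitmx.
Proof. by move=> a0; rewrite unitmxE det2 !mxE /= mulr0 subr0 mul1r unitfE. Qed.

(* New coordinates s1' = p s0 + a s1, t1' = q t0 + b t1, u1' = r u0 + c u1, and
   x3' = k x3 modulo x0, x1, x2. *)
Lemma nf_change p a q b r c k d00 d10 d01 d11 e00 e10 e01 e11 d11' e00' e10' e01' e11' :
  a != 0 -> b != 0 -> c != 0 -> k != 0 ->
  k * e11 = c * a * b * e11' ->
  k * e10 = c * a * (e10' + q * e11') ->
  k * e01 = c * b * (e01' + p * e11') ->
  k * e00 = c * (e00' + p * e10' + q * e01' + p * q * e11') ->
  k * d11 = a * b * (d11' + r * e11') ->
  equivalent (nf d00 d10 d01 d11 e00 e10 e01 e11) (nf 0 0 0 d11' e00' e10' e01' e11').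
Proof.
move=> a0 b0 c0 k0 E11 E10 E01 E00 D11.
(* The multiples of the old x1, x2 and x0 removed from the new x3; they absorb [d10], [d01] and
   [d00]. *)
pose l1 := a * q * d11' + r * a * (e10' + q * e11') - k * d10.
pose l2 := b * p * d11' + r * b * (e01' + p * e11') - k * d01.
pose l0 := p * q * d11' + r * (e00' + p * e10' + q * e01' + p * q * e11') - k * d00.
pose g := lin4 (vec4 1 (- p / a) (- q / b) (- (l0 - l1 * p / a - l2 * q / b) / k))
  (vec4 0 a^-1 0 (- l1 / (a * k))) (vec4 0 0 b^-1 (- l2 / (b * k))) (vec4 0 0 0 k^-1).
have gE y0 y1 y2 y3 : vec4 y0 y1 y2 y3 *m g = vec4 y0 ((y1 - p * y0) / a) ((y2 - q * y0) / b)
    ((y3 - l0 * y0 - l1 * ((y1 - p * y0) / a) - l2 * ((y2 - q * y0) / b)) / k).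
  rewrite mul_lin4; apply: eq_vec4; rewrite !mxE /=; [ring|field|field|field];
    by rewrite ?a0 ?b0 ?k0.
pose h (l : 'I_3) := [:: shear p a; shear q b; shear r c]`_l.
exists h, g; split.
- by apply: forall_I3; exact: shear_unit.
- pose gi := lin4 (vec4 1 p q l0) (vec4 0 a 0 l1) (vec4 0 0 b l2) (vec4 0 0 0 k).
  apply: (@unit_of_inverse _ _ gi) => y0 y1 y2 y3.
  rewrite gE mul_lin4; apply: eq_vec4; rewrite !mxE /=; [ring|field|field|field];
    by rewrite ?a0 ?b0 ?k0.
move=> x; pose y := reparam 1 h x.
have y0 l : y l 0 = x l 0.
  by rewrite /y mxE mxE sum_I2 perm1 !mxE /h; move: l; apply: forall_I3; rewrite /= !mxE /= mulr1 mulr0 addr0.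
have y1 : (y 0 1 = p * x 0 0 + a * x 0 1) * (y 1 1 = q * x 1 0 + b * x 1 1)
        * (y 2 1 = r * x 2 0 + c * x 2 1).
  by rewrite /y !mxE !sum_I2 !perm1 !mxE /h /= !(mulrC (x _ _)).
rewrite -/y /nf !y0 !y1 gE; congr vec4; [field; exact: a0|field; exact: b0|].
apply: (mulfI k0); rewrite !mul0r !add0r.
transitivity (x 2 0 * (k * d00 * (x 0 0 * x 1 0) + k * d10 * (x 0 1 * x 1 0)
    + k * d01 * (x 0 0 * x 1 1) + (k * d11) * (x 0 1 * x 1 1))
    + x 2 1 * ((k * e00) * (x 0 0 * x 1 0) + (k * e10) * (x 0 1 * x 1 0)
             + (k * e01) * (x 0 0 * x 1 1) + (k * e11) * (x 0 1 * x 1 1))); first by ring.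
rewrite E11 E10 E01 E00 D11 /l0 /l1 /l2; field; by rewrite ?a0 ?b0 ?k0.
Qed.

(** [nfB2] with s and t exchanged; this is where the classification permutes the factors. *)
Definition nfB2s : 'M[K]_(3, 2) -> 'rV[K]_4 := nf 0 0 0 1 0 0 1 0.

Lemma cong_nfB2s : cong nfB2s 1 = pbp (gsw K) (cong (@nfB2 K) 0) /\
  cong nfB2s 0 = pbp (gsw K) (cong (@nfB2 K) 1).
Proof. exact: (@cong_swap K nfB2s (@nfB2 K) (nf_swap 0 0 0 1 0 0 1 0)). Qed.

Lemma nf_det_neq0 d00 d10 d01 d11 e00 e10 e01 e11 (phi := nf d00 d10 d01 d11 e00 e10 e01 e11) :
  (d11 != 0) || (e11 != 0) -> e00 * e11 - e10 * e01 != 0 ->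
  equivalent phi (@nfA1 K) \/ equivalent phi (@nfB1 K).
Proof.
move=> de D; have [e0|e0] := eqVneq e11 0; [right|left].
  move: de D; rewrite e0 eqxx orbF mulr0 sub0r oppr_eq0 mulf_eq0 negb_or => d0 /andP[e10n e01n].
  (* Normalizing [e10] and [e01] to 1 sets [a = k e10] and [b = k e01]; then [k d11 = a b]
     determines [k]. *)
  pose k := d11 / (e10 * e01).
  have kn : k != 0 by rewrite mulf_neq0 ?invr_eq0 ?mulf_neq0.
  apply: (@nf_change (k * e00) (k * e10) 0 (k * e01) 0 1 k);
    rewrite ?e0 ?mulf_neq0 ?oner_neq0 ?invr_eq0 ?mulf_neq0 //; try by ring.
  by rewrite /k; field; rewrite e10n e01n.
(* With [p = k e01] and [q = e10 / e11], the equation for [e00] reads [k e00 = 1 + p q]. The shift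
   [r = d11 / e11] of u1 removes [d11]. *)
pose k := (e00 - e10 * e01 / e11)^-1.
have D' : e00 - e10 * e01 / e11 != 0.
  by apply: contraNneq D => E; rewrite -[e00](subrK (e10 * e01 / e11)) E add0r mulfVK ?subrr.
have kn : k != 0 by rewrite invr_eq0.
apply: (@nf_change (k * e01) (k * e11) (e10 / e11) 1 (d11 / e11) 1 k);
  rewrite ?oner_neq0 ?mulf_neq0 //.
- by ring.
- by field.
- by ring.
- by rewrite /k; field; rewrite e0 /=; move: D; rewrite (mulrC e10).
- by field.
Qed.

(** When e has rank 1, [e11 != 0] leads to s1 t1. If [e11 = 0], then e10 e01 = 0, and the vanishing
    of [e10] and [e01] decides between the last three forms; there [d11] is nonzero and is scaled to
    1. *)
Lemma nf_cases d00 d10 d01 d11 e00 e10 e01 e11 (phi := nf d00 d10 d01 d11 e00 e10 e01 e11) :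
  (d11 != 0) || (e11 != 0) -> [|| e00 != 0, e10 != 0, e01 != 0 | e11 != 0] ->
  [\/ equivalent phi (@nfA1 K), equivalent phi (@nfA0 K), equivalent phi (@nfB1 K)
    | [\/ equivalent phi (@nfB2 K), equivalent phi nfB2s | equivalent phi (@nfB3 K)]].
Proof.
move=> de en; have [D|D] := eqVneq (e00 * e11 - e10 * e01) 0; last first.
  by have [] := nf_det_neq0 d00 d10 d01 de D => H; [apply: Or41|apply: Or43].
move/eqP: D; rewrite subr_eq0 => /eqP D; have o1 := oner_neq0 K.
have [e0|e0] := eqVneq e11 0; last first.
  apply: Or42; apply: (@nf_change (e01 / e11) 1 (e10 / e11) 1 (d11 / e11) 1 e11^-1);
    rewrite ?invr_eq0 //; try by field.
  by rewrite -[e00](mulfK e0) D; field.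
move: de D en; rewrite e0 eqxx orbF mulr0 orbF => d0 /esym/eqP; rewrite mulf_eq0.
have [z10|z10] := eqVneq e10 0; have [z01|z01] := eqVneq e01 0 => // _; rewrite ?orbF => en;
  apply: Or44.
- by apply: Or33; apply: (@nf_change 0 1 0 d11 0 e00 1); rewrite ?z10 ?z01 ?e0 //; ring.
- apply: Or32; apply: (@nf_change 0 (d11 / e01) (e00 / e01) 1 0 1 e01^-1);
    rewrite ?z10 ?e0 ?mulf_neq0 ?invr_eq0 //; try by field.
- apply: Or31; apply: (@nf_change (e00 / e10) 1 0 (d11 / e10) 0 1 e10^-1);
    rewrite ?z01 ?e0 ?mulf_neq0 ?invr_eq0 //; try by field.
Qed.

End Equivalent.

(** * Trilinear maps and extension of scalars *)

Section Trilinear.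
Variable K : numFieldType.
Implicit Types phi : 'M[K]_(3, 2) -> 'rV[K]_4.

Definition trilinear phi : Prop := exists T : 'I_2 -> 'I_2 -> 'I_2 -> 'rV[K]_4,
  forall x, phi x = \sum_a \sum_b \sum_c (x 0 a * x 1 b * x 2 c) *: T a b c.

Definition vertex (a b c : 'I_2) : 'M[K]_(3, 2) :=
  mk6 (a == 0)%:R (a == 1)%:R (b == 0)%:R (b == 1)%:R (c == 0)%:R (c == 1)%:R.

(** The values at the eight vertices are the coefficients. As the vertices are real, an identity
    over [R] between trilinear maps extends to [R[i]]. *)
Lemma trilinear_ext phi phi' : trilinear phi -> trilinear phi' ->
  (forall a b c, phi (vertex a b c) = phi' (vertex a b c)) -> forall x, phi x = phi' x.
Proof.
move=> [T TE] [T' TE'] E x; rewrite TE TE'.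
have TT a b c : T a b c = T' a b c.
  have := E a b c; rewrite TE TE' !sum_I2 /vertex !mk6E.
  by move: a b c; do 3!apply: forall_I2;
    rewrite /= !(mulr0, mul0r, mulr1, scale0r, scale1r, addr0, add0r).
by apply: eq_bigr => a _; apply: eq_bigr => b _; apply: eq_bigr => c _; rewrite TT.
Qed.

Lemma trilinear_nf d00 d10 d01 d11 e00 e10 e01 e11 :
  trilinear (nf d00 d10 d01 d11 e00 e10 e01 e11).
Proof.
exists (fun a b c => nf d00 d10 d01 d11 e00 e10 e01 e11 (vertex a b c)) => x.
by rewrite !sum_I2 /vertex /nf !mk6E /=; apply: eq_vec4; rewrite !mxE /=; ring.
Qed.

Lemma trilinear_equiv phi (h : 'I_3 -> 'M[K]_2) (g : 'M[K]_4) : trilinear phi ->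
  trilinear (fun x => phi (reparam 1 h x) *m g).
Proof.
move=> [T TE]; exists (fun a b c => (\sum_a' \sum_b' \sum_c'
  (h 0 a a' * h 1 b b' * h 2 c c') *: T a' b' c') *m g) => x.
rewrite TE !sum_I2 !scalemxAl -!mulmxDl; congr (_ *m g).
have xE l j : reparam 1 h x l j = x l 0 * h l 0 j + x l 1 * h l 1 j.
  by rewrite mxE mxE sum_I2 perm1 !mxE.
by rewrite !xE; apply/rowP => i; rewrite !mxE; ring.
Qed.

End Trilinear.

(** * Classification of the real maps *)

Section PartTwo.
Variable R : realType.
Local Notation C := R[i].
Local Notation rc := (real_complex R).
Variable w : 'rV[R]_ncoef.

Lemma cmx_reparam (h : 'I_3 -> 'M[R]_2) x :
  cmx (reparam 1 h x) = reparam 1 (fun l => cmx (h l)) (cmx x).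
Proof. by apply/row_matrixP => l; rewrite -map_row !row_reparam map_mxM map_row. Qed.

Lemma cmx_nf (d00 d10 d01 d11 e00 e10 e01 e11 : R) x :
  cmx (nf d00 d10 d01 d11 e00 e10 e01 e11 x) =
  nf (rc d00) (rc d10) (rc d01) (rc d11) (rc e00) (rc e10) (rc e01) (rc e11) (cmx x).
Proof. by rewrite cmx_vec4 /nf !mxE !(rmorphM, rmorphD). Qed.

Lemma cmx_vertex a b c : cmx (vertex R a b c) = vertex C a b c.
Proof.
by apply/matrixP; apply: forall_I3; apply: forall_I2; rewrite !mxE /= rmorph_nat.
Qed.

Lemma cong_equivalent (d00 d10 d01 d11 e00 e10 e01 e11 : R) :
  equivalent (tri_map w) (nf d00 d10 d01 d11 e00 e10 e01 e11) ->
  exists2 g : 'M[R]_4, g \in unitmx & forall k, param_congruence (cplx w) k =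
    pbp (cmx g) (cong (nf (rc d00) (rc d10) (rc d01) (rc d11) (rc e00) (rc e10) (rc e01) (rc e11)) k).
Proof.
move=> [h [g [uh ug E]]]; exists (invmx g); rewrite ?unitmx_inv // => k.
rewrite param_congruenceE cmx_inv -{1}[k](perm1 k).
apply: (cong_equiv (h := fun l => cmx (h l))); rewrite ?cmx_unit //.
  by move=> l; rewrite cmx_unit.
apply: trilinear_ext.
- by exists (tcoef (cplx w)); exact: tri_map_sum.
- by apply: trilinear_equiv; exact: trilinear_nf.
by move=> a b c; rewrite -cmx_vertex tri_map_cplx E cmxM cmx_nf cmx_reparam.
Qed.

Lemma birational_normal_form : real_birational_maps R type112 w ->
  exists d00 d10 d01 d11 e00 e10 e01 e11,
    [/\ equivalent (tri_map w) (nf d00 d10 d01 d11 e00 e10 e01 e11),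
        (d11 != 0) || (e11 != 0) & [|| e00 != 0, e10 != 0, e01 != 0 | e11 != 0]].
Proof.
move=> [_ [psi [inv hom cop]]].
have [L0 [L1 [HL HL0]]] := real_pencil inv hom (k := 0) erefl.
have [M0 [M1 [HM HM0]]] := real_pencil inv hom (k := 1) erefl.
have [g [h [d00 [d10 [d01 [d11 [e00 [e10 [e01 [e11 [ug uh E de en]]]]]]]]]]] :=
  normal_form_exists HL HL0 HM HM0 (no_linear_inverse inv hom cop) (row2_nonconstant inv).
by exists d00, d10, d01, d11, e00, e10, e01, e11; split=> //; exists h, g.
Qed.

Lemma classified_eq (S S' T T' : set 'rV[C]_6) :
  S = S' -> T = T' -> classified S' T' -> classified S T.
Proof. by move=> -> ->. Qed.

Lemma classified_nfB2s : classified (cong (@nfB2s C) 1) (cong (@nfB2s C) 0).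
Proof.
have [ET ES] := cong_nfB2s C; have Eg X := congr1 (fun g => pbp g X) (@cmx_gsw R).
apply: (classified_eq (etrans ET (esym (Eg _))) (etrans ES (esym (Eg _)))).
by apply: classified_pb; [exact: gsw_unit|exact: classified_nfB2].
Qed.

Lemma classification : real_birational_maps R type112 w ->
  exists p : {perm 'I_3},
    classified (param_congruence (cplx w) (p 0)) (param_congruence (cplx w) (p 1)).
Proof.
move=> /birational_normal_form[d00 [d10 [d01 [d11 [e00 [e10 [e01 [e11 [eqv de en]]]]]]]]].
have tr phi' := equivalent_trans (phi3 := phi') eqv.
have id_perm g phi' : g \in unitmx -> (forall k, param_congruence (cplx w) k = pbp (cmx g) (cong phi' k)) ->
    classified (cong phi' 0) (cong phi' 1) ->
    exists p : {perm 'I_3},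
    classified (param_congruence (cplx w) (p 0)) (param_congruence (cplx w) (p 1)).
  by move=> ug E H; exists 1%g; rewrite !perm1 !E; exact: classified_pb.
case: (nf_cases d00 d10 d01 de en) => [/tr|/tr|/tr|[/tr|/tr|/tr]] /cong_equivalent[g ug];
  rewrite ?rmorph0 ?rmorph1 => E.
- by apply: id_perm E _ => //; exact: classified_nfA1.
- by apply: id_perm E _ => //; exact: classified_nfA0.
- by apply: id_perm E _ => //; exact: classified_nfB1.
- by apply: id_perm E _ => //; exact: classified_nfB2.
- exists (tperm 0 1); rewrite tpermL tpermR !E; apply: (classified_pb ug).
  exact: classified_nfB2s.
- by apply: id_perm E _ => //; exact: classified_nfB3.
Qed.

End PartTwo.

(** * General maps *)

Section Resultant.
Variable S : comPzRingType.
Implicit Type c : 'I_2 -> 'I_2 -> 'I_2 -> S.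

(* For fixed u, a trilinear form is a bilinear form in s and t, whose determinant is
   the binary quadratic form [quad0 u0^2 + quad1 u0 u1 + quad2 u1^2]. *)
Definition quad0 c := c 0 0 0 * c 1 1 0 - c 0 1 0 * c 1 0 0.
Definition quad1 c := c 0 0 0 * c 1 1 1 + c 0 0 1 * c 1 1 0 - (c 0 1 0 * c 1 0 1 + c 0 1 1 * c 1 0 0).
Definition quad2 c := c 0 0 1 * c 1 1 1 - c 0 1 1 * c 1 0 1.

(** The Sylvester resultant of two binary quadratic forms, written with the 2 by 2 minors of their
    coefficients. *)
Definition quad_resultant c c' :=
  (quad0 c * quad2 c' - quad0 c' * quad2 c) * (quad0 c * quad2 c' - quad0 c' * quad2 c)
  - (quad0 c * quad1 c' - quad0 c' * quad1 c) * (quad1 c * quad2 c' - quad1 c' * quad2 c).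

Lemma quad_det c u0 u1 (f := fun a b => u0 * c a b 0 + u1 * c a b 1) :
  quad0 c * u0 ^+ 2 + quad1 c * (u0 * u1) + quad2 c * u1 ^+ 2 = f 0 0 * f 1 1 - f 0 1 * f 1 0.
Proof. by rewrite /f /quad0 /quad1 /quad2; ring. Qed.

End Resultant.

Lemma rmorph_quad_resultant (S S' : comPzRingType) (f : {rmorphism S -> S'}) c c' :
  f (quad_resultant c c') =
  quad_resultant (fun i j k => f (c i j k)) (fun i j k => f (c' i j k)).
Proof. by rewrite /quad_resultant /quad0 /quad1 /quad2 !(rmorphB, rmorphM, rmorphD). Qed.

Lemma quad_resultant_eq0 (K : fieldType) (c c' : 'I_2 -> 'I_2 -> 'I_2 -> K) u0 u1 :
  (u0 != 0) || (u1 != 0) ->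
  quad0 c * u0 ^+ 2 + quad1 c * (u0 * u1) + quad2 c * u1 ^+ 2 = 0 ->
  quad0 c' * u0 ^+ 2 + quad1 c' * (u0 * u1) + quad2 c' * u1 ^+ 2 = 0 ->
  quad_resultant c c' = 0.
Proof.
rewrite /quad_resultant; move: (quad0 c) (quad1 c) (quad2 c) (quad0 c') (quad1 c') (quad2 c').
move=> A B C A' B' C' u_nz E E'.
(* Eliminating each coefficient pair in turn gives relations between these minors, up to factors u0
   and u1. The cases u0 = 0 and u1 = 0 are treated apart, since those factors must be cancelled. *)
pose X := A * B' - A' * B; pose Y := A * C' - A' * C; pose Z := B * C' - B' * C.
have h1 : u1 * (X * u0 + Y * u1) = 0.
  transitivity (A * (A' * u0 ^+ 2 + B' * (u0 * u1) + C' * u1 ^+ 2)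
              - A' * (A * u0 ^+ 2 + B * (u0 * u1) + C * u1 ^+ 2)); first by rewrite /X /Y; ring.
  by rewrite E E' !mulr0 subrr.
have h2 : u0 * (Y * u0 + Z * u1) = 0.
  transitivity (C' * (A * u0 ^+ 2 + B * (u0 * u1) + C * u1 ^+ 2)
              - C * (A' * u0 ^+ 2 + B' * (u0 * u1) + C' * u1 ^+ 2)); first by rewrite /Z /Y; ring.
  by rewrite E E' !mulr0 subrr.
have h3 : X * u0 ^+ 2 = Z * u1 ^+ 2.
  apply/eqP; rewrite -subr_eq0; apply/eqP.
  transitivity (B' * (A * u0 ^+ 2 + B * (u0 * u1) + C * u1 ^+ 2)
              - B * (A' * u0 ^+ 2 + B' * (u0 * u1) + C' * u1 ^+ 2)); first by rewrite /X /Z; ring.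
  by rewrite E E' !mulr0 subrr.
rewrite -/X -/Y -/Z; have [u00|u00] := eqVneq u0 0.
  move: u_nz h1 h3; rewrite u00 eqxx /= => u10 /eqP.
  rewrite mulr0 add0r !mulf_eq0 (negPf u10) orbF /= => /eqP ->.
  move=> /eqP; rewrite expr0n mulr0 eq_sym mulf_eq0 expf_eq0 (negPf u10) orbF => /eqP ->.
  by rewrite !mulr0 subrr.
have [u10|u10] := eqVneq u1 0.
  move: h2 h3; rewrite u10 mulr0 addr0 expr0n mulr0 => /eqP.
  rewrite !mulf_eq0 (negPf u00) /= orbF => /eqP -> /eqP.
  by rewrite mulf_eq0 expf_eq0 (negPf u00) orbF => /eqP ->; rewrite !mul0r subrr.
move/eqP: h1; rewrite mulf_eq0 (negPf u10) addr_eq0 => /eqP h1.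
move/eqP: h2; rewrite mulf_eq0 (negPf u00) addr_eq0 => /eqP h2.
apply: (mulfI (mulf_neq0 u00 u10)); rewrite mulr0.
transitivity ((Y * u0) * (Y * u1) - (X * u0) * (Z * u1)); first by ring.
by rewrite h1 h2; ring.
Qed.

(** * The open set of general maps *)

Section PartOne.
Variable R : realType.
Local Notation C := R[i].

Definition coef_var (i : 'I_4) (a b c : 'I_2) : {mpoly R[ncoef]} :=
  'X_(mxvec_index i (enum_rank (index3 a b c))).

(** For [nfA1] each of x0, x1, x2 has rank one in s and t, so its determinant is identically zero;
    but x1 + x2 has determinant - u0^2 and x3 has determinant u1^2, without common root. Hence the
    choice of components 3 and 1 + 2. *)
Definition generic_form : {mpoly R[ncoef]} :=
  quad_resultant (coef_var 3) (fun a b c => coef_var 1 a b c + coef_var 2 a b c).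

Lemma dhomog_generic_form : generic_form \is 8.-homog.
Proof.
have X1 i a b c : coef_var i a b c \is 1.-homog by exact: dhomogX1.
have Q f : (forall a b c, f a b c \is 1.-homog) ->
    [/\ quad0 f \is 2.-homog, quad1 f \is 2.-homog & @quad2 {mpoly R[ncoef]} f \is 2.-homog].
  by move=> f1; split; apply: rpredB; try apply: rpredD; apply: (@dhomogM _ _ _ 1 _ 1).
have [a0 a1 a2] := Q _ (X1 3).
have [b0 b1 b2] : let f a b c := coef_var 1 a b c + coef_var 2 a b c in
    [/\ quad0 f \is 2.-homog, quad1 f \is 2.-homog & quad2 f \is 2.-homog].
  by apply: Q => a b c; apply: rpredD; exact: X1.
by apply: rpredB; apply: (@dhomogM _ _ _ 4 _ 4); apply: rpredB; apply: (@dhomogM _ _ _ 2 _ 2).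
Qed.

Lemma eval_generic_form (w : 'rV[R]_ncoef) : evalv generic_form w =
  quad_resultant (fun a b c => tcoef w a b c 0 3)
                 (fun a b c => tcoef w a b c 0 1 + tcoef w a b c 0 2).
Proof.
have E i a b c : meval (w 0) (coef_var i a b c) = tcoef w a b c 0 i by rewrite mevalXU mxE.
rewrite /evalv rmorph_quad_resultant; congr quad_resultant;
  apply/funext => a; apply/funext => b; apply/funext => c; first exact: E.
exact: etrans (rmorphD _ _ _) (congr2 _ (E _ _ _ _) (E _ _ _ _)).
Qed.

(** At the [u] sent to (0 : 1), phi is e(s,t) times the last row of [g]. If det e = 0, this [u] is a
    common root of the determinants of all components, and the resultant vanishes. *)
Lemma generic_form_det (w : 'rV[R]_ncoef) (h : 'I_3 -> 'M[R]_2) (g : 'M[R]_4)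
    d00 d10 d01 d11 e00 e10 e01 e11 : (forall l, h l \in unitmx) ->
  (forall x, tri_map w x = nf d00 d10 d01 d11 e00 e10 e01 e11 (reparam 1 h x) *m g) ->
  e00 * e11 - e10 * e01 = 0 -> evalv generic_form w = 0.
Proof.
move=> uh E D; rewrite eval_generic_form.
pose u : 'rV[R]_2 := delta_mx 0 1 *m invmx (h 2).
have delta (M : 'M[R]_2) a j : (a == 0)%:R * M 0 j + (a == 1)%:R * M 1 j = M a j.
  by move: a; apply: forall_I2; rewrite /= !(mul0r, mul1r, addr0, add0r).
have u_nz : (u 0 0 != 0) || (u 0 1 != 0).
  have : u != 0.
    rewrite mulmx_unit_neq0 ?unitmx_inv //; apply/eqP => /rowP/(_ 1).
    by rewrite !mxE !eqxx => /eqP; rewrite oner_eq0.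
  rewrite -negb_and; apply: contraNN => /andP[/eqP h0 /eqP h1].
  by apply/eqP/rowP; apply: forall_I2; rewrite ?h0 ?h1 mxE.
pose F a b := e00 * (h 0 a 0 * h 1 b 0) + e10 * (h 0 a 1 * h 1 b 0)
              + e01 * (h 0 a 0 * h 1 b 1) + e11 * (h 0 a 1 * h 1 b 1).
(* Substituting [h 0] and [h 1] multiplies the determinant of e by theirs, and the scalar [m]
   contributes its square. *)
have quadE (c : 'I_2 -> 'I_2 -> 'I_2 -> R) m :
    (forall a b, u 0 0 * c a b 0 + u 0 1 * c a b 1 = F a b * m) ->
    quad0 c * u 0 0 ^+ 2 + quad1 c * (u 0 0 * u 0 1) + quad2 c * u 0 1 ^+ 2 = 0.
  move=> fE; rewrite quad_det /= !fE /F.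
  transitivity (m ^+ 2 * (e00 * e11 - e10 * e01)
    * (h 0 0 0 * h 0 1 1 - h 0 0 1 * h 0 1 0) * (h 1 0 0 * h 1 1 1 - h 1 0 1 * h 1 1 0)); first by ring.
  by rewrite D mulr0 !mul0r.
  have fE i a b : u 0 0 * tcoef w a b 0 0 i + u 0 1 * tcoef w a b 1 0 i = F a b * g 3 i.
    pose x := mk6 (a == 0)%:R (a == 1)%:R (b == 0)%:R (b == 1)%:R (u 0 0) (u 0 1).
    transitivity (tri_map w x 0 i).
      rewrite tri_map_sum !sum_I2 /x !mk6E !mxE; clear x; move: a b; do 2!apply: forall_I2;
        by rewrite /= !(mulr0, mul0r, mul1r, mulr1, addr0, add0r).
    have x2 : row 2 (reparam 1 h x) = delta_mx 0 1.
      have -> : delta_mx 0 1 = u *m h 2 :> 'rV_2 by rewrite mulmxKV.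
      rewrite row_reparam perm1; congr (_ *m _).
      by apply/rowP; apply: forall_I2; rewrite !mxE.
    have z0 : reparam 1 h x 2 0 = 0 by have /rowP/(_ 0) := x2; rewrite mxE => ->; rewrite mxE.
    have z1 : reparam 1 h x 2 1 = 1 by have /rowP/(_ 1) := x2; rewrite mxE => ->; rewrite mxE.
    have y0 j : reparam 1 h x 0 j = h 0 a j.
      by rewrite mxE mxE sum_I2 perm1 !mxE /= delta.
    have y1 j : reparam 1 h x 1 j = h 1 b j.
      by rewrite mxE mxE sum_I2 perm1 !mxE /= delta.
    rewrite E /nf z0 z1 !y0 !y1 mxE sum_I4 !vec4E /F; ring.
apply: (quad_resultant_eq0 u_nz).
  exact: (quadE _ (g 3 3) (fE 3)).
apply: (quadE _ (g 3 1 + g 3 2)) => a b.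
by rewrite [RHS]mulrDr -!fE; ring.
Qed.

(** [zeros] omits the zero vector, so lying outside it yields a nonzero value of the form only once
    [w] is known to be nonzero. *)
Lemma birational_neq0 (w : 'rV[R]_ncoef) : real_birational_maps R type112 w -> w != 0.
Proof.
move=> [_ [psi [inv _ _]]]; have u0 : (delta_mx 0 0 : 'rV[R]_2) != 0.
  by apply/eqP => /rowP/(_ 0)/eqP; rewrite !mxE oner_eq0.
have [x [_]] := row2_nonconstant inv u0; apply: contraNneq => ->.
rewrite tri_mapE big1 // => j _; apply/rowP => i; rewrite !mxE /coef mxE mulr0 //.
Qed.

Lemma general_normal_form (w : 'rV[R]_ncoef) : real_birational_maps R type112 w ->
  evalv generic_form w != 0 ->
  equivalent (tri_map w) (@nfA1 R) \/ equivalent (tri_map w) (@nfB1 R).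
Proof.
move=> /birational_normal_form[d00 [d10 [d01 [d11 [e00 [e10 [e01 [e11 [[h [g [uh ug E]]] de _]]]]]]]]] F0.
have eqv : equivalent (tri_map w) (nf d00 d10 d01 d11 e00 e10 e01 e11) by exists h, g.
have D : e00 * e11 - e10 * e01 != 0.
  by apply: contraNneq F0 => D; apply/eqP; exact: (generic_form_det uh E).
have [H|H] := nf_det_neq0 d00 d10 d01 de D; [left|right]; exact: equivalent_trans eqv H.
Qed.

End PartOne.

(** * Reality of the focal configuration *)

Section Configuration.
Variable R : realType.
Local Notation C := R[i].
Local Notation axis := (@coord_line C).

Lemma coplanar_axes (K : numFieldType) : coplanar (@coord_line K 0 1) (@coord_line K 0 2).
Proof.
exists [set v : 'rV[K]_4 | v != 0 /\ v 0 0 = 0]; last by split=> v [v0 [h0 _]].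
pose M : 'M[K]_(3, 4) := \matrix_(i, j) (j == i.+1 :> nat)%:R.
have ME (u : 'rV[K]_3) : u *m M = vec4 0 (u 0 0) (u 0 1) (u 0 2).
  apply: eq_vec4; rewrite !mxE !big_ord_recl big_ord0 !mxE /= ?(mulr0, mulr1, addr0, add0r) //;
    by congr (u _ _); apply: val_inj.
exists M.
  apply: inj_row_free => u; rewrite ME => /eqP; rewrite vec4_eq0 eqxx /= => /and3P[/eqP h0 /eqP h1 /eqP h2].
  by apply/rowP; apply: forall_I3; rewrite [RHS]mxE.
apply/seteqP; split=> v [v0 Hv]; split=> //.
  apply/submxP; exists (\row_i v 0 (lift 0 i)); rewrite ME !mxE.
  by apply: eq_vec4; rewrite vec4E //; congr (v _ _); apply: val_inj.
by have /submxP[u ->] := Hv; rewrite ME vec4E.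
Qed.

Variables (w : 'rV[R]_ncoef) (g : 'M[R]_4) (phi : 'M[C]_(3, 2) -> 'rV[C]_4) (c : set 'rV[C]_4).
Hypothesis ug : g \in unitmx.
Hypothesis wE : forall k, param_congruence (cplx w) k = pbp (cmx g) (cong phi k).
Hypothesis fS : focal_curves (cong phi 0) = [set axis 0 2; c].
Hypothesis fT : focal_curves (cong phi 1) = [set axis 0 1; c].

Let ucg : cmx g \in unitmx. Proof. by rewrite cmx_unit. Qed.

Lemma focal_curves_param :
  focal_curves (param_congruence (cplx w) 0) = [set pb (cmx g) (axis 0 2); pb (cmx g) c] /\
  focal_curves (param_congruence (cplx w) 1) = [set pb (cmx g) (axis 0 1); pb (cmx g) c].
Proof. by rewrite !wE !focal_curves_pb // (pb_set2 ucg fS) (pb_set2 ucg fT). Qed.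

(** Each of the three curves is a focal curve of S or of T, and all focal curves of S and T are
    real; so the curves need not be matched individually. *)
Lemma real_configuration a b c' : is_real c -> focal_configuration w a b c' ->
  [/\ is_real a, is_real b & is_real c'].
Proof.
move=> rc [_ [_ [H _]]]; have [ES ET] := focal_curves_param.
have rS v : focal_curves (param_congruence (cplx w) 0) v -> is_real v.
  by rewrite ES => -[->|->]; apply: is_real_pb => //; exact: is_real_coord_line.
have rT v : focal_curves (param_congruence (cplx w) 1) v -> is_real v.
  by rewrite ET => -[->|->]; apply: is_real_pb => //; exact: is_real_coord_line.
by case: H => -[HS HT]; split; [apply: rS|apply: rT|apply: rS|apply: rT|apply: rS|apply: rS];
  rewrite ?HS ?HT; by [left|right].
Qed.

Lemma configuration_exists : focal_points (cong phi 2) = [set @apex C] ->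
  is_plane_conic c -> is_point (axis 0 1 `&` c) -> is_point (axis 0 2 `&` c) ->
  exists a b c', focal_configuration w a b c'.
Proof.
move=> fU pc p1 p2; exists (pb (cmx g) (axis 0 1)), (pb (cmx g) (axis 0 2)), (pb (cmx g) c).
have [ES ET] := focal_curves_param.
split; [split|split; [split|split]].
- by apply: is_flat_pb => //; exact: is_line01.
- by apply: is_flat_pb => //; exact: is_line02.
- by move=> /(pb_inj ucg); exact: axis01_02.
- have [H hH [s1 s2]] := coplanar_axes C.
  exists (pb (cmx g) H); first exact: (is_flat_pb ucg hH).
  by split; exact: pb_sub.
- exact: plane_conic_pb.
- exact: (is_flat_pb ucg p1).
- exact: (is_flat_pb ucg p2).
- by right.
by rewrite wE focal_points_pb // (pb_set1 ucg fU) axis_meet.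
Qed.

End Configuration.

Section General.
Variable R : realType.
Local Notation C := R[i].
Local Notation axis := (@coord_line C).

Lemma is_real_conicA : is_real (@conicA C).
Proof. by rewrite /conicA -cmx_gA; apply: is_real_pb; exact: is_real_std_conic. Qed.

Lemma is_real_conicB : is_real (@conicB C).
Proof. by rewrite /conicB -cmx_gB; apply: is_real_pb; exact: is_real_std_conic. Qed.

Lemma is_point_eq (v : 'rV[C]_4) X : v != 0 -> X = point_of v -> is_point X.
Proof. by move=> v0 ->; apply/is_pointP; exists v. Qed.

Lemma e4_pt (k : 'I_4) (v : 'rV[C]_4) : v != 0 -> (forall j, j != k -> v 0 j = 0) ->
  point_of (e4 C k) v.
Proof.
move=> v0 H; have E : v = v 0 k *: e4 C k.
  apply/rowP => j; rewrite mxE e4E; have [->|jk] := eqVneq j k; first by rewrite mulr1.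
  by rewrite mulr0 H.
by exists (v 0 k) => //; apply: contraNneq v0 => z; rewrite E z scale0r.
Qed.

Lemma conicA_axes : is_point (axis 0 1 `&` @conicA C) /\ is_point (axis 0 2 `&` @conicA C).
Proof.
split.
  apply: (@is_point_eq (e4 C 2)); first exact: e4_neq0.
  apply/seteqP; split=> v.
    move=> [[v0 [h0 h1]] /conicAE[_ [h3 _]]]; apply: e4_pt => //.
    by apply: forall_I4.
  move=> [k k0 ->]; have kv0 : k *: e4 C 2 != 0 by rewrite scaler_eq0 negb_or k0 e4_neq0.
  by split; [split|apply/conicAE; split]; rewrite ?mxE //= ?(mulr0, oppr0, mul0r).
apply: (@is_point_eq (e4 C 1)); first exact: e4_neq0.
apply/seteqP; split=> v.
  move=> [[v0 [h0 h1]] /conicAE[_ [h3 _]]]; apply: e4_pt => //.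
  by apply: forall_I4.
move=> [k k0 ->]; have kv0 : k *: e4 C 1 != 0 by rewrite scaler_eq0 negb_or k0 e4_neq0.
by split; [split|apply/conicAE; split]; rewrite ?mxE //= ?(mulr0, oppr0, mul0r).
Qed.

(** Both lines meet the conic in the apex alone, which still gives points of intersection: maps
    whose conic passes through the apex also satisfy the configuration. *)
Lemma conicB_axes : is_point (axis 0 1 `&` @conicB C) /\ is_point (axis 0 2 `&` @conicB C).
Proof.
split.
  apply: (@is_point_eq (e4 C 3)); first exact: e4_neq0.
  apply/seteqP; split=> v.
    move=> [[v0 [h0 h1]] /conicBE[_ [h3 _]]]; apply: e4_pt => //.
    by apply: forall_I4 => //; rewrite h1 add0r in h3.
  move=> [k k0 ->]; have kv0 : k *: e4 C 3 != 0 by rewrite scaler_eq0 negb_or k0 e4_neq0.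
  by split; [split|apply/conicBE; split]; rewrite ?mxE //= ?(mulr0, oppr0, mul0r, addr0).
apply: (@is_point_eq (e4 C 3)); first exact: e4_neq0.
apply/seteqP; split=> v.
  move=> [[v0 [h0 h1]] /conicBE[_ [h3 _]]]; apply: e4_pt => //.
  by apply: forall_I4 => //; rewrite h1 addr0 in h3.
move=> [k k0 ->]; have kv0 : k *: e4 C 3 != 0 by rewrite scaler_eq0 negb_or k0 e4_neq0.
by split; [split|apply/conicBE; split]; rewrite ?mxE //= ?(mulr0, oppr0, mul0r, addr0).
Qed.

Lemma general_configuration (w : 'rV[R]_ncoef) : real_birational_maps R type112 w ->
  evalv (generic_form R) w != 0 ->
  (exists a b c : set 'rV[C]_4, focal_configuration w a b c) /\
  (forall a b c : set 'rV[C]_4, focal_configuration w a b c ->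
     [/\ is_real a, is_real b & is_real c]).
Proof.
move=> wB wF; have [] := general_normal_form wB wF => /cong_equivalent[g ug];
  rewrite ?rmorph0 ?rmorph1 => E.
  have [fS fT] := focal_curves_nfA1 C; split.
    apply: (configuration_exists ug E fS fT).
    - apply: focal_points_nf; rewrite ?(addr0, add0r, mulr0, mulr1).
        by rewrite -(natrD _ 1 1) pnatr_eq0.
      by rewrite -(natrD _ 1 2) pnatr_eq0.
    - by apply: plane_conic_pb; [exact: gA_unit|exact: plane_conic_std].
    - exact: (conicA_axes).1.
    - exact: (conicA_axes).2.
  by move=> a b c; apply: (real_configuration ug E fS fT); exact: is_real_conicA.
have [fS fT] := focal_curves_nfB1 C; split.
  apply: (configuration_exists ug E fS fT).
  - apply: focal_points_nf; rewrite ?(addr0, add0r, mulr0, mulr1).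
      by rewrite -(natrD _ 1 1) pnatr_eq0.
    by rewrite -(natrD _ 1 2) pnatr_eq0.
  - by apply: plane_conic_pb; [exact: gB_unit|exact: plane_conic_std].
  - exact: (conicB_axes).1.
  - exact: (conicB_axes).2.
by move=> a b c; apply: (real_configuration ug E fS fT); exact: is_real_conicB.
Qed.

End General.

(** * Divisors of products of variables *)

Section CommonFactor.
Variables (K : numFieldType) (n : nat).
Implicit Types p q g h : {mpoly K[n]}.

Definition drop_var (i : 'I_n) : n.-tuple {mpoly K[n]} :=
  [tuple (if j == i then 0 else 'X_j) | j < n].

Lemma eval_drop_var i p (v : 'I_n -> K) :
  (p \mPo drop_var i).@[v] = p.@[fun j => if j == i then 0 else v j].
Proof.
rewrite comp_mpoly_meval; apply: meval_eq => j; rewrite tnth_mktuple.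
by case: eqP => _; rewrite ?meval0 ?mevalXU.
Qed.

Lemma divides_sub_drop_var i p : exists h, p - (p \mPo drop_var i) = 'X_i * h.
Proof.
elim/mpoly_ring_ind: p => [a|j|p q [h ph] [h' qh]|p q [h ph] [h' qh]].
- by exists 0; rewrite comp_mpolyC subrr mulr0.
- rewrite comp_mpolyXU -tnth_nth tnth_mktuple; case: eqP => [->|_].
    by exists 1; rewrite subr0 mulr1.
  by exists 0; rewrite subrr mulr0.
- by exists (h + h'); rewrite comp_mpolyD mulrDr -ph -qh; ring.
- exists (h * q + (p \mPo drop_var i) * h'); rewrite comp_mpolyM mulrDr mulrA -ph.
  by rewrite mulrCA -qh; ring.
Qed.

Lemma drop_varX i : 'X_i \mPo drop_var i = 0 :> {mpoly K[n]}.
Proof. by rewrite comp_mpolyXU -tnth_nth tnth_mktuple eqxx. Qed.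

Lemma unit_mpolyC g h : g * h = 1 -> exists2 k : K, k != 0 & g = k%:MP.
Proof.
move=> gh; have g0 : g != 0 by apply: contra_eq_neq gh => ->; rewrite mul0r eq_sym oner_eq0.
have h0 : h != 0 by apply: contra_eq_neq gh => ->; rewrite mulr0 eq_sym oner_eq0.
have : msize (g * h) = 1%N by rewrite gh msizeC oner_eq0.
rewrite msizeM // => sz; have sg : (msize g <= 1)%N.
  by move: g0 h0 sz; rewrite -!msize_poly_eq0; move: (msize g) (msize h) => a b; lia.
have gE := msize1_polyC sg; exists g@_0 => //.
by apply: contraNneq g0 => z; rewrite gE z.
Qed.

(** Setting a variable to zero kills the product but, by hypothesis, not [g]; so it kills [h], and
    the variable can be cancelled from [h]. At the end [g] divides 1. *)
Lemma divides_vars (s : seq 'I_n) g h : g * h = \prod_(i <- s) 'X_i ->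
  (forall i, i \in s -> exists v : 'I_n -> K, v i = 0 /\ g.@[v] != 0) ->
  exists2 k : K, k != 0 & g = k%:MP.
Proof.
elim: s h => [|i s IH] h; first by rewrite big_nil => /unit_mpolyC.
rewrite big_cons => gh Hs; have [v [vi gv]] := Hs i (mem_head i s).
have /eqP : (g \mPo drop_var i) * (h \mPo drop_var i) = 0.
  by rewrite -comp_mpolyM gh comp_mpolyM drop_varX mul0r.
rewrite mulf_eq0 => /orP[/eqP gz|/eqP hz].
  case/negP: gv; apply/eqP; transitivity ((g \mPo drop_var i).@[v]); last by rewrite gz meval0.
  by rewrite eval_drop_var; apply: meval_eq => j; case: eqP => [->|].
have [h' hE] := divides_sub_drop_var i h; rewrite hz subr0 in hE.
have Xi : 'X_i != 0 :> {mpoly K[n]}.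
  by apply/eqP => /(congr1 (fun p => p@_U_(i)%MM))/eqP; rewrite mcoeffXU eqxx mcoeff0 oner_eq0.
apply: (IH h').
  by apply: (mulfI Xi); rewrite -gh hE; ring.
by move=> j js; apply: Hs; rewrite inE js orbT.
Qed.

End CommonFactor.

(** * A map in the open set *)

Section Witness.
Variable K : numFieldType.

Definition trilinear_coefs (T : 'I_2 -> 'I_2 -> 'I_2 -> 'rV[K]_4) : 'rV[K]_ncoef :=
  mxvec (\matrix_(i, r) (let j := enum_val r : multi_index in T (j 0) (j 1) (j 2) 0 i)).

Lemma tcoef_trilinear T a b c : tcoef (trilinear_coefs T) a b c = T a b c.
Proof. by apply/rowP => i; rewrite mxE /coef mxvecE mxE enum_rankK /= !ffunE. Qed.

(** [nfA1] as a coefficient vector; it shows that the open set is not empty. *)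
Definition witness : 'rV[K]_ncoef := trilinear_coefs (fun a b c => nfA1 (vertex K a b c)).

Lemma tri_map_witness x : tri_map witness x = nfA1 x.
Proof.
move: x; apply: trilinear_ext.
- by exists (tcoef witness); exact: tri_map_sum.
- exact: trilinear_nf.
move=> a b c; rewrite tri_map_sum !sum_I2 /vertex !mk6E !tcoef_trilinear.
by move: a b c; do 3!apply: forall_I2;
  rewrite /= !(mulr0, mul0r, mulr1, scale0r, scale1r, addr0, add0r).
Qed.

Lemma eval_tri_poly (w : 'rV[K]_ncoef) i x : evalv (tri_poly w i) (mxvec x) = tri_map w x 0 i.
Proof. by rewrite mxE. Qed.

Lemma evalv_ext n (p q : {mpoly K[n]}) : (forall v, evalv p v = evalv q v) -> p = q.
Proof.
move=> E; apply/eqP; rewrite -subr_eq0; apply/eqP; apply: mpoly_eval_eq0 => v'.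
have vE (r : {mpoly K[n]}) : r.@[v'] = evalv r (\row_i v' i) by apply: meval_eq => i; rewrite mxE.
by rewrite mevalB !vE E subrr.
Qed.

Lemma evalv_neq0 n (p : {mpoly K[n]}) v : evalv p v != 0 -> p != 0.
Proof. by apply: contraNneq => ->; rewrite /evalv meval0. Qed.

Lemma subst_tri_cross (w : 'rV[K]_ncoef) p q k :
  (forall x, evalv p (tri_map w x) * x k 1 = evalv q (tri_map w x) * x k 0) ->
  subst_tri w p * 'X_(pair_var k 1) = subst_tri w q * 'X_(pair_var k 0).
Proof.
move=> E; apply: evalv_ext => v; rewrite -[v]vec_mxK !evalvM !eval_subst_tri !evalvX.
by rewrite !mxvec_pair.
Qed.

Lemma eval_subst_pairs psi p v :
  evalv (subst_pairs psi p) v = evalv p (mxvec (map_mx (fun q : {mpoly K[4]} => evalv q v) psi)).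
Proof.
rewrite /evalv comp_mpoly_meval; apply: meval_eq => z; rewrite tnth_mktuple.
by case/mxvec_indexP: z => k e; rewrite !mxvecE mxE.
Qed.

(** For [nfA1], both x0^2 + x1 x2 and x0 x3 have the factor s0 t0 u0 (s0 t0 + s1 t1), with cofactors
    u0 and u1. *)
Definition witness_inverse : 'M[{mpoly K[4]}]_(3, 2) := \matrix_(k, e)
  nth 0 (nth [::] [:: [:: 'X_0; 'X_1]; [:: 'X_0; 'X_2];
                      [:: 'X_0 * 'X_0 + 'X_1 * 'X_2; 'X_0 * 'X_3]] k) e.

Lemma eval_witness_inverse v : map_mx (fun q : {mpoly K[4]} => evalv q v) witness_inverse =
  mk6 (v 0 0) (v 0 1) (v 0 0) (v 0 2) (v 0 0 * v 0 0 + v 0 1 * v 0 2) (v 0 0 * v 0 3).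
Proof.
by apply/matrixP; apply: forall_I3; apply: forall_I2;
  rewrite !mxE /= ?evalvD ?evalvM ?evalvX.
Qed.

Lemma eval_inverse k e v : evalv (witness_inverse k e) v =
  mk6 (v 0 0) (v 0 1) (v 0 0) (v 0 2) (v 0 0 * v 0 0 + v 0 1 * v 0 2) (v 0 0 * v 0 3) k e.
Proof. by rewrite -eval_witness_inverse [RHS]mxE. Qed.

Lemma witness_rational_inverse : rational_inverse witness witness_inverse.
Proof.
have comp v i : evalv (subst_pairs witness_inverse (tri_poly witness i)) v =
    v 0 0 * (v 0 0 * v 0 0 + v 0 1 * v 0 2) * v 0 i.
  rewrite eval_subst_pairs eval_tri_poly tri_map_witness eval_witness_inverse /nfA1 /nf !mk6E.
  by move: i; apply: forall_I4; rewrite vec4E; ring.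
split.
(* At this parameter phi is (1, 1, 0, 1), where the first entry of each of the three pairs equals
   1. *)
- move=> k; exists 0; apply: (@evalv_neq0 _ _ (mxvec (mk6 1 1 1 0 1 1))).
  rewrite eval_subst_tri tri_map_witness eval_inverse /nfA1 /nf !mk6E !vec4E.
  by move: k; apply: forall_I3; rewrite !mk6E !(mulr0, mulr1, addr0) oner_neq0.
- move=> k; apply: subst_tri_cross => x; rewrite tri_map_witness !eval_inverse /nfA1 /nf !vec4E.
  by move: k; apply: forall_I3; rewrite !mk6E; ring.
- exists 0; apply: (@evalv_neq0 _ _ (vec4 1 0 0 0)); rewrite comp !vec4E.
  by rewrite !(mulr0, mulr1, addr0) oner_neq0.
- by move=> i j; apply: evalv_ext => v; rewrite !evalvM !comp !evalvX; ring.
Qed.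

Lemma witness_coprime : no_common_factor (tri_poly witness).
Proof.
move=> g Hg; have [h0 E0] := Hg 0.
have pt s0 s1 t0 t1 u0 u1 i (x := mk6 s0 s1 t0 t1 u0 u1) : nfA1 x 0 i != 0 -> evalv g (mxvec x) != 0.
  rewrite -tri_map_witness -eval_tri_poly; have [h ->] := Hg i.
  by apply: contraNneq; rewrite evalvM => ->; rewrite mul0r.
apply: (@divides_vars _ _ [:: pair_var 0 0; pair_var 1 0; pair_var 2 0] _ h0).
  rewrite -E0; apply: evalv_ext => v; rewrite -[v]vec_mxK eval_tri_poly tri_map_witness.
  by rewrite !big_cons big_nil mulr1 !evalvM !evalvX !mxvec_pair /nfA1 /nf vec4E mulrA.
move=> i; rewrite !inE => /or3P[] /eqP ->.
- exists (mxvec (mk6 0 1 1 0 1 0 : 'M[K]_(3, 2)) 0); split; first by rewrite mxvec_pair mk6E.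
  by apply: (pt 0 1 1 0 1 0 1); rewrite /nfA1 /nf vec4E !mk6E !mulr1 oner_neq0.
- exists (mxvec (mk6 1 0 0 1 1 0 : 'M[K]_(3, 2)) 0); split; first by rewrite mxvec_pair mk6E.
  by apply: (pt 1 0 0 1 1 0 2); rewrite /nfA1 /nf vec4E !mk6E !mulr1 oner_neq0.
- exists (mxvec (mk6 1 0 1 0 0 1 : 'M[K]_(3, 2)) 0); split; first by rewrite mxvec_pair mk6E.
  apply: (pt 1 0 1 0 0 1 3); rewrite /nfA1 /nf vec4E !mk6E.
  by rewrite !(mul0r, mulr0, mul1r, addr0, add0r) oner_neq0.
Qed.

Lemma witness_inverse_coprime k : no_common_factor (witness_inverse k).
Proof.
move=> g Hg; have [h0 E0] := Hg 0; have [h1 E1] := Hg 1.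
have pt e v : evalv (witness_inverse k e) v != 0 -> evalv g v != 0.
  by have [h ->] := Hg e; apply: contraNneq; rewrite evalvM => ->; rewrite mul0r.
move: k E0 E1 pt {Hg}; apply: forall_I3 => E0 E1 pt.
- apply: (@divides_vars _ _ [:: 0] _ h0); first by rewrite -E0 mxE big_seq1.
  move=> i; rewrite inE => /eqP ->; exists (vec4 0 1 0 0 0); split; first by rewrite vec4E.
  by apply: (pt 1); rewrite eval_inverse mk6E vec4E oner_neq0.
- apply: (@divides_vars _ _ [:: 0] _ h0); first by rewrite -E0 mxE big_seq1.
  move=> i; rewrite inE => /eqP ->; exists (vec4 0 0 1 0 0); split; first by rewrite vec4E.
  by apply: (pt 1); rewrite eval_inverse mk6E vec4E oner_neq0.
- apply: (@divides_vars _ _ [:: 0; 3] _ h1); first by rewrite -E1 mxE big_cons big_seq1.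
  move=> i; rewrite !inE => /orP[] /eqP ->.
    exists (vec4 0 1 1 0 0); split; first by rewrite vec4E.
    by apply: (pt 0); rewrite eval_inverse mk6E !vec4E mulr0 add0r mulr1 oner_neq0.
  exists (vec4 1 0 0 0 0); split; first by rewrite vec4E.
  by apply: (pt 0); rewrite eval_inverse mk6E !vec4E mulr0 addr0 mulr1 oner_neq0.
Qed.

Lemma witness_birational : birational_of_type type112 witness.
Proof.
split; first exact: witness_coprime.
exists witness_inverse; split; [exact: witness_rational_inverse| |exact: witness_inverse_coprime].
by apply: forall_I3; apply: forall_I2; rewrite mxE /= ?dhomogX1 ?dhomogXX ?rpredD ?dhomogXX.
Qed.

End Witness.

Lemma cplx_witness (R : realType) : cplx (witness R) = witness R[i].
Proof.
rewrite /cplx map_mxvec; congr mxvec; apply/matrixP => i r; rewrite !mxE.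
have := cmx_nf 0 0 0 0 1 0 0 1 (vertex R ((enum_val r : multi_index) 0) ((enum_val r : multi_index) 1) ((enum_val r : multi_index) 2)).
by rewrite cmx_vertex !rmorph0 rmorph1 => /rowP/(_ i); rewrite mxE.
Qed.

Lemma generic_form_witness (R : realType) : evalv (generic_form R) (witness R) != 0.
Proof.
have E1 a b c : tcoef (witness R) a b c 0 1 = (a == 1)%:R * (b == 0)%:R * (c == 0)%:R.
  by rewrite tcoef_trilinear vec4E !mk6E.
have E2 a b c : tcoef (witness R) a b c 0 2 = (a == 0)%:R * (b == 1)%:R * (c == 0)%:R.
  by rewrite tcoef_trilinear vec4E !mk6E.
have E3 a b c : tcoef (witness R) a b c 0 3 =
    (c == 1)%:R * ((a == 0)%:R * (b == 0)%:R + (a == 1)%:R * (b == 1)%:R).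
  by rewrite tcoef_trilinear vec4E !mk6E; ring.
rewrite eval_generic_form /quad_resultant /quad0 /quad1 /quad2 !E1 !E2 !E3 /=.
by rewrite !(mulr0, mul0r, mulr1, addr0, add0r, subr0, sub0r, oppr0, opprK) oner_neq0.
Qed.

Theorem theoremD2 (R : realType) :
  (exists W : set 'rV[R]_ncoef,
     [/\ W !=set0,
         zopen_in (real_birational_maps R type112) W &
         forall w, W w ->
           (exists a b c : set 'rV[R[i]]_4, focal_configuration w a b c) /\
           (forall a b c : set 'rV[R[i]]_4, focal_configuration w a b c ->
              [/\ is_real a, is_real b & is_real c])])
  /\
  (forall w : 'rV[R]_ncoef, real_birational_maps R type112 w ->
     exists (a b O c : set 'rV[R[i]]_4) (p : {perm 'I_3}),
       let S := param_congruence (cplx w) (p 0) in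
       let T := param_congruence (cplx w) (p 1) in
       [/\ is_line a, is_line b, a <> b, is_point O /\ O = a `&` b &
           is_plane_conic c] /\
       [\/ [/\ smooth_plane_conic c, ~ (O `<=` c),
               quadratic S /\ focal_curves S = [set b; c] &
               quadratic T /\ focal_curves T = [set a; c]],
           [/\ smooth_plane_conic c, O `<=` c,
               quadratic S /\ focal_curves S = [set b; c] &
               quadratic T /\ focal_curves T = [set a; c]],
           (exists x y : set 'rV[R[i]]_4,
              [/\ is_line x, is_line y, c = x `|` y &
                  [/\ x <> y, x <> a, x <> b, y <> a & y <> b]] /\
              [/\ hyperbolic_linear S /\ focal_lines S = [set b; x] &
                  hyperbolic_linear T /\ focal_lines T = [set a; y]]) |
           (exists x : set 'rV[R[i]]_4,
              [/\ is_line x, c = x `|` a,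
                  hyperbolic_linear S /\ focal_lines S = [set b; x] &
                  [/\ parabolic_linear T, focal_lines T = [set a] &
                      double_focal_line T a]]) \/
           [/\ c = b `|` a,
               [/\ parabolic_linear S, focal_lines S = [set b] &
                   double_focal_line S b] &
               [/\ parabolic_linear T, focal_lines T = [set a] &
                   double_focal_line T a]]]).
Proof.
split; last by move=> w /classification[p [a [b [O [c H]]]]]; exists a, b, O, c, p.
exists (real_birational_maps R type112 `\` zeros [set generic_form R]); split.
- exists (witness R); split; first by rewrite /real_birational_maps /= cplx_witness; exact: witness_birational.
  by move=> [_ /(_ _ erefl)]; apply/eqP; exact: generic_form_witness.
- exists (zeros [set generic_form R]) => //; exists [set generic_form R]; split=> // _ ->.
  by exists 8; exact: dhomog_generic_form.
move=> w [wB wZ]; apply: general_configuration => //; apply/eqP => w0; apply: wZ.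
by split; [exact: birational_neq0|move=> _ ->].
Qed.
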